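(* Assume in addition: $\succeq$ is a lattice order on $A$ whose join $\vee$ and meet $\wedge$ are continuous; (i) $\mathcal{A}(c)$ is a sublattice of $A$ for each $c$; (ii) $v$ is supermodular in $a$, i.e. $v(c,a\vee a',s,\mu)+v(c,a\wedge a',s,\mu)\ge v(c,a,s,\mu)+v(c,a',s,\mu)$ for all $a,a',c,s,\mu$; (iii) $v$ has increasing differences in $(a,\mu)$, i.e. for $a\succeq a'$ the map $\mu\mapsto v(c,a,s,\mu)-v(c,a',s,\mu)$ is nondecreasing with respect to the stochastic order $\succeq$ on $\Delta_\nu(C\times A)$. Let $\mathcal{S}$ be the interim correlated rationalizable correspondence and define $\bigvee\mathcal{S},\bigwedge\mathcal{S}:C\times\Delta(T)\to A$ by $\bigvee\mathcal{S}(c,\beta)=\sup\mathcal{S}(c,\beta)$ and $\bigwedge\mathcal{S}(c,\beta)=\inf\mathcal{S}(c,\beta)$ in $(A,\succeq)$. Then $\bigvee\mathcal{S}$ and $\bigwedge\mathcal{S}$ are both (interim) Bayes–Nash equilibria.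
   Context: Conventions: for a Polish space $X$, $\Delta(X)$ is the space of Borel probability measures with the weak topology; products carry product topologies. For Polish $X,Y$ and Borel probability $\nu$ on $X$, $\Delta_\nu(X\times Y)$ is the set of Borel probability measures on $X\times Y$ with $X$-marginal $\nu$. Setting: $C$ Polish, $\nu$ a Borel probability measure on $C$, $A$ compact metrizable, $\mathcal{A}:C\to 2^A$ upper hemicontinuous with nonempty compact values, $S$ compact metrizable, $v:C\times A\times S\times\Delta_\nu(C\times A)\to\mathbb{R}$ continuous. Type space $(T,\sigma,\tau)$: $T$ nonempty compact metrizable, $\sigma:T\to S$ and $\tau:T\to\Delta_\nu(C\times\Delta(T))$ continuous. $\phi:\Delta_\nu(C\times\Delta(T)\times A)\to\Delta_\nu(C\times A)$ is the marginal map. For $\mathcal{S}'$ with measurable graph, $\mathcal{D}_{\mathcal{S}'}(t)=\{\kappa\in\Delta_\nu(C\times\Delta(T)\times A):\kappa(\operatorname{graph}\mathcal{S}')=1,\ C\times\Delta(T)\text{-marginal of }\kappa=\tau(t)\}$; for $\mathcal{D}$ with measurable graph, $\mathcal{S}_{\mathcal{D}}(c,\beta)$ is the set of $a\in A$ such that some $\mu\in\Delta(T\times\Delta_\nu(C\times\Delta(T)\times A))$ with $T$-marginal $\beta$ and $\mu(\operatorname{graph}\mathcal{D})=1$ has $a\in\operatorname{argmax}_{a'\in\mathcal{A}(c)}\int v(c,a',\sigma(t),\phi(\kappa))\,\mathrm d\mu(t,\kappa)$. Interim correlated rationalizability: $\mathcal{S}_0(c,\beta)=\mathcal{A}(c)$,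 $\mathcal{S}_{m+1}=\mathcal{S}_{\mathcal{D}_{\mathcal{S}_m}}$, $\mathcal{S}=\bigcap_m\mathcal{S}_m$. Stochastic order: on $C\times A$ put $(c,a)\succeq(c',a')$ iff $c=c'$ and $a\succeq a'$; for $\mu,\mu'\in\Delta_\nu(C\times A)$, $\mu\succeq\mu'$ iff $\int g\,\mathrm d\mu\ge\int g\,\mathrm d\mu'$ for every bounded measurable $\succeq$-nondecreasing $g:C\times A\to\mathbb{R}$. A (symmetric) strategy profile is a measurable $\zeta:C\times\Delta(T)\to A$ with $\zeta(c,\beta)\in\mathcal{A}(c)$; it induces $\zeta^*:\Delta_\nu(C\times\Delta(T))\to\Delta_\nu(C\times\Delta(T)\times A)$, $\zeta^*(\kappa)(B)=\int 1_B(c,\beta,\zeta(c,\beta))\,\mathrm d\kappa(c,\beta)$. $\zeta$ is an (interim) Bayes–Nash equilibrium if for all $c\in C$, $\beta\in\Delta(T)$, $\zeta(c,\beta)\in\operatorname{argmax}_{a\in\mathcal{A}(c)}\int v(c,a,s,\mu)\,\mathrm d\big(\beta\circ(\sigma,\phi\circ\zeta^*\circ\tau)^{-1}\big)(s,\mu)$, where $\beta\circ(\sigma,\phi\circ\zeta^*\circ\tau)^{-1}$ is the pushforward of $\beta$ under $t\mapsto(\sigma(t),\phi(\zeta^*(\tau(t))))$. *)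

(* Defs.v *)
From HB Require Import structures.
From mathcomp Require Import all_boot all_order all_algebra.
From mathcomp Require Import all_classical all_reals all_analysis.
Import Order.TTheory GRing.Theory Num.Theory numFieldNormedType.Exports.
Set Implicit Arguments. Unset Strict Implicit. Unset Printing Implicit Defensive.
Local Open Scope classical_set_scope.
Local Open Scope ring_scope.

(* Binary products of pointed topological spaces are pointed topological
   spaces (product topology); this only registers the join of the existing
   product-topology and pointed instances. *)
HB.instance Definition _ (X Y : ptopologicalType) := Pointed.on (X * Y)%type.

Definition borel (X : ptopologicalType) := g_sigma_algebraType (@open X).

Section Spaces.
Variable R : realType.

Definition metric_for (X : topologicalType) (d : X -> X -> R) : Prop :=
  (forall x y, d x y = 0 <-> x = y) /\
  (forall x y, d x y = d y x) /\
  (forall x y z, d x z <= d x y + d y z) /\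
  (forall U : set X, open U <->
     forall x, U x -> exists e : R, 0 < e /\ [set y | d x y < e] `<=` U).

Definition metrizable (X : topologicalType) : Prop :=
  exists d : X -> X -> R, metric_for d.

Definition complete_metric (X : topologicalType) (d : X -> X -> R) : Prop :=
  forall u : nat -> X,
    (forall e : R, 0 < e -> exists N : nat, forall m n : nat,
        (N <= m)%N -> (N <= n)%N -> d (u m) (u n) < e) ->
    exists x : X, forall e : R, 0 < e ->
        exists N : nat, forall n : nat, (N <= n)%N -> d (u n) x < e.

Definition separable (X : topologicalType) : Prop :=
  exists u : nat -> X, forall U : set X, open U -> U !=set0 -> exists n, U (u n).

Definition polish (X : topologicalType) : Prop :=
  separable X /\ exists d : X -> X -> R, metric_for d /\ complete_metric d.

Definition compact_metrizable (X : topologicalType) : Prop :=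
  compact [set: X] /\ metrizable X.

Definition bcf (X : ptopologicalType) :=
  {f : X -> R | continuous f /\ exists M : R, forall x, `|f x| <= M}.

Definition wev (X : ptopologicalType) (mu : probability (borel X) R)
  : {ptws bcf X -> R} :=
  fun f => fine (\int[mu]_x (sval f x)%:E)%E.

(* Delta(X): Borel probability measures on X with the weak topology, i.e.
   the initial topology making mu |-> \int f dmu continuous for every
   bounded continuous f. *)
Definition Prob (X : ptopologicalType) := initial_topology (@wev X).
HB.instance Definition _ X := Pointed.on (Prob X).

Definition pm {X : ptopologicalType} (mu : Prob X) : probability (borel X) R :=
  mu.

(* pushforward (image) measure of mu under a Borel measurable f;
   (default value, never used in the statement when f is measurable) *)
Definition pf (X Y : ptopologicalType) (mu : Prob X) (f : X -> Y) : Prob Y :=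
  match pselect (@measurable_fun _ _ (borel X) (borel Y) setT f) with
  | left mf =>
      Probability.clone _ _ _ (distribution (pm mu) (mfun_Sub (mem_set mf))) _
  | right _ => Probability.clone _ _ _ (@dirac _ (borel Y) point R) _
  end.

Definition has_marg1 (X Y : ptopologicalType) (mu : Prob (X * Y)%type)
  (nu : Prob X) : Prop :=
  forall B : set (borel X), measurable B ->
    pm mu (fst @^-1` B : set (borel (X * Y)%type)) = pm nu B.

End Spaces.

Definition is_lub (A : Type) (le : A -> A -> Prop) (X : set A) (a : A) :=
  (forall x, X x -> le x a) /\ (forall b, (forall x, X x -> le x b) -> le a b).
Definition is_glb (A : Type) (le : A -> A -> Prop) (X : set A) (a : A) :=
  (forall x, X x -> le a x) /\ (forall b, (forall x, X x -> le b x) -> le b a).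

Definition uhc (X Y : topologicalType) (F : X -> set Y) : Prop :=
  forall (x : X) (U : set Y), open U -> F x `<=` U ->
    exists W : set X, open W /\ W x /\ forall x', W x' -> F x' `<=` U.

Section Game.
Variables (R : realType) (C A S T : ptopologicalType).
Variable (le : A -> A -> Prop).
Variable (nu : Prob R C).
Variable (Acorr : C -> set A).
Variable (v : C -> A -> S -> Prob R (C * A)%type -> R).
Variable (sigma : T -> S) (tau : T -> Prob R (C * Prob R T)%type).

(* Convention: [le x y] reads "y \succeq x" (i.e. x \preceq y). *)

Definition CAge (x y : C * A) : Prop := x.1 = y.1 /\ le y.2 x.2.

Definition stoch_ge (mu mu' : Prob R (C * A)%type) : Prop :=
  forall g : C * A -> R,
    @measurable_fun _ _ (borel (C * A)%type) R setT g ->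
    (exists M : R, forall x, `|g x| <= M) ->
    (forall x y, CAge x y -> g y <= g x) ->
    (\int[pm mu']_x (g x)%:E <= \int[pm mu]_x (g x)%:E)%E.

Definition phi (k : Prob R (C * Prob R T * A)%type) : Prob R (C * A)%type :=
  pf k (fun x : C * Prob R T * A => (x.1.1, x.2)).

Definition graphS (F : C -> Prob R T -> set A) : set (C * Prob R T * A) :=
  [set x | F x.1.1 x.1.2 x.2].

Definition graphD (D : T -> set (Prob R (C * Prob R T * A)%type))
  : set (T * Prob R (C * Prob R T * A)%type) :=
  [set x | D x.1 x.2].

Definition Dof (F : C -> Prob R T -> set A) (t : T)
  : set (Prob R (C * Prob R T * A)%type) :=
  [set k | pm k (graphS F : set (borel (C * Prob R T * A)%type)) = 1%E /\
     forall B : set (borel (C * Prob R T)%type), measurable B ->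
       pm k (fst @^-1` B : set (borel (C * Prob R T * A)%type)) = pm (tau t) B].

Definition Sof (D : T -> set (Prob R (C * Prob R T * A)%type))
  (c : C) (b : Prob R T) : set A :=
  [set a | exists mu : Prob R (T * Prob R (C * Prob R T * A)%type)%type,
     (forall B : set (borel T), measurable B ->
        pm mu (fst @^-1` B : set (borel (T * Prob R (C * Prob R T * A))%type))
        = pm b B) /\
     pm mu (graphD D : set (borel (T * Prob R (C * Prob R T * A))%type)) = 1%E /\
     Acorr c a /\
     forall a', Acorr c a' ->
       (\int[pm mu]_x (v c a' (sigma x.1) (phi x.2))%:E
        <= \int[pm mu]_x (v c a (sigma x.1) (phi x.2))%:E)%E].

Fixpoint Sm (n : nat) : C -> Prob R T -> set A :=
  match n with
  | O => fun c _ => Acorr c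
  | n'.+1 => Sof (Dof (Sm n'))
  end.

Definition ICR (c : C) (b : Prob R T) : set A := [set a | forall n, Sm n c b a].

Definition zstar (zeta : C -> Prob R T -> A) (k : Prob R (C * Prob R T)%type)
  : Prob R (C * Prob R T * A)%type :=
  pf k (fun x : C * Prob R T => (x, zeta x.1 x.2)).

Definition BNE (zeta : C -> Prob R T -> A) : Prop :=
  @measurable_fun _ _ (borel (C * Prob R T)%type) (borel A) setT
     (fun x : C * Prob R T => zeta x.1 x.2) /\
  (forall c b, Acorr c (zeta c b)) /\
  forall (c : C) (b : Prob R T) (a : A), Acorr c a ->
    (\int[pm (pf b (fun t => (sigma t, phi (zstar zeta (tau t)))))]_x
        (v c a x.1 x.2)%:E
     <= \int[pm (pf b (fun t => (sigma t, phi (zstar zeta (tau t)))))]_x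
        (v c (zeta c b) x.1 x.2)%:E)%E.

End Game.

(* Main.v *)
(* If every action in [F] is at most [z], then a best reply to a conjecture
   supported by [F] is, by supermodularity and increasing differences, at most the
   greatest best reply to the strategy [z].  Hence, inductively, each round of
   elimination leaves a greatest action at each (c, beta); by compactness so does the
   limit [ICR].  As [ICR] is a fixed point of the elimination, its greatest selection
   is its own greatest best reply.  The reversed order gives the least selection.

   Because the action correspondence is only upper hemicontinuous, the graphs of the
   rounds are not closed.  By a Lusin type argument [C] contains closed sets of nearly
   full measure on which that correspondence is also lower hemicontinuous; over them
   Berge's theorem applies, and as all conjectures have [C]-marginal [nu] this
   suffices for the sets of conjectures to be closed.  Compactness of these sets
   follows from the Daniell-Stone theorem: along an ultrafilter the integrals converge
   to a positive functional, continuous along monotone sequences because of the fixed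
   marginal.  [Prob] is not Hausdorff, since a measure also carries values at
   non-measurable sets; this is why limits are handled through filters. *)

Require Import Defs.
From HB Require Import structures.
From mathcomp Require Import all_boot all_order all_algebra.
From mathcomp Require Import all_classical all_reals all_analysis.
From mathcomp Require Import measurable_realfun giry lra.
Import Order.TTheory GRing.Theory Num.Theory numFieldNormedType.Exports.
Local Open Scope classical_set_scope.
Local Open Scope ring_scope.
Set Implicit Arguments.
Unset Strict Implicit.
Unset Printing Implicit Defensive.

(** * Integrals of bounded Borel functions *)

(** Besides compactness, measurability shapes the proof. The payoff [v] is continuous only at
    measures with marginal [nu], and nothing makes it measurable elsewhere; since every conjecture
    leads almost surely to outcomes in the closed set [consistent_outcomes], [v] may be given any
    convenient value outside it. A greatest selection must be Borel to count as a strategy. In a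
    compact ordered space it suffices to examine preimages of closed up-closed sets G, and the
    greatest element of F(c, beta) lies in G exactly when F(c, beta) meets G. This is the origin of
    the measurability clause of [regular], which each round of elimination has to inherit; there
    lower hemicontinuity on nearly all of C does not help, because the clause concerns all c. *)

Section FullSet.
Import HBNNSimple.
Local Open Scope ereal_scope.
Context d (T : measurableType d) (R : realType).
Variables (mu : {measure set T -> \bar R}) (E : set T).
Hypotheses (mE : measurable E) (E0 : mu (~` E) = 0).

Lemma measure_setI_full (A : set T) : measurable A -> mu (A `&` E) = mu A.
Proof.
move=> mA; apply/eqP; rewrite eq_le le_measure ?inE//=; last exact: measurableI.
rewrite {1}(measureDI mu mA mE) setDE -[leRHS]add0e leeD2r// -E0.
rewrite le_measure ?inE//; last exact: measurableC.
by apply: measurableI => //; exact: measurableC.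
Qed.

(** Cutting a simple function below [f] to [E] puts it below [g]; its nonzero level sets change only
    by null sets, so its integral stays the same. *)
Let ge0_le_integral_full (f g : T -> \bar R) : (forall x, 0 <= f x) ->
  (forall x, 0 <= g x) -> (forall x, E x -> f x = g x) ->
  \int[mu]_x f x <= \int[mu]_x g x.
Proof.
move=> f0 g0 fg; rewrite !ge0_integralTE//; apply: ge_ereal_sup => _ [h hf <-].
apply: ereal_sup_ubound; exists (proj_nnsfun h mE).
  move=> x; rewrite -mrestrict /patch; case: ifPn => [/set_mem/fg <-|_] //.
rewrite /sintegral; apply: eq_fsbigr => r _.
have [->|r0] := eqVneq r 0%R; first by rewrite !mul0e.
congr (_ * _); rewrite -[RHS]measure_setI_full; last exact: measurable_sfunP.
congr (mu _); apply/seteqP; split => x /=.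
  rewrite measurable_realfun.mindicE; have [xE|xE] := boolP (x \in E); rewrite ?mulr1 ?mulr0.
    by move=> ->; split => //; exact/set_mem.
  by move=> /esym /eqP; rewrite (negbTE r0).
by move=> [<- Ex]; rewrite measurable_realfun.mindicE mem_set// mulr1.
Qed.

(* No measurability is required of [f] and [g]: mathcomp's integral is a
   difference of suprema over simple functions. *)
Lemma eq_integral_full (f g : T -> \bar R) : (forall x, E x -> f x = g x) ->
  \int[mu]_x f x = \int[mu]_x g x.
Proof.
move=> fg; rewrite integralE [RHS]integralE; congr (_ - _);
  apply/eqP; rewrite eq_le !ge0_le_integral_full// => x Ex;
  by rewrite ?funeposE ?funenegE fg.
Qed.

End FullSet.

Section Basics.
Variable R : realType.
Implicit Types X Y Z : ptopologicalType.

Lemma open_borel X (U : set X) : open U -> measurable (U : set (borel X)).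
Proof. by move=> oU; exact: sub_sigma_algebra. Qed.

Lemma closed_borel X (U : set X) : closed U -> measurable (U : set (borel X)).
Proof.
by move=> cU; rewrite -[U]setCK; apply: measurableC; apply: open_borel; exact: closed_openC.
Qed.

Lemma measurable_to_borel d (X : measurableType d) Y (f : X -> Y) :
  (forall U : set Y, open U -> measurable (f @^-1` U)) ->
  @measurable_fun _ _ X (borel Y) setT f.
Proof.
move=> fU; apply: (@measurability _ _ X (borel Y) setT f (@open Y)) => // _ [B oB <-].
by rewrite setTI; exact: fU.
Qed.

Lemma continuous_borel X Y (f : X -> Y) : continuous f ->
  @measurable_fun _ _ (borel X) (borel Y) setT f.
Proof.
move=> cf; apply: measurable_to_borel => U oU; apply: open_borel.
by apply: open_comp => // x _; exact: cf.
Qed.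

Lemma measurable_gtR d (X : measurableType d) (f : X -> R) :
  (forall s, measurable [set x | s < f x]) -> measurable_fun setT f.
Proof.
move=> fs mD; apply: (measurability _ (measurable_realfun.RGenOInfty.measurableE R)) => //.
by move=> _ [_ [x ->] <-]; rewrite setTI preimage_itvoy; exact: fs.
Qed.

Lemma continuous_borelR X (f : X -> R) : continuous f ->
  @measurable_fun _ _ (borel X) R setT f.
Proof.
move=> cf; apply: measurable_gtR => s; apply: open_borel.
rewrite -[[set x | _]]/(f @^-1` [set r | s < r]); by apply: open_comp => // x _; exact: cf.
Qed.

Definition bmeas X (f : X -> R) :=
  @measurable_fun _ _ (borel X) R setT f /\ exists M, forall x, `|f x| <= M.

Lemma bmeas_integrable X (f : X -> R) (mu : Prob R X) : bmeas f ->
  (pm mu).-integrable setT (EFin \o f).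
Proof.
move=> [mf [M fM]]; apply: measurable_bounded_integrable => //.
  by rewrite (le_lt_trans (probability_le1 _ _))// ltry.
exists M; split; first exact: num_real.
by move=> N MN x _; rewrite /= (le_trans (fM x))// ltW.
Qed.
Hint Resolve bmeas_integrable : core.

Lemma bcont_bmeas X (f : X -> R) : continuous f ->
  (exists M, forall x, `|f x| <= M) -> bmeas f.
Proof. by move=> cf bf; split => //; exact: continuous_borelR. Qed.

Lemma bmeasD X (f g : X -> R) : bmeas f -> bmeas g -> bmeas (fun x => f x + g x).
Proof.
move=> [mf [M fM]] [mg [N gN]]; split; first exact: measurable_funD.
by exists (M + N) => x; rewrite (le_trans (ler_normD _ _))// lerD.
Qed.

Lemma bmeasN X (f : X -> R) : bmeas f -> bmeas (fun x => - f x).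
Proof.
move=> [mf [M fM]]; split; first exact: (measurableT_comp (@oppr_measurable R setT) mf).
by exists M => x; rewrite normrN.
Qed.

Lemma bmeasB X (f g : X -> R) : bmeas f -> bmeas g -> bmeas (fun x => f x - g x).
Proof. by move=> bf /bmeasN bg; exact: bmeasD. Qed.

Lemma bmeasZ X (f : X -> R) k : bmeas f -> bmeas (fun x => k * f x).
Proof.
move=> [mf [M fM]]; split; first exact: (measurableT_comp (@mulrl_measurable R setT k) mf).
by exists (`|k| * M) => x; rewrite normrM ler_wpM2l.
Qed.

Lemma bmeas_cst X (k : R) : bmeas (fun _ : X => k).
Proof. by split; [exact: measurable_cst|exists `|k|]. Qed.

Lemma bmeas_comp X Y (f : Y -> R) (h : X -> Y) :
  @measurable_fun _ _ (borel X) (borel Y) setT h -> bmeas f -> bmeas (fun x => f (h x)).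
Proof.
move=> mh [mf [M fM]]; split; last by exists M.
exact: (measurableT_comp mf mh).
Qed.

Lemma bmeas_indic X (A : set X) : measurable (A : set (borel X)) ->
  bmeas (\1_A : X -> R).
Proof.
move=> mA; split; first exact: (@measurable_indic _ (borel X) R setT A).
by exists 1 => x; rewrite indicE; case: (_ \in _); rewrite ?normr1 ?normr0.
Qed.

Lemma bmeas_sum X n (f : nat -> X -> R) : (forall i, bmeas (f i)) ->
  bmeas (fun x => \sum_(i < n) f i x).
Proof.
move=> bf; elim: n => [|n IH].
  by under eq_fun do rewrite big_ord0; exact: bmeas_cst.
by under eq_fun do rewrite big_ord_recr; exact: bmeasD.
Qed.

Definition Ex X (mu : Prob R X) (f : X -> R) : R := \int[pm mu]_x f x.

Lemma ExE X (mu : Prob R X) (f : X -> R) : bmeas f ->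
  (\int[pm mu]_x (f x)%:E)%E = (Ex mu f)%:E.
Proof. by move=> bf; rewrite fineK//; apply: integrable_fin_num => //; exact: bmeas_integrable. Qed.

Lemma ExD X (mu : Prob R X) f g : bmeas f -> bmeas g ->
  Ex mu (fun x => f x + g x) = Ex mu f + Ex mu g.
Proof. by move=> bf bg; apply: RintegralD => //; exact: bmeas_integrable. Qed.

Lemma ExB X (mu : Prob R X) f g : bmeas f -> bmeas g ->
  Ex mu (fun x => f x - g x) = Ex mu f - Ex mu g.
Proof. by move=> bf bg; apply: RintegralB => //; exact: bmeas_integrable. Qed.

Lemma ExZ X (mu : Prob R X) f k : bmeas f ->
  Ex mu (fun x => k * f x) = k * Ex mu f.
Proof. by move=> bf; apply: RintegralZl => //; exact: bmeas_integrable. Qed.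

Lemma Ex_cst X (mu : Prob R X) k : Ex mu (fun=> k) = k.
Proof. by rewrite /Ex Rintegral_cst//= probability_setT/= mulr1. Qed.

Lemma ExN X (mu : Prob R X) f : bmeas f -> Ex mu (fun x => - f x) = - Ex mu f.
Proof.
move=> bf; rewrite -[RHS]mulN1r -ExZ//; congr (Ex _ _); apply/funext => x.
by rewrite mulN1r.
Qed.

Lemma le_Ex X (mu : Prob R X) f g : bmeas f -> bmeas g ->
  (forall x, f x <= g x) -> Ex mu f <= Ex mu g.
Proof. by move=> bf bg fg; apply: le_Rintegral => //; exact: bmeas_integrable. Qed.

Lemma Ex_sum X (mu : Prob R X) n (f : nat -> X -> R) : (forall i, bmeas (f i)) ->
  Ex mu (fun x => \sum_(i < n) f i x) = \sum_(i < n) Ex mu (f i).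
Proof.
move=> bf; elim: n => [|n IH].
  by under eq_fun do rewrite big_ord0; rewrite Ex_cst big_ord0.
under eq_fun do rewrite big_ord_recr; rewrite ExD//; last exact: bmeas_sum.
by rewrite big_ord_recr IH.
Qed.

Definition pr X (mu : Prob R X) (A : set X) : R := fine (pm mu (A : set (borel X))).

Lemma prE X (mu : Prob R X) (A : set X) : measurable (A : set (borel X)) ->
  pm mu (A : set (borel X)) = (pr mu A)%:E.
Proof. by move=> mA; rewrite fineK// fin_num_measure. Qed.

Lemma pr_ge0 X (mu : Prob R X) A : 0 <= pr mu A.
Proof. exact: fine_ge0. Qed.

Lemma pr_le1 X (mu : Prob R X) (A : set X) : measurable (A : set (borel X)) -> pr mu A <= 1.
Proof. by move=> mA; rewrite -lee_fin -prE// probability_le1. Qed.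

Lemma le_pr X (mu : Prob R X) (A B : set X) : measurable (A : set (borel X)) ->
  measurable (B : set (borel X)) -> A `<=` B -> pr mu A <= pr mu B.
Proof. by move=> mA mB AB; rewrite -lee_fin -!prE// le_measure// inE. Qed.

Lemma pr_setC X (mu : Prob R X) (A : set X) : measurable (A : set (borel X)) ->
  pr mu (~` A) = 1 - pr mu A.
Proof.
move=> mA; apply/EFin_inj; rewrite -prE; last exact: measurableC.
by rewrite probability_setC// prE.
Qed.

Lemma Ex_indic X (mu : Prob R X) (A : set X) : measurable (A : set (borel X)) ->
  Ex mu \1_A = pr mu A.
Proof. by move=> mA; rewrite /Ex /Rintegral integral_indic// setIT. Qed.

Lemma pr_full X (mu : Prob R X) (E : set X) : measurable (E : set (borel X)) ->
  pm mu (E : set (borel X)) = 1%E -> pm mu (~` E : set (borel X)) = 0%E.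
Proof. by move=> mE E1; rewrite probability_setC// E1 subee. Qed.

(** [min f g] agrees with [f] on [E] and lies below [g] everywhere. *)
Lemma le_Ex_full X (mu : Prob R X) (E : set X) f g :
  measurable (E : set (borel X)) -> pm mu (E : set (borel X)) = 1%E ->
  bmeas f -> bmeas g -> (forall x, E x -> f x <= g x) -> Ex mu f <= Ex mu g.
Proof.
move=> mE /(pr_full mE) E1 bf bg fg.
pose h x := Num.min (f x) (g x).
have bh : bmeas h.
  case: bf bg => [mf [M fM]] [mg [N gN]]; split; first exact: measurable_minr.
  exists (Num.max M N) => x; rewrite /h; case: (leP (f x) (g x)) => _.
    by rewrite le_max fM.
  by rewrite le_max gN orbT.
have -> : Ex mu f = Ex mu h.
  congr fine; apply: (eq_integral_full mE E1) => x /fg fgx.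
  by rewrite /h min_l.
by apply: le_Ex => // x; rewrite ge_min lexx orbT.
Qed.

Lemma cvg_Ex_dominated X (mu : Prob R X) (f : nat -> X -> R) g M :
  (forall n, @measurable_fun _ _ (borel X) R setT (f n)) ->
  (forall n x, `|f n x| <= M) -> bmeas g ->
  (forall x, f n x @[n --> \oo] --> g x) -> Ex mu (f n) @[n --> \oo] --> Ex mu g.
Proof.
move=> mf fM bg fg.
have bf n : bmeas (f n) by split=> //; exists M.
have [|||||_ _] := @dominated_convergence _ (borel X) R (pm mu) setT measurableT
  (fun n => EFin \o f n) (EFin \o g) (fun=> M%:E).
- by move=> n; apply/measurable_EFinP.
- by apply/measurable_EFinP; case: bg.
- by apply: aeW => x _ /=; apply/cvg_EFin; [exact: nearW|exact: fg].
- exact/bmeas_integrable/bmeas_cst.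
- by apply: aeW => x n _ /=; rewrite lee_fin.
rewrite (_ : (fun n => _) = EFin \o (fun n => Ex mu (f n))); last first.
  by apply/funext => n /=; rewrite ExE.
rewrite (_ : integral _ _ _ = (Ex mu g)%:E); last by rewrite ExE.
by move/fine_cvgP => [].
Qed.

(** Holds for every [f], measurable or not: the simple functions that define the integral see only
    measurable sets. *)
Lemma eq_pr_Ex X (mu nu : Prob R X) f :
  (forall A, measurable (A : set (borel X)) ->
     pm mu (A : set (borel X)) = pm nu (A : set (borel X))) ->
  Ex mu f = Ex nu f.
Proof. by move=> e; congr fine; apply: eq_measure_integral => A mA _; exact: e. Qed.

Section Pushforward.
Context X Y (f : X -> Y).
Hypothesis mf : @measurable_fun _ _ (borel X) (borel Y) setT f.

Lemma pfE (mu : Prob R X) (A : set Y) :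
  pm (pf mu f) (A : set (borel Y)) = pm mu (f @^-1` A : set (borel X)).
Proof. by rewrite /pf; case: pselect. Qed.

Lemma Ex_pf (mu : Prob R X) (g : Y -> R) : bmeas g ->
  Ex (pf mu f) g = Ex mu (fun x => g (f x)).
Proof.
move=> bg; have bgf := bmeas_comp mf bg.
apply/EFin_inj; rewrite -!ExE//.
transitivity (\int[pushforward (pm mu) (f : borel X -> borel Y)]_y (g y)%:E)%E.
  by apply: eq_measure_integral => A mA _; exact: pfE.
rewrite (integral_pushforward mf)//.
- by apply/measurable_EFinP; case: bg.
- exact: bmeas_integrable.
Qed.

(* [g] is only required to be measurable and bounded on a set of full measure. *)
Lemma integral_pf_full (mu : Prob R X) (E : set Y) (g g' : Y -> R) :
  measurable (E : set (borel Y)) -> pm (pf mu f) (E : set (borel Y)) = 1%E ->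
  bmeas g' -> (forall y, E y -> g y = g' y) ->
  (\int[pm (pf mu f)]_y (g y)%:E)%E = (\int[pm mu]_x (g (f x))%:E)%E.
Proof.
move=> mE E1 bg' gg'; have E0 := pr_full mE E1.
rewrite (eq_integral_full mE E0 (g := EFin \o g')); last by move=> x /gg' /= ->.
rewrite [LHS]ExE// Ex_pf// -ExE; last exact: bmeas_comp.
have mfE : measurable (f @^-1` E : set (borel X)) by rewrite -[_ @^-1` _]setTI; exact: mf.
rewrite pfE preimage_setC in E0.
by apply: (eq_integral_full mfE E0) => x /gg' /= ->.
Qed.

End Pushforward.

End Basics.

(** * The weak topology *)

Lemma initial_cvgP (S : choiceType) (T : topologicalType) (f : S -> T)
    (F : set_system S) (s : S) : Filter F ->
  F --> (s : initial_topology f) <-> f @ F --> f s.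
Proof.
move=> FF; split.
  by move=> Fs; apply: (cvg_comp _ _ Fs); exact: (@initial_continuous S T f s).
move=> Fs W; rewrite nbhsE => -[ W' [[B oB <-] Bs] OW].
by apply: (filterS OW); apply: Fs; exact: open_nbhs_nbhs.
Qed.

Section Weak.
Variable R : realType.
Implicit Types X Y Z : ptopologicalType.

Definition bcont X (f : X -> R) := continuous f /\ exists M, forall x, `|f x| <= M.

Lemma bcontb X (f : X -> R) : bcont f -> bmeas f.
Proof. by case; exact: bcont_bmeas. Qed.

Lemma cvg_ProbP I (F : set_system I) X (m : I -> Prob R X) (mu : Prob R X) :
  Filter F ->
  m @ F --> mu <-> (forall f, bcont f -> Ex (m i) f @[i --> F] --> Ex mu f).
Proof.
move=> FF; split => [/initial_cvgP/cvg_sup Fm f bf|Fm].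
  exact: ((initial_cvgP _ _ _).1 (Fm (exist _ f bf))).
apply/initial_cvgP/cvg_sup => -[f bf].
by apply/initial_cvgP; exact: (Fm f bf).
Qed.

Lemma Ex_continuous X (f : X -> R) : bcont f -> continuous (fun mu : Prob R X => Ex mu f).
Proof.
move=> bf mu; exact: ((cvg_ProbP id mu (nbhs_filter mu)).1 cvg_id).
Qed.

Lemma bcont_comp X Y (f : Y -> R) (h : X -> Y) : continuous h -> bcont f ->
  bcont (fun x => f (h x)).
Proof.
move=> ch [cf [M fM]]; split; last by exists M.
by move=> x; apply: continuous_comp; [exact: ch|exact: cf].
Qed.

Lemma pf_continuous X Y (h : X -> Y) : continuous h ->
  continuous (fun mu : Prob R X => pf mu h).
Proof.
move=> ch mu; apply: (cvg_ProbP _ _ (nbhs_filter mu)).2 => f bf.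
have mh := continuous_borel ch.
rewrite (Ex_pf mh); last exact: bcontb.
rewrite (_ : (fun k => Ex (pf k h) f) = (fun k => Ex k (fun x => f (h x)))); last first.
  by apply/funext => k; rewrite (Ex_pf mh)//; exact: bcontb.
by apply: Ex_continuous; exact: bcont_comp.
Qed.

Definition cbase_on (I : Type) X (f : I -> X -> R) :=
  [/\ forall i, continuous (f i), forall i x, 0 <= f i x <= 1 &
      forall U x, open U -> U x -> exists i, 0 < f i x /\ [set y | 0 < f i y] `<=` U].

(* Second countability by cozero sets; passes to products and to [Prob]. *)
Definition cbase X := exists f : nat -> X -> R, cbase_on f.

Lemma cbase_count (I : countType) X (f : I -> X -> R) : cbase_on f -> cbase X.
Proof.
move=> [cf f01 fU].
exists (fun n => if unpickle n is Some i then f i else fun=> 0); split.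
- by move=> n; case: unpickle => // x; exact: cvg_cst.
- by move=> n x; case: unpickle => // ; rewrite lexx ler01.
- move=> U x oU Ux; have [i [fi fiU]] := fU U x oU Ux.
  by exists (pickle i); rewrite pickleK.
Qed.

Lemma cbase_prod X Y : cbase X -> cbase Y -> cbase (X * Y)%type.
Proof.
move=> [f [cf f01 fU]] [g [cg g01 gU]].
apply: (@cbase_count (nat * nat)%type _ (fun ij xy => f ij.1 xy.1 * g ij.2 xy.2)).
split.
- move=> [i j] xy; apply: continuousM => /=.
    by apply: continuous_comp; [exact: cvg_fst|exact: cf].
  by apply: continuous_comp; [exact: cvg_snd|exact: cg].
- move=> [i j] [x y] /=; have /andP[f0 f1] := f01 i x; have /andP[g0 g1] := g01 j y.
  by rewrite mulr_ge0//= mulr_ile1.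
- move=> U [x y] oU Uxy.
  have [[A B] /= [Ax By] ABU] : nbhs (x, y) U by exact: open_nbhs_nbhs.
  move: Ax By; rewrite !nbhsE => -[A' [oA' A'x] A'A] [B' [oB' B'y] B'B].
  have [i [fi fiA]] := fU _ _ oA' A'x; have [j [gj gjB]] := gU _ _ oB' B'y.
  exists (i, j) => /=; split; first exact: mulr_gt0.
  move=> [x' y'] /= fg; apply: ABU; split => /=.
    apply/A'A/fiA => /=; have /andP[f0 _] := f01 i x'; rewrite lt_neqAle f0 andbT.
    by apply: contraTneq fg => <-; rewrite mul0r ltxx.
  apply/B'B/gjB => /=; have /andP[g0 _] := g01 j y'; rewrite lt_neqAle g0 andbT.
  by apply: contraTneq fg => <-; rewrite mulr0 ltxx.
Qed.

(** * Approximation of open sets from within *)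

Section Bump.
Variables (X : ptopologicalType) (f : nat -> X -> R).
Hypothesis fb : cbase_on f.

(** For large [k] this is 1 at any given point of the union of the cozero sets listed in [s], and it
    is 0 off that union. Only countably many such functions exist. *)
Definition bump (s : seq nat) (k : nat) (x : X) : R :=
  Num.min 1 (k%:R * \sum_(i <- s) f i x).

Lemma bump_ge0 s k x : 0 <= bump s k x.
Proof.
rewrite le_min ler01 mulr_ge0// sumr_ge0// => i _.
by case: fb => _ /(_ i x)/andP[].
Qed.

Lemma bump_le1 s k x : bump s k x <= 1.
Proof. by rewrite ge_min lexx. Qed.

Lemma bump_bcont s k : bcont (bump s k).
Proof.
split; last by exists 1 => x; rewrite ger0_norm ?bump_le1 ?bump_ge0.
have cs : continuous (fun x => \sum_(i <- s) f i x).
  elim: s => [|i s IH]; first by under eq_fun do rewrite big_nil; move=> x; exact: cvg_cst.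
  under eq_fun do rewrite big_cons.
  by move=> x; apply: cvgD; [case: fb => + _ _; exact|exact: IH].
move=> x; apply: (@continuous_min R X (fun=> 1)); first exact: cvg_cst.
by apply: cvgM; [exact: cvg_cst|exact: cs].
Qed.

(** Bumps over those among the first n basic sets that lie in [U] converge pointwise to the
    indicator of [U]; dominated convergence does the rest. *)
Lemma inner_bump (mu : Prob R X) (U : set X) (q : R) : open U -> q < pr mu U ->
  exists s k, q < Ex mu (bump s k) /\ forall x, bump s k x <= \1_U x.
Proof.
move=> oU qU; have [cf f01 fU] := fb.
pose s n := [seq i <- iota 0 n | `[< [set y | 0 < f i y] `<=` U >]].
have hU n x : bump (s n) n x <= \1_U x.
  rewrite indicE; have [xU|xU] := boolP (x \in U); first exact: bump_le1.
  rewrite ge_min; apply/orP; right; rewrite big_seq big1 ?mulr0// => i.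
  rewrite mem_filter => /andP[/asboolP fiU _]; apply/eqP.
  have /andP[f0 _] := f01 i x; rewrite eq_le f0 andbT leNgt; apply/negP => fi.
  by move/negP: xU; apply; apply/mem_set/fiU.
have hl x : bump (s n) n x @[n --> \oo] --> (\1_U x : R).
  have [xU|xU] := pselect (U x); last first.
    apply: cvg_near_cst; apply: nearW => n; apply/eqP; rewrite eq_le hU.
    by rewrite indicE memNset//= bump_ge0.
  have [i [fi fiU]] := fU U x oU xU.
  apply: cvg_near_cst; near=> n; rewrite indicE mem_set//=; apply/eqP.
  rewrite eq_le bump_le1 le_min lexx/=.
  have : 1 <= n%:R * f i x.
    rewrite -ler_pdivrMr// mul1r; near: n; exact: nbhs_infty_ger.
  move=> /le_trans; apply; rewrite ler_wpM2l//.
  have si : i \in s n.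
    rewrite mem_filter mem_iota/= add0n; apply/andP; split; first exact/asboolP.
    by near: n; exact: nbhs_infty_gt.
  rewrite (perm_big _ (perm_to_rem si)) big_cons lerDl sumr_ge0// => j _.
  by have /andP[] := f01 j x.
have mU := open_borel oU.
have : Ex mu (bump (s n) n) @[n --> \oo] --> pr mu U.
  rewrite -(Ex_indic _ mU); apply: (@cvg_Ex_dominated _ _ _ _ _ 1) => //.
  - by move=> n; have [] := bcontb (bump_bcont (s n) n).
  - by move=> n x; rewrite ger0_norm ?bump_le1 ?bump_ge0.
  - exact: bmeas_indic.
move=> /cvgr_gt/(_ _ qU) [N _ /(_ N (leqnn _)) /= qN].
by exists (s N), N.
Unshelve. all: by end_near. Qed.

End Bump.

(** The open-set half of the portmanteau theorem: a bump below the indicator of [U] already has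
    expectation above [q], and that expectation is continuous in the measure. *)
Lemma open_pr_gt X (U : set X) (q : R) : cbase X -> open U ->
  open [set mu : Prob R X | q < pr mu U].
Proof.
move=> [f fb] oU; rewrite openE => mu /= /(inner_bump fb oU) [s [k [qk hU]]].
have : \forall mu' \near mu, q < Ex mu' (bump f s k).
  exact: (cvgr_gt _ (Ex_continuous (bump_bcont fb s k) (x := mu))).
apply: filterS => mu' /= /lt_le_trans; apply.
rewrite -Ex_indic; last exact: open_borel.
apply: le_Ex => //; first exact/bcontb/bump_bcont.
by apply: bmeas_indic; exact: open_borel.
Qed.

Lemma closed_pr_ge X (F : set X) (q : R) : cbase X -> closed F ->
  closed [set mu : Prob R X | q <= pr mu F].
Proof.
move=> bX cF; rewrite -openC.
rewrite (_ : ~` _ = [set mu | 1 - q < pr mu (~` F)]).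
  by apply: open_pr_gt => //; exact: closed_openC.
apply/seteqP; split => mu /=; rewrite pr_setC ?ltrD2l ?ltrN2 ?ltNge; try exact: closed_borel.
  by move/negP.
by move/negP.
Qed.

(** The sum counts the integers from 1 to N below [y]; with the next bound, [y] is within 1 of this
    count. *)
Lemma layer_cake_le N (y : R) : 0 <= y ->
  \sum_(j < N) ((j.+1%:R : R) < y)%R%:R <= y :> R.
Proof.
move=> y0; elim: N => [|N IH]; first by rewrite big_ord0.
rewrite big_ord_recr /=; have [lt|_] := ltP N.+1%:R y; last by rewrite addr0.
rewrite (le_trans _ (ltW lt))// -[N.+1]addn1 natrD lerD2r.
rewrite -[leRHS](_ : \sum_(j < N) 1 = N%:R); last first.
  by rewrite sumr_const card_ord.
by apply: ler_sum => i _; rewrite lern1 leq_b1.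
Qed.

Lemma layer_cake_ge N (y : R) : y <= N%:R ->
  y <= 1 + \sum_(j < N) ((j.+1%:R : R) < y)%R%:R :> R.
Proof.
elim: N => [|N IH]; first by rewrite big_ord0 addr0 => /le_trans; apply; rewrite ler01.
move=> yN; have [/IH|Ny] := leP y N%:R.
  by move/le_trans; apply; rewrite big_ord_recr/= lerD2l lerDl.
rewrite (le_trans yN)// -[N.+1]add1n natrD lerD2l big_ord_recr/=.
rewrite -[X in X <= _](_ : \sum_(j < N) 1 = N%:R); last first.
  by rewrite sumr_const card_ord.
rewrite -[leLHS]addr0 lerD//; apply: ler_sum => i _.
by rewrite (le_lt_trans _ Ny)// ler_nat.
Qed.

(** * Integrals of semicontinuous functions *)

Section Semicontinuity.
Variables (I : Type) (F : set_system I) (X : ptopologicalType).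
Variables (m : I -> Prob R X) (mu : Prob R X).
Hypothesis FF : Filter F.
(** Stated through open sets rather than as convergence of [m], because [cvg_prob_open] uses this
    section to derive convergence from it. *)
Hypothesis mmu : forall U q, open U -> q < pr mu U -> \forall i \near F, q < pr (m i) U.

Lemma lsc_bmeas (g : X -> R) : (forall s, open [set x | s < g x]) ->
  (exists M, forall x, `|g x| <= M) -> bmeas g.
Proof. by move=> go gM; split=> //; apply: measurable_gtR => s; exact: open_borel. Qed.

(** Up to 1/n, the expectation of [g] is the average [L] of the probabilities of the n open level
    sets [U j]. Each of these finitely many probabilities drops by at most e/2 near the limit, and
    1/n < e/2 pays for the discretization. *)
Let Ex_lsc01 (g : X -> R) (e : R) : (forall s, open [set x | s < g x]) ->
  (forall x, 0 <= g x <= 1) -> 0 < e ->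
  \forall i \near F, Ex mu g - e < Ex (m i) g.
Proof.
move=> og g01 e0.
have bg : bmeas g.
  apply: lsc_bmeas => //; exists 1 => x; have /andP[g0 g1] := g01 x.
  by rewrite ger0_norm.
have [n n0 ne] : exists2 n : nat, (0 < n)%N & n%:R^-1 < e / 2 :> R.
  have e20 : 0 < e / 2 by rewrite divr_gt0.
  have [k _ /(_ k (leqnn _)) /= ke] := near_infty_natSinv_lt (PosNum e20).
  by exists k.+1.
have n0' : 0 < n%:R :> R by rewrite ltr0n.
pose U j := [set x | j.+1%:R < n%:R * g x].
have oU j : open (U j).
  rewrite (_ : U j = [set x | j.+1%:R / n%:R < g x])//.
  by apply/seteqP; split => x; rewrite /U /= ltr_pdivrMr// mulrC.
have bU j : bmeas (\1_(U j) : X -> R) by apply: bmeas_indic; exact: open_borel.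
pose L (k : Prob R X) := n%:R^-1 * \sum_(j < n) pr k (U j).
have LE k : L k = n%:R^-1 * Ex k (fun x => \sum_(j < n) \1_(U j) x).
  by rewrite (Ex_sum k n bU); congr (_ * _); apply: eq_bigr => j _; rewrite Ex_indic//; exact: open_borel.
have indE j x : \1_(U j) x = ((j.+1%:R : R) < n%:R * g x)%R%:R :> R.
  by rewrite indicE; congr (_%:R); congr nat_of_bool; apply/idP/idP; rewrite ?inE.
have sumE x : \sum_(j < n) \1_(U j) x = \sum_(j < n) ((j.+1%:R : R) < n%:R * g x)%R%:R :> R.
  by apply: eq_bigr => j _; exact: indE.
have bS : bmeas (fun x : X => \sum_(j < n) \1_(U j) x : R) by exact: (bmeas_sum n bU).
have Lle k : L k <= Ex k g.
  rewrite LE ler_pdivrMl// -ExZ//; apply: le_Ex => //; first exact: bmeasZ.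
  move=> x; rewrite sumE; apply: layer_cake_le; have /andP[g0 g1] := g01 x.
  exact: mulr_ge0.
have Lge k : Ex k g <= n%:R^-1 + L k.
  rewrite LE -[X in X + _]mulr1 -mulrDr ler_pdivlMl// -ExZ//.
  rewrite -[X in X + _](Ex_cst k 1) -ExD//; last exact: bmeas_cst.
  apply: le_Ex => //; [exact: bmeasZ|apply: bmeasD => //; exact: bmeas_cst|].
  move=> x; rewrite sumE; apply: layer_cake_ge; have /andP[g0 g1] := g01 x.
  by rewrite -[leRHS]mulr1 ler_wpM2l.
have : \forall i \near F, forall j : 'I_n, pr mu (U j) - e / 2 < pr (m i) (U j).
  apply: filter_forall => j; apply: mmu => //.
  by rewrite ltrBlDr ltrDl divr_gt0.
apply: filterS => i Hi; apply: (lt_le_trans _ (Lle (m i))).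
apply: (@lt_le_trans _ _ (L mu - e / 2)).
  have := Lge mu; have := ne; lra.
rewrite /L ler_pdivlMl// mulrBr mulrA divff ?gt_eqF// mul1r.
rewrite (_ : n%:R * (e / 2) = \sum_(j < n) (e / 2)); last first.
  by rewrite sumr_const card_ord mulr_natl.
by rewrite -sumrB; apply: ler_sum => j _; exact: ltW.
Qed.

Lemma Ex_lsc (g : X -> R) (e : R) : (forall s, open [set x | s < g x]) ->
  (exists M, forall x, `|g x| <= M) -> 0 < e ->
  \forall i \near F, Ex mu g - e < Ex (m i) g.
Proof.
move=> og [M gM] e0; have bg : bmeas g by apply: lsc_bmeas => //; exists M.
pose N := Num.max M 1; have N0 : 0 < N by rewrite lt_max ltr01 orbT.
have gN x : `|g x| <= N by rewrite (le_trans (gM x))// le_max lexx.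
(* The affine image of [g] with values in [0, 1]. *)
pose h x := (2 * N)^-1 * (g x + N).
have N20 : 0 < 2 * N by rewrite mulr_gt0.
have hE k : Ex k h = (2 * N)^-1 * (Ex k g + N).
  rewrite /h ExZ; last by apply: bmeasD => //; exact: bmeas_cst.
  by rewrite ExD//; [rewrite Ex_cst|exact: bmeas_cst].
have h01 x : 0 <= h x <= 1.
  rewrite /h ler_pdivrMl// mulr_ge0/=; last 2 first.
    by rewrite invr_ge0 ltW.
    by have := gN x; rewrite ler_norml => /andP[]; lra.
  by have := gN x; rewrite ler_norml => /andP[]; lra.
have oh s : open [set x | s < h x].
  rewrite (_ : [set x | _] = [set x | 2 * N * s - N < g x])//.
  by apply/seteqP; split => x /=; rewrite /h ltrBlDr ltr_pdivlMl.
have := @Ex_lsc01 h ((2 * N)^-1 * e) oh h01; rewrite mulr_gt0 ?invr_gt0// => /(_ isT).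
apply: filterS => i; rewrite !hE -mulrBr ltr_pM2l ?invr_gt0//.
by rewrite addrAC ltrD2r.
Qed.

Lemma Ex_usc (g : X -> R) (e : R) : (forall s, open [set x | g x < s]) ->
  (exists M, forall x, `|g x| <= M) -> 0 < e ->
  \forall i \near F, Ex (m i) g < Ex mu g + e.
Proof.
move=> og [M gM] e0.
have og' s : open [set x | s < - g x].
  by rewrite (_ : [set x | _] = [set x | g x < - s])//; apply/seteqP; split => x /=; rewrite ltrNr.
have gM' : exists M, forall x, `|- g x| <= M by exists M => x; rewrite normrN.
have := Ex_lsc og' gM' e0; apply: filterS => i.
have bg : bmeas g.
  have /bmeasN := lsc_bmeas og' gM'.
  by under [X in bmeas X]eq_fun do rewrite opprK.
by rewrite !ExN// -opprD ltrN2.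
Qed.

Lemma cvg_prob_open : m @ F --> mu.
Proof.
apply/cvg_ProbP => f [cf bf]; apply/cvgrPdist_lt => e e0.
have o1 s : open [set x | s < f x].
  by rewrite -[[set x | _]]/(f @^-1` [set r | s < r]); apply: open_comp => // x _; exact: cf.
have o2 s : open [set x | f x < s].
  by rewrite -[[set x | _]]/(f @^-1` [set r | r < s]); apply: open_comp => // x _; exact: cf.
have := Ex_lsc o1 bf e0; have := Ex_usc o2 bf e0; apply: filterS2 => i h1 h2.
by rewrite ltr_distl; apply/andP; split; lra.
Qed.

End Semicontinuity.

Lemma cvg_pr_open I (F : set_system I) X (m : I -> Prob R X) (mu : Prob R X) :
  Filter F -> cbase X -> m @ F --> mu ->
  forall U q, open U -> q < pr mu U -> \forall i \near F, q < pr (m i) U.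
Proof.
move=> FF bX mmu U q oU qU; apply: (mmu [set k | q < pr k U]).
by apply: open_nbhs_nbhs; split => //; exact: open_pr_gt.
Qed.

(** * A countable base of the weak topology *)

Definition prob_bump X (f : nat -> X -> R) (p : seq nat * nat * rat) (mu : Prob R X) : R :=
  Num.min 1 (Num.max 0 (Ex mu (bump f p.1.1 p.1.2) - ratr p.2)).

Definition prob_bumps X (f : nat -> X -> R) (l : seq (seq nat * nat * rat)) (mu : Prob R X) : R :=
  \prod_(p <- l) prob_bump f p mu.

(** The cozero set of [prob_bump] consists of the measures giving a bump an expectation above a
    rational; products of these functions provide finite intersections. The cozero sets around [mu]
    generate a filter satisfying the portmanteau condition, so it converges to [mu] and contains
    every neighbourhood. *)
Lemma prob_bumps_base X (f : nat -> X -> R) : cbase_on f -> cbase_on (prob_bumps f).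
Proof.
move=> fb; pose g := prob_bump f; pose G := prob_bumps f.
have g01 p mu : 0 <= g p mu <= 1.
  by rewrite /g /prob_bump ge_min lexx andbT le_min ler01/= le_max lexx.
have G01 l mu : 0 <= G l mu <= 1.
  rewrite /G /prob_bumps; elim: l => [|p l /andP[IH0 IH1]]; first by rewrite big_nil ler01 lexx.
  have /andP[? ?] := g01 p mu.
  by rewrite big_cons mulr_ge0//= mulr_ile1.
have G1 p mu : G [:: p] mu = g p mu by rewrite /G /prob_bumps big_cons big_nil mulr1.
have g_gt0 p mu : 0 < g p mu -> ratr p.2 < Ex mu (bump f p.1.1 p.1.2).
  by rewrite /g /prob_bump lt_min ltr01/= lt_max ltxx/= subr_gt0.
have cg p : continuous (g p).
  move=> mu; apply: (@continuous_min R (Prob R X) (fun=> 1)).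
    exact: (@cst_continuous (Prob R X) R).
  apply: (@continuous_max R (Prob R X) (fun=> 0)).
    exact: (@cst_continuous (Prob R X) R).
  apply: (@continuousB R R (Prob R X)); last exact: (@cst_continuous (Prob R X) R).
  by apply: Ex_continuous; exact: bump_bcont.
split => //; rewrite -/G.
- move=> l; elim: l => [|p l IH] mu.
    rewrite (_ : G [::] = fun=> 1); first exact: (@cst_continuous (Prob R X) R).
    by apply/funext => k; rewrite /G /prob_bumps big_nil.
  rewrite (_ : G (p :: l) = fun k => g p k * G l k); last first.
    by apply/funext => k; rewrite /G /prob_bumps big_cons.
  by apply: (@continuousM R (Prob R X)); [exact: cg|exact: IH].
- move=> W mu oW Wmu.
  pose D := [set l | 0 < G l mu]; pose B l := [set mu' | 0 < G l mu'].
  have FG : Filter (filter_from D B).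
    apply: filter_from_filter; first by exists [::]; rewrite /D /= /G /prob_bumps big_nil ltr01.
    move=> l1 l2 D1 D2; exists (l1 ++ l2); first by rewrite /D /G /prob_bumps /= big_cat mulr_gt0.
    move=> mu'; rewrite /B /G /prob_bumps /= big_cat/= => h.
    have /andP[h1 _] := G01 l1 mu'; have /andP[h2 _] := G01 l2 mu'.
    rewrite !lt_neqAle h1 h2 !andbT.
    by split; apply: contraTneq h; rewrite /G /prob_bumps => <-; rewrite ?mul0r ?mulr0 ltxx.
  have /(_ W) : filter_from D B --> mu.
    apply: (@cvg_prob_open (Prob R X) (filter_from D B) X id mu FG) => U q oU qU.
    have [s [k [qk hU]]] := inner_bump fb oU qU.
    have [r] := rat_in_itvoo qk; rewrite in_itv/= => /andP[qr rk].
    exists [:: (s, k, r)]; first by rewrite /D /= G1 /g /prob_bump lt_min ltr01/= lt_max subr_gt0 rk orbT.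
    move=> mu' /=; rewrite /B /= G1 => /g_gt0 /= h.
    apply: (lt_trans qr); apply: (lt_le_trans h).
    rewrite -Ex_indic; last exact: open_borel.
    apply: le_Ex => //; first exact/bcontb/bump_bcont.
    by apply: bmeas_indic; exact: open_borel.
  by move=> /(_ (open_nbhs_nbhs (conj oW Wmu))) [l Dl BW]; exists l.
Qed.

Lemma cbase_Prob X : cbase X -> cbase (Prob R X).
Proof. by move=> [f /prob_bumps_base fb]; exact: (cbase_count fb). Qed.

(** By [inner_bump] the two measures agree on open sets, a generator stable under intersection. *)
Lemma bcont_prob_ext X (mu nu : Prob R X) : cbase X ->
  (forall f, bcont f -> Ex mu f = Ex nu f) ->
  forall A, measurable (A : set (borel X)) ->
    pm mu (A : set (borel X)) = pm nu (A : set (borel X)).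
Proof.
move=> [f fb] e.
have le (mu1 mu2 : Prob R X) U : (forall f, bcont f -> Ex mu1 f = Ex mu2 f) -> open U -> pr mu1 U <= pr mu2 U.
  move=> e12 oU; rewrite leNgt; apply/negP => /(inner_bump fb oU) [s [k []]].
  rewrite e12; last exact: bump_bcont.
  rewrite ltNge => /negP + hU; apply.
  rewrite -Ex_indic; last exact: open_borel.
  apply: le_Ex => //; first exact/bcontb/bump_bcont.
  by apply: bmeas_indic; exact: open_borel.
move=> A mA.
apply: (@measure_unique _ _ (borel X) (@open X) (fun=> setT)) => //.
- by move=> U V oU oV; exact: openI.
- by move=> _; exact: openT.
- by rewrite bigcup_const.
- move=> U oU; rewrite /= !prE; try exact: open_borel.
  by congr EFin; apply/eqP; rewrite eq_le !le// => g bg; rewrite e.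
- by move=> _; rewrite /= probability_setT ltry.
Qed.

End Weak.

(** * The Daniell-Stone theorem *)

(* The measure is the one of the subgraphs: a strip [f <= r < g] of [X * R] gets
   the value of the functional at the length of its fibres, and [B] the measure of
   the part of [B * [0, 1[]. *)
Definition strip_space (R : realType) (X : ptopologicalType) : Type := (X * R)%type.

Section Strip.
Variables (R : realType) (X : ptopologicalType).
Local Notation ST := (strip_space R X).

HB.instance Definition _ := gen_eqMixin ST.
HB.instance Definition _ := gen_choiceMixin ST.
HB.instance Definition _ := isPointed.Build ST (point, 0).

Definition strip (f g : X -> R) : set ST := [set p | f p.1 <= p.2 < g p.1].

Definition strips : set (set ST) :=
  [set A | exists f g, [/\ bcont f, bcont g & A = strip f g]].

Lemma bcont_cst (k : R) : bcont (fun _ : X => k).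
Proof. by split; [move=> x; exact: cvg_cst|exists `|k|]. Qed.

Lemma bcontD (f g : X -> R) : bcont f -> bcont g -> bcont (fun x => f x + g x).
Proof.
move=> [cf [M fM]] [cg [N gN]]; split; first by move=> x; apply: cvgD; [exact: cf|exact: cg].
by exists (M + N) => x; rewrite (le_trans (ler_normD _ _))// lerD.
Qed.

Lemma bcontZ (f : X -> R) k : bcont f -> bcont (fun x => k * f x).
Proof.
move=> [cf [M fM]]; split.
  by move=> x; apply: continuousM; [exact: cvg_cst|exact: cf].
by exists (`|k| * M) => x; rewrite normrM ler_wpM2l.
Qed.

Lemma bcontN (f : X -> R) : bcont f -> bcont (fun x => - f x).
Proof.
move=> [cf [M fM]]; split; first by move=> x; apply: cvgN; exact: cf.
by exists M => x; rewrite normrN.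
Qed.

Lemma bcontB (f g : X -> R) : bcont f -> bcont g -> bcont (fun x => f x - g x).
Proof. by move=> bf /bcontN bg; exact: bcontD. Qed.

Lemma bcont_min (f g : X -> R) : bcont f -> bcont g -> bcont (fun x => Num.min (f x) (g x)).
Proof.
move=> [cf [M fM]] [cg [N gN]]; split.
  by move=> x; apply: (@continuous_min R X f g); [exact: cf|exact: cg].
exists (Num.max M N) => x; case: (leP (f x) (g x)) => _; rewrite le_max.
  by rewrite fM.
by rewrite gN orbT.
Qed.

Lemma bcont_max (f g : X -> R) : bcont f -> bcont g -> bcont (fun x => Num.max (f x) (g x)).
Proof.
move=> [cf [M fM]] [cg [N gN]]; split.
  by move=> x; apply: (@continuous_max R X f g); [exact: cf|exact: cg].
exists (Num.max M N) => x; case: (leP (f x) (g x)) => _; rewrite le_max.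
  by rewrite gN orbT.
by rewrite fM.
Qed.

Lemma bcont_sum (f : nat -> X -> R) n : (forall i, bcont (f i)) ->
  bcont (fun x => \sum_(i < n) f i x).
Proof.
move=> bf; elim: n => [|n IH].
  by under eq_fun do rewrite big_ord0; exact: bcont_cst.
by under eq_fun do rewrite big_ord_recr; exact: bcontD.
Qed.

Let strips0 : strips set0.
Proof.
exists (fun=> 0), (fun=> 0); split; try exact: bcont_cst.
apply/seteqP; split => // p; rewrite /strip /= => /andP[p0 p1].
by have := le_lt_trans p0 p1; rewrite ltxx.
Qed.

Let stripsI : setI_closed strips.
Proof.
move=> _ _ [f1 [g1 [bf1 bg1 ->]]] [f2 [g2 [bf2 bg2 ->]]].
exists (fun x => Num.max (f1 x) (f2 x)), (fun x => Num.min (g1 x) (g2 x)); split.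
- exact: bcont_max.
- exact: bcont_min.
- apply/seteqP; split => p; rewrite /strip /= ge_max lt_min.
    by move=> [/andP[-> ->] /andP[-> ->]].
  by move=> /andP[/andP[-> ->] /andP[-> ->]].
Qed.

Let stripsD : semi_setD_closed strips.
Proof.
move=> _ _ [f1 [g1 [bf1 bg1 ->]]] [f2 [g2 [bf2 bg2 ->]]].
(* The parts of the first strip below and above the second. The inner maximum with [f2] in [P2]
   keeps them disjoint also where the removed fibre is empty. *)
pose P1 := strip f1 (fun x => Num.min (g1 x) (f2 x)).
pose P2 := strip (fun x => Num.max (f1 x) (Num.max (f2 x) (g2 x))) g1.
have P12 p : P1 p -> P2 p -> False.
  rewrite /P1 /P2 /strip /= lt_min !ge_max => /andP[_ /andP[_ h]] /andP[/andP[_ /andP[h' _]] _].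
  by have := le_lt_trans h' h; rewrite ltxx.
exists [set P1; P2]; split.
- exact: finite_set2.
- move=> _ [->|->].
    by exists f1, (fun x => Num.min (g1 x) (f2 x)); split => //; exact: bcont_min.
  exists (fun x => Num.max (f1 x) (Num.max (f2 x) (g2 x))), g1; split => //.
  by apply: bcont_max => //; exact: bcont_max.
- rewrite bigcup_setU !bigcup_set1; apply/seteqP; split => p.
    rewrite /P1 /P2 /strip /= => -[/andP[fp pg]] /negP; rewrite negb_and -ltNge -leNgt => h.
    rewrite fp pg lt_min pg !ge_max fp/=.
    have [lt|ge] := ltP p.2 (f2 p.1); first by left.
    by right; move: h; rewrite ltNge ge/= => ->.
  rewrite /P1 /P2 /strip /= lt_min !ge_max.
  move=> [/andP[-> /andP[-> lt]]|/andP[/andP[-> /andP[_ ge]] ->]]; split => //.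
    by rewrite leNgt lt.
  by rewrite [_ < _]ltNge ge andbF.
- move=> A B [->|->] [->|->] //= [p [h1 h2]].
    by have := P12 _ h1 h2.
  by have := P12 _ h2 h1.
Qed.

HB.instance Definition _ :=
  @isSemiRingOfSets.Build default_measure_display ST strips strips0 stripsI stripsD.

Definition fibre_length (A : set ST) (x : X) : R :=
  fine (lebesgue_measure [set r : R | A (x, r)]).

Lemma fibre_strip (f g : X -> R) x :
  [set r : R | strip f g (x, r)] = `[f x, g x[%classic.
Proof. by apply/seteqP; split => r /=; rewrite /strip /= in_itv. Qed.

Lemma fibre_length_strip (f g : X -> R) x :
  fibre_length (strip f g) x = Num.max 0 (g x - f x).
Proof.
rewrite /fibre_length fibre_strip lebesgue_measure_itv/= lte_fin.
case: ltP => fg /=; first by rewrite max_r// subr_ge0 ltW.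
by rewrite max_l// subr_le0.
Qed.

Lemma fibre_length_bcont (A : set ST) : strips A -> bcont (fibre_length A).
Proof.
move=> [f [g [bf bg ->]]].
rewrite (_ : fibre_length _ = fun x => Num.max 0 (g x - f x)); last first.
  by apply/funext => x; exact: fibre_length_strip.
by apply: bcont_max; [exact: bcont_cst|exact: bcontB].
Qed.

Section Daniell.
Variable L : (X -> R) -> R.
Hypothesis LD : forall f g, bcont f -> bcont g -> L (fun x => f x + g x) = L f + L g.
Hypothesis LZ : forall k f, bcont f -> L (fun x => k * f x) = k * L f.
Hypothesis L_ge0 : forall f, bcont f -> (forall x, 0 <= f x) -> 0 <= L f.
Hypothesis L1 : L (fun=> 1) = 1.
Hypothesis Ldown : forall h : nat -> X -> R, (forall n, bcont (h n)) ->
  (forall n x, h n.+1 x <= h n x) -> (forall x, h n x @[n --> \oo] --> 0) ->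
  L (h n) @[n --> \oo] --> 0.

Lemma daniellN f : bcont f -> L (fun x => - f x) = - L f.
Proof.
move=> bf; rewrite -[RHS]mulN1r -LZ//; congr L; apply/funext => x.
by rewrite mulN1r.
Qed.

Lemma daniell_cst k : L (fun=> k) = k.
Proof.
rewrite -[RHS]mulr1 -L1 -LZ; last exact: bcont_cst.
by congr L; apply/funext => x; rewrite mulr1.
Qed.

Lemma daniell_sum (f : nat -> X -> R) n : (forall i, bcont (f i)) ->
  L (fun x => \sum_(i < n) f i x) = \sum_(i < n) L (f i).
Proof.
move=> bf; elim: n => [|n IH].
  by under eq_fun do rewrite big_ord0; rewrite daniell_cst big_ord0.
under eq_fun do rewrite big_ord_recr; rewrite LD//; last exact: bcont_sum.
by rewrite big_ord_recr IH.
Qed.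

(** The truncation at 0 only serves nonnegativity on arbitrary sets, which the measure structure
    asks for; on strips it changes nothing. *)
Definition strip_content (A : set ST) : \bar R := (Num.max 0 (L (fibre_length A)))%:E.

Lemma fibre_length_ge0 (A : set ST) x : 0 <= fibre_length A x.
Proof. exact: fine_ge0. Qed.

Lemma strip_contentE (A : set ST) : strips A -> strip_content A = (L (fibre_length A))%:E.
Proof.
move=> sA; rewrite /strip_content max_r// L_ge0//; first exact: fibre_length_bcont.
by move=> x; exact: fibre_length_ge0.
Qed.

Let strip_content0 : strip_content set0 = 0%E.
Proof.
rewrite strip_contentE//; congr EFin; rewrite -[RHS]daniell_cst; congr L.
by apply/funext => x; rewrite /fibre_length (_ : [set _ | _] = set0) ?measure0.
Qed.

Let strip_content_ge0 (A : set ST) : (0 <= strip_content A)%E.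
Proof. by rewrite lee_fin le_max lexx. Qed.

(** On each fibre, countable additivity of Lebesgue measure makes the remainder [h n] decrease to 0;
    as the remainders are continuous, [Ldown] applies. *)
Let strip_content_sigma : semi_sigma_additive strip_content.
Proof.
move=> F mF tF mUF; rewrite strip_contentE//.
pose U := \bigcup_n F n.
pose h n x := fibre_length U x - \sum_(i < n) fibre_length (F i) x.
have bF i := fibre_length_bcont (mF i).
have bU : bcont (fibre_length U) := fibre_length_bcont mUF.
have bh n : bcont (h n) by apply: bcontB => //; exact: (bcont_sum n bF).
have hE n : L (h n) = L (fibre_length U) - \sum_(i < n) L (fibre_length (F i)).
  have bS := bcont_sum n bF.
  by rewrite /h LD//; [rewrite daniellN// (daniell_sum n bF)|exact: bcontN].
have h0 : L (h n) @[n --> \oo] --> 0.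
  apply: Ldown => // [n x|x].
    by rewrite /h big_ord_recr/= lerD2l lerN2 lerDl fibre_length_ge0.
  pose G n : set R := [set r | F n (x, r)].
  have mG n : measurable (G n).
    by have [f [g [_ _ E]]] := mF n; rewrite /G E fibre_strip; exact: measurable_itv.
  have UG : [set r | U (x, r)] = \bigcup_n G n by [].
  have mUG : measurable (\bigcup_n G n).
    have [f [g [_ _ UE]]] := mUF.
    by rewrite -UG /U UE fibre_strip; exact: measurable_itv.
  have tG : trivIset setT G.
    by move=> i j _ _ [r [Gi Gj]]; apply: tF => //; exists (x, r).
  have fin A : strips A -> (fibre_length A x)%:E = lebesgue_measure [set r : R | A (x, r)].
    move=> [f [g [_ _ ->]]]; rewrite /fibre_length fineK// fibre_strip.
    by rewrite lebesgue_measure_itv/=; case: ifP.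
  have : (\sum_(0 <= i < n) (@lebesgue_measure R) (G i))%E @[n --> \oo] --> (fibre_length U x)%:E.
    by rewrite (fin _ mUF); exact: measure_semi_sigma_additive.
  move=> /fine_cvgP[_] h1.
  have h2 : \sum_(i < n) fibre_length (F i) x @[n --> \oo] --> fibre_length U x.
    apply: cvg_trans h1; apply: near_eq_cvg; apply: nearW => n /=.
    rewrite big_mkord -[RHS]/(fine (_)%:E) -sumEFin.
    by congr fine; apply: eq_bigr => i _; rewrite (fin _ (mF i)).
  rewrite -[X in _ --> X](subrr (fibre_length U x)).
  by apply: cvgB => //; exact: cvg_cst.
rewrite (_ : (fun n => _) = EFin \o (fun n => L (fibre_length U) - L (h n))); last first.
  apply/funext => n /=; rewrite hE opprB addrC subrK big_mkord -sumEFin.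
  by apply: eq_bigr => i _; exact: (strip_contentE (mF i)).
apply/cvg_EFin; first exact: nearW.
rewrite -[X in _ --> X]subr0.
by apply: cvgB => //; exact: cvg_cst.
Qed.

HB.instance Definition _ := isMeasure.Build _ _ _ strip_content
  strip_content0 strip_content_ge0 strip_content_sigma.

Hypothesis cX : @cbase R X.

Local Notation SG := (g_sigma_algebraType (@measurable _ ST)).

Definition band : set SG := strip (fun=> 0) (fun=> 1).

Lemma strip_measurable f g : bcont f -> bcont g -> measurable (strip f g : set SG).
Proof. by move=> bf bg; apply: sub_sigma_algebra; exists f, g. Qed.

Lemma measurable_band : measurable band.
Proof. by apply: strip_measurable; exact: bcont_cst. Qed.

(** The cylinder over a cozero set of [f i] is the union over k of the strips between -k [f i] and k
    [f i], whose fibres are empty where [f i] vanishes. *)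
Lemma strip_fst_measurable : @measurable_fun _ _ SG (borel X) setT fst.
Proof.
apply: measurable_to_borel => U oU.
have [f [cf f01 fU]] := cX.
have bf i : bcont (f i).
  split=> //; exists 1 => x; have /andP[f0 f1] := f01 i x.
  by rewrite ger0_norm.
pose P i : set SG := [set p | [set y | 0 < f i y] `<=` U] `&` \bigcup_k strip (fun x => - (k%:R * f i x)) (fun x => k%:R * f i x).
rewrite (_ : _ @^-1` _ = \bigcup_i P i).
  apply: bigcup_measurable => i _; rewrite /P.
  have [h|h] := pselect ([set y | 0 < f i y] `<=` U); last first.
    by rewrite (_ : [set p | _] = set0) ?set0I//; apply/seteqP; split.
  rewrite (_ : [set p | _] = setT) ?setTI//; last by apply/seteqP; split.
  apply: bigcup_measurable => k _; apply: strip_measurable; last exact: bcontZ.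
  by apply: bcontN; exact: bcontZ.
apply/seteqP; split => [[x r] /= Ux|[x r] [i _ [/= fiU [k _]]]].
  have [i [fi fiU]] := fU _ _ oU Ux; exists i => //; split => //.
  have [k _ /(_ k (leqnn _)) /= hk] := nbhs_infty_gtr (`|r| / f i x).
  exists k => //; rewrite /strip /=.
  move: hk; rewrite ltr_pdivrMr// ltr_norml => /andP[h1 h2].
  by rewrite h2 ltW.
rewrite /strip /= => /andP[h1 h2]; apply: fiU => /=.
have /andP[f0 _] := f01 i x; rewrite lt_neqAle f0 andbT; apply/eqP => fx.
by move: h1 h2; rewrite -fx mulr0 oppr0 => /le_lt_trans/[apply]; rewrite ltxx.
Qed.

Definition daniell_measure (B : set (borel X)) : \bar R :=
  measure_extension strip_content ((fst @^-1` B : set SG) `&` band).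

Let daniell_measurable (B : set (borel X)) : measurable B ->
  measurable ((fst @^-1` B : set SG) `&` band).
Proof.
move=> mB; apply: measurableI; last exact: measurable_band.
by rewrite -[_ @^-1` _]setTI; exact: strip_fst_measurable.
Qed.

Let daniell_measure0 : daniell_measure set0 = 0%E.
Proof. by rewrite /daniell_measure preimage_set0 set0I measure0. Qed.

Let daniell_measure_ge0 B : (0 <= daniell_measure B)%E.
Proof. exact: measure_ge0. Qed.

Let daniell_measure_sigma : semi_sigma_additive daniell_measure.
Proof.
move=> F mF tF mUF; rewrite /daniell_measure preimage_bigcup setI_bigcupl.
apply: measure_semi_sigma_additive.
- by move=> i; exact: daniell_measurable.
- by move=> i j _ _ [p [[Fi _] [Fj _]]]; apply: tF => //; exists p.1.
- by rewrite -setI_bigcupl -preimage_bigcup; exact: daniell_measurable.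
Qed.

HB.instance Definition _ := isMeasure.Build _ _ _ daniell_measure
  daniell_measure0 daniell_measure_ge0 daniell_measure_sigma.

Let measure_extension_strip f g : bcont f -> bcont g ->
  measure_extension strip_content (strip f g : set SG) = (L (fun x => Num.max 0 (g x - f x)))%:E.
Proof.
move=> bf bg; rewrite /measure_extension measurable_mu_extE; last by exists f, g.
rewrite /= strip_contentE; last by exists f, g.
by congr (L _)%:E; apply/funext => x; exact: fibre_length_strip.
Qed.

Let daniell_measure_setT : daniell_measure setT = 1%E.
Proof.
rewrite /daniell_measure preimage_setT setTI measure_extension_strip; try exact: bcont_cst.
by congr EFin; rewrite -[RHS]daniell_cst; congr L; apply/funext => x; rewrite subr0 max_r.
Qed.

HB.instance Definition _ := Measure_isProbability.Build _ _ _ daniell_measure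
  daniell_measure_setT.

Definition daniell_prob : Prob R X := daniell_measure : probability (borel X) R.

(** The strip between 0 and [h] is contained in the part of [band] above [U]. *)
Lemma daniell_le_pr (U : set X) h : open U -> bcont h -> (forall x, 0 <= h x) ->
  (forall x, h x <= \1_U x) -> L h <= pr daniell_prob U.
Proof.
move=> oU bh h0 hU; rewrite -lee_fin -prE; last exact: open_borel.
have -> : (L h)%:E = measure_extension strip_content (strip (fun=> 0) h : set SG).
  rewrite measure_extension_strip//; last exact: bcont_cst.
  by congr (L _)%:E; apply/funext => x; rewrite subr0 max_r.
apply: le_measure; rewrite ?inE.
- by apply: strip_measurable => //; exact: bcont_cst.
- by apply: daniell_measurable; exact: open_borel.
- move=> [x r]; rewrite /strip /band /strip /= => /andP[r0 rh]; split => /=.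
    apply: contrapT => nU; have := lt_le_trans rh (hU x).
    by rewrite indicE memNset//= ltNge r0.
  by rewrite r0/= (lt_le_trans rh)// (le_trans (hU x))// indicE lern1 leq_b1.
Qed.

Lemma sum_clip n (y : R) : 0 <= y ->
  \sum_(j < n) Num.max 0 (Num.min 1 (y - j%:R)) = Num.min y n%:R.
Proof.
move=> y0; elim: n => [|n IH]; first by rewrite big_ord0 min_r.
rewrite big_ord_recr /= IH -[n.+1]addn1 natrD.
have [h|h] := leP y n%:R.
  rewrite max_l ?addr0; last by rewrite ge_min subr_le0 h orbT.
  by rewrite min_l// (le_trans h)// lerDl.
rewrite max_r; last by rewrite le_min ler01 subr_ge0 ltW.
have [h'|h'] := leP 1 (y - n%:R).
  by rewrite min_r//; lra.
by rewrite min_l; lra.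
Qed.

(** Cut n f into slices [g j] of height at most 1. Each has L-value at most the probability of n f >
    j, and these probabilities sum to at most 1 + n E f; divide by n and let n grow. *)
Let daniell_le01 f : bcont f -> (forall x, 0 <= f x <= 1) -> L f <= Ex daniell_prob f.
Proof.
move=> bf f01; set nu := daniell_prob.
have bmf := bcontb bf.
suff h n : (0 < n)%N -> n%:R * L f <= 1 + n%:R * Ex nu f.
  rewrite leNgt; apply/negP; rewrite -subr_gt0 => lt.
  have [k _ /(_ k (leqnn _)) /= hk] := nbhs_infty_gtr (L f - Ex nu f)^-1.
  have k0 : (0 < k)%N by rewrite -(ltr_nat R) (lt_trans _ hk)// invr_gt0.
  have := h k k0; rewrite leNgt => /negP; apply.
  rewrite -ltrBrDr -mulrBr.
  by move: hk; rewrite -[X in X < _]mul1r ltr_pdivrMr.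
move=> n0.
have n0' : 0 <= n%:R :> R by [].
pose g j x := Num.max 0 (Num.min 1 (n%:R * f x - j%:R)).
have bg j : bcont (g j).
  apply: bcont_max; first exact: bcont_cst.
  apply: bcont_min; first exact: bcont_cst.
  by apply: bcontB; [exact: bcontZ|exact: bcont_cst].
pose U j := [set x | j%:R < n%:R * f x].
have oU j : open (U j).
  rewrite -[U j]/((fun x => n%:R * f x) @^-1` [set r | j%:R < r]).
  apply: open_comp; last exact: open_gt.
  by move=> x _; have [+ _] := bcontZ n%:R bf; exact.
have mU j : measurable (U j : set (borel X)) by exact: open_borel.
have gU j : L (g j) <= pr nu (U j).
  apply: daniell_le_pr => // x; first by rewrite le_max lexx.
  rewrite indicE; have [/set_mem xU|/negP xU] := boolP (x \in U j).
    by rewrite ge_max ler01 ge_min lexx.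
  rewrite ge_max lexx/= ge_min subr_le0 leNgt; apply/orP; right; apply/negP => h.
  by apply: xU; apply/mem_set; rewrite /U /= ltNge; exact/negP.
rewrite -LZ//.
have -> : (fun x => n%:R * f x) = (fun x => \sum_(j < n) g j x).
  apply/funext => x; have /andP[f0 f1] := f01 x.
  rewrite /g sum_clip ?mulr_ge0// min_l//.
  by rewrite -[leRHS]mulr1 ler_wpM2l.
rewrite (daniell_sum n bg).
apply: (@le_trans _ _ (\sum_(j < n) pr nu (U j))); first by apply: ler_sum => j _; exact: gU.
(* The level j = 0 is bounded by 1; shifting the other levels by one brings them to the form of
   [layer_cake_le]. *)
rewrite -(prednK n0) big_ord_recl/=; apply: lerD; first exact: pr_le1.
rewrite (prednK n0) -ExZ//.
apply: (@le_trans _ _ (\sum_(j < n) pr nu (U j.+1))).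
  rewrite -[in leRHS](prednK n0) big_ord_recr/= lerDl; exact: pr_ge0.
have bU j : bmeas (\1_(U j.+1) : X -> R) by exact: bmeas_indic.
under eq_bigr do rewrite -Ex_indic//.
rewrite -(Ex_sum nu n bU); apply: le_Ex; [exact: (bmeas_sum n bU)|exact: bmeasZ|].
move=> x.
rewrite (eq_bigr (fun j : 'I_n => ((j.+1%:R : R) < n%:R * f x)%R%:R)).
  by apply: layer_cake_le; have /andP[f0 _] := f01 x; exact: mulr_ge0.
by move=> j _; rewrite indicE; congr (_%:R); congr nat_of_bool; apply/idP/idP; rewrite inE.
Qed.

Let daniell_le f : bcont f -> L f <= Ex daniell_prob f.
Proof.
move=> bf; have [_ [M fM]] := bf.
pose N := Num.max M 1; have N0 : 0 < N by rewrite lt_max ltr01 orbT.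
have fN x : `|f x| <= N by rewrite (le_trans (fM x))// le_max lexx.
have N20 : 0 < 2 * N by rewrite mulr_gt0.
pose h x := (2 * N)^-1 * (f x + N).
have bfN : bcont (fun x => f x + N) by apply: bcontD => //; exact: bcont_cst.
have h01 x : 0 <= h x <= 1.
  rewrite /h ler_pdivrMl// mulr_ge0/=; last 2 first.
    by rewrite invr_ge0 ltW.
    by have := fN x; rewrite ler_norml => /andP[]; lra.
  by have := fN x; rewrite ler_norml => /andP[]; lra.
have := @daniell_le01 h (bcontZ _ bfN) h01.
rewrite /h LZ// ExZ; last exact: bcontb.
rewrite ler_pM2l ?invr_gt0// LD//; last exact: bcont_cst.
rewrite ExD; [|exact: bcontb|exact: bmeas_cst].
by rewrite daniell_cst Ex_cst lerD2r.
Qed.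

(** The inequality of [daniell_le], applied to both f and -f, is an equality. *)
Theorem daniell_stone : exists mu : Prob R X, forall f, bcont f -> Ex mu f = L f.
Proof.
exists daniell_prob => f bf; apply/eqP; rewrite eq_le daniell_le// andbT.
rewrite -lerN2 -daniellN// -ExN; last exact: bcontb.
by apply: daniell_le; exact: bcontN.
Qed.

End Daniell.
End Strip.

(** * Compact sets of probability measures *)

Section Metrizable.
Variables (R : realType) (X : ptopologicalType) (d : X -> X -> R).
Hypothesis dP : metric_for d.

Lemma metric_refl x : d x x = 0.
Proof. by case: dP => d0 _; apply/d0. Qed.

Lemma metric_sym x y : d x y = d y x.
Proof. by case: dP => _ [ds _]; exact: ds. Qed.

Lemma metric_triangle x y z : d x z <= d x y + d y z.
Proof. by case: dP => _ [_ [dt _]]; exact: dt. Qed.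

Lemma metric_ge0 x y : 0 <= d x y.
Proof. by have := metric_triangle x y x; rewrite metric_refl (metric_sym y); lra. Qed.

Lemma open_metric_ball x e : open [set y | d x y < e].
Proof.
case: dP => _ [_ [_ op]]; apply/op => y /= xy.
exists (e - d x y); split; first by rewrite subr_gt0.
by move=> z /= yz; have := metric_triangle x y z; lra.
Qed.

Lemma metric_continuous a : continuous (fun x => d x a).
Proof.
move=> x; apply/cvgrPdist_lt => e e0.
have : nbhs x [set y | d x y < e].
  by apply: open_nbhs_nbhs; split; [exact: open_metric_ball|rewrite /= metric_refl].
apply: filterS => y /= xy; rewrite ltr_norml.
have := metric_triangle x y a; have := metric_triangle y x a; rewrite (metric_sym y x).
by move=> ? ?; apply/andP; split; lra.
Qed.

(** The cozero sets are the balls of radius 1/(j+1) about the points of the dense sequence. *)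
Lemma separable_cbase : separable X -> cbase R X.
Proof.
move=> [u uD].
apply: (@cbase_count R (nat * nat)%type X (fun ij x => Num.max 0 (ij.2.+1%:R^-1 - d x (u ij.1)))).
split.
- move=> [i j] x; apply: (@continuous_max R X (fun=> 0)); first exact: cvg_cst.
  by apply: cvgB; [exact: cvg_cst|exact: metric_continuous].
- move=> [i j] x /=; rewrite le_max lexx/= ge_max ler01/=.
  have a1 : j.+1%:R^-1 <= 1 :> R by rewrite invf_le1// ler1n.
  by rewrite lerBlDr (le_trans a1)// lerDl metric_ge0.
- move=> U x oU Ux; case: (dP) => _ [_ [_ op]].
  have [e [e0 eU]] := (op U).1 oU x Ux.
  have e20 : 0 < e / 2 by rewrite divr_gt0.
  have [j _ /(_ j (leqnn _)) /= je] := near_infty_natSinv_lt (PosNum e20).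
  have [|i ui] := uD _ (open_metric_ball x j.+1%:R^-1).
    by exists x; rewrite /= metric_refl invr_gt0.
  exists (i, j); split => /=; first by rewrite lt_max subr_gt0 ui orbT.
  move=> y /=; rewrite lt_max ltxx/= subr_gt0 => yu; apply: eU => /=.
  have := metric_triangle x (u i) y; rewrite (metric_sym (u i) y).
  by move: je ui yu => /=; move: (_^-1) => a; lra.
Qed.

Lemma compact_separable : compact [set: X] -> separable X.
Proof.
rewrite compact_cover => cX.
have net n : exists D : seq X, forall x, exists2 y, y \in D & d y x < n.+1%:R^-1.
  have [|x _|D _ DX] := cX X setT (fun x => [set y | d x y < n.+1%:R^-1]).
  - by move=> x _; exact: open_metric_ball.
  - by exists x => //=; rewrite metric_refl invr_gt0.
  - by exists (finmap.enum_fset D) => x; have [y yD yx] := DX x I; exists y.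
have /choice[D DP] := net.
exists (fun k => if unpickle k is Some (n, i) then nth point (D n) i else point).
move=> U oU [x Ux]; case: (dP) => _ [_ [_ op]].
have [e [e0 eU]] := (op U).1 oU x Ux.
have [j _ /(_ j (leqnn _)) /= je] := near_infty_natSinv_lt (PosNum e0).
have [y yD yx] := DP j x.
exists (pickle (j, index y (D j))); rewrite pickleK nth_index//.
by apply: eU => /=; rewrite metric_sym (lt_trans yx).
Qed.

End Metrizable.

Lemma polish_cbase (R : realType) (X : ptopologicalType) : polish R X -> cbase R X.
Proof. by move=> [sX [d [dX _]]]; exact: (separable_cbase dX). Qed.

Lemma compact_metrizable_cbase (R : realType) (X : ptopologicalType) :
  compact_metrizable R X -> cbase R X.
Proof.
by move=> [cX [d dX]]; apply: (separable_cbase dX); exact: (compact_separable dX).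
Qed.

Lemma fmap_ultra (I T : Type) (f : I -> T) (F : set_system I) :
  UltraFilter F -> UltraFilter (f @ F).
Proof.
move=> UF; split; first exact: fmap_proper_filter.
move=> G GF FG; apply/funext => A; apply/propext; split; last exact: FG.
move=> GA; have [//|FnA] := in_ultra_setVsetC (f @^-1` A) UF.
have GnA : G (~` A) by apply: FG.
by have [x [Ax nAx]] := filter_ex (filterI GA GnA); have := nAx Ax.
Qed.

Lemma ultra_cvg (I : Type) (X : topologicalType) (K : set X) (F : set_system I) (f : I -> X) :
  UltraFilter F -> compact K -> (\forall i \near F, K (f i)) ->
  exists2 x, K x & f @ F --> x.
Proof.
move=> UF; rewrite compact_ultra => cK FK.
by have [x [Kx Fx]] := cK _ (fmap_ultra f UF) FK; exists x.
Qed.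

Lemma cvg_upper (R : realType) (I : Type) (F : set_system I) (f : I -> R) (l c : R) :
  ProperFilter F -> f @ F --> l -> (\forall i \near F, f i <= c) -> l <= c.
Proof. by move=> PF fl fc; exact: (@closed_cvg I R F PF f [set r | r <= c] (@closed_le R c) fc l fl). Qed.

Lemma cvg_lower (R : realType) (I : Type) (F : set_system I) (f : I -> R) (l c : R) :
  ProperFilter F -> f @ F --> l -> (\forall i \near F, c <= f i) -> c <= l.
Proof. by move=> PF fl fc; exact: (@closed_cvg I R F PF f [set r | c <= r] (@closed_ge R c) fc l fl). Qed.

Lemma ler_cvg_filter (R : realType) (I : Type) (F : set_system I) (f g : I -> R) (l l' : R) :
  ProperFilter F -> f @ F --> l -> g @ F --> l' -> (\forall i \near F, f i <= g i) -> l <= l'.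
Proof.
move=> PF fl gl fg; rewrite -subr_ge0; apply: (cvg_lower PF (cvgB gl fl)).
by apply: filterS fg => i; rewrite subr_ge0.
Qed.

Section Compact.
Variable R : realType.
Implicit Types X Y K : ptopologicalType.

(** Uniform continuity from below along increasing open covers. It replaces tightness: it is exactly
    what makes an ultrafilter limit of the integrals continuous along decreasing sequences. *)
Definition tau_smooth X (M : set (Prob R X)) := forall U : nat -> set X,
  (forall n, open (U n)) -> (forall n, U n `<=` U n.+1) ->
  (forall x, exists n, U n x) ->
  forall e : R, 0 < e -> exists n, forall mu, M mu -> 1 - e <= pr mu (U n).

Section Limit.
Variables (X : ptopologicalType) (M : set (Prob R X)).
Variables (I : Type) (F : set_system I) (m : I -> Prob R X).
Hypotheses (cX : cbase R X) (tM : tau_smooth M) (UF : UltraFilter F).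
Hypothesis FM : \forall i \near F, M (m i).

Let L (f : X -> R) : R := lim (Ex (m i) f @[i --> F]).

Let LP f : bcont f -> Ex (m i) f @[i --> F] --> L f.
Proof.
move=> bf; have [_ [B fB]] := bf.
have [|x _ Fx] := @ultra_cvg I R^o `[- B, B]%classic F (fun i => Ex (m i) f) UF (@segment_compact _ _ _).
  apply: nearW => i /=; rewrite in_itv/= -[- B](Ex_cst (m i)) -[X in _ && (_ <= X)](Ex_cst (m i)).
  have bfm := bcontb bf; have bc k := @bmeas_cst R X k.
  by apply/andP; split; apply: le_Ex => // x; have := fB x; rewrite ler_norml => /andP[].
by rewrite /L; move/cvg_lim: (Fx) => ->.
Qed.

Let Luniq f l : Ex (m i) f @[i --> F] --> l -> L f = l.
Proof. exact: cvg_lim. Qed.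

(** Bounded integrals converge along an ultrafilter, to a functional [L] that is visibly linear,
    positive and normalized. For [Ldown], the open sets where [h n] is below a small constant
    increase to X, so one of them is nearly full for all measures of [M] at once. *)
Lemma tau_smooth_ultra_cvg : exists mu : Prob R X, m @ F --> mu.
Proof.
have le f g : bcont f -> bcont g -> (forall x, f x <= g x) -> L f <= L g.
  move=> bf bg fg; apply: (ler_cvg_filter _ (LP bf) (LP bg)).
  by apply: nearW => i; apply: le_Ex => //; exact: bcontb.
have LD f g : bcont f -> bcont g -> L (fun x => f x + g x) = L f + L g.
  move=> bf bg; apply: Luniq.
  rewrite (_ : (fun i => _) = (fun i => Ex (m i) f + Ex (m i) g)); last first.
    by apply/funext => i; rewrite ExD//; exact: bcontb.
  by apply: cvgD; exact: LP.
have LZ k f : bcont f -> L (fun x => k * f x) = k * L f.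
  move=> bf; apply: Luniq.
  rewrite (_ : (fun i => _) = (fun i => k * Ex (m i) f)); last first.
    by apply/funext => i; rewrite ExZ//; exact: bcontb.
  by apply: cvgM; [exact: cvg_cst|exact: LP].
have Lc k : L (fun=> k) = k.
  apply: Luniq; rewrite (_ : (fun i => _) = (fun i => k)); first exact: cvg_cst.
  by apply/funext => i; rewrite Ex_cst.
have L_ge0 f : bcont f -> (forall x, 0 <= f x) -> 0 <= L f.
  by move=> bf f0; rewrite -(Lc 0); apply: le => //; exact: bcont_cst.
have Ldown (h : nat -> X -> R) : (forall n, bcont (h n)) ->
    (forall n x, h n.+1 x <= h n x) -> (forall x, h n x @[n --> \oo] --> 0) ->
    L (h n) @[n --> \oo] --> 0.
  move=> bh hS h0.
  have hle n k x : (n <= k)%N -> h k x <= h n x.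
    move=> /subnK <-; elim: (k - n)%N => // j IH.
    by rewrite addSn (le_trans (hS _ _)).
  have hge0 n x : 0 <= h n x.
    by apply: (cvg_upper _ (h0 x)); exists n => // k /= nk; exact: hle.
  have [_ [B' hB']] := bh 0%N; pose B := Num.max B' 1.
  have B0 : 0 < B by rewrite lt_max ltr01 orbT.
  have hB x : h 0%N x <= B.
    by rewrite (le_trans (ler_norm _))// (le_trans (hB' x))// le_max lexx.
  (* The estimate below is e' + B e', from the set where h n < e' and from its complement, of mass
     at most e'. *)
  apply/cvgrPdist_le => e e0; pose e' := e / (1 + B).
  have B10 : 0 < 1 + B by rewrite addr_gt0.
  have e'0 : 0 < e' by rewrite divr_gt0.
  pose U n := [set x | h n x < e'].
  have oU n : open (U n).
    rewrite -[U n]/((h n) @^-1` [set r | r < e']); apply: open_comp; last exact: open_lt.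
    by move=> x _; have [+ _] := bh n; exact.
  have [||n nM] := tM oU _ _ e'0.
  - by move=> n x; rewrite /U /=; exact: le_lt_trans.
  - move=> x; have /cvgr_lt/(_ _ e'0) [n _ /(_ n (leqnn _)) /= hn] := h0 x.
    by exists n.
  exists n => // k /= nk; rewrite sub0r normrN ger0_norm; last exact: L_ge0.
  apply: (le_trans (le (h k) (h n) _ _ _)) => // [x|]; first exact: hle.
  apply: (cvg_upper _ (LP (bh n))).
  apply: filterS FM => i Mi.
  have mU : measurable (U n : set (borel X)) by exact: open_borel.
  have mCU : measurable (~` U n : set (borel X)) by exact: measurableC.
  have bI : bmeas (fun x => B * \1_(~` U n) x) by apply: bmeasZ; exact: bmeas_indic.
  apply: (@le_trans _ _ (Ex (m i) (fun x => e' + B * \1_(~` U n) x))).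
    apply: le_Ex; [exact: bcontb|by apply: bmeasD => //; exact: bmeas_cst|].
    move=> x; rewrite indicE; have [xU|xU] := boolP (x \in ~` U n); rewrite ?mulr1 ?mulr0 ?addr0.
      by rewrite (le_trans (hle _ _ x (leq0n n)))// (le_trans (hB x))// lerDr ltW.
    by apply: ltW; apply: contrapT => h'; move/negP: xU; apply; exact/mem_set.
  rewrite ExD//; last exact: bmeas_cst.
  rewrite Ex_cst ExZ; last exact: bmeas_indic.
  rewrite Ex_indic// pr_setC//.
  have h1 : B * (1 - pr (m i) (U n)) <= B * e'.
    by rewrite ler_pM2l//; have := nM _ Mi; lra.
  rewrite (le_trans (lerD (lexx e') h1))//.
  by rewrite -[X in X + _]mul1r -mulrDl /e' mulrC divfK// gt_eqF.
have [mu muL] := daniell_stone LD LZ L_ge0 (Lc 1) Ldown cX.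
exists mu; apply/cvg_ProbP => f bf; rewrite muL//; exact: LP.
Qed.

End Limit.

Lemma tau_smooth1 X (nu : Prob R X) : tau_smooth [set nu].
Proof.
move=> U oU US UT e e0.
have mU n : measurable (U n : set (borel X)) by exact: open_borel.
have ndU : nondecreasing_seq U.
  apply/nondecreasing_seqP => n; apply/subsetPset; exact: US.
have UTT : \bigcup_n U n = setT.
  by apply/seteqP; split => // x _; have [n Un] := UT x; exists n.
have : (pm nu \o (U : nat -> set (borel X))) n @[n --> \oo] --> 1%E.
  rewrite -(probability_setT (pm nu)) -[setT]UTT.
  by apply: nondecreasing_cvg_mu => //; exact: bigcup_measurable.
move=> /fine_cvgP[_] /= h.
have /cvgr_ge/(_ (1 - e)) := h.
rewrite ltrBlDr ltrDl => /(_ e0) [n _ /(_ n (leqnn _)) /= hn].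
by exists n => _ ->.
Qed.

Lemma tau_smoothS X (M N : set (Prob R X)) : M `<=` N -> tau_smooth N -> tau_smooth M.
Proof.
move=> MN tN U oU US UT e e0; have [n h] := tN U oU US UT e e0.
by exists n => mu /MN; exact: h.
Qed.

(** Let [V n] be the set of x whose whole fibre lies in [U n]. Compactness of K makes [V n] open, by
    the tube lemma, and makes the [V n] exhaust X; smoothness of the marginals then applies to
    them. *)
Lemma tau_smooth_marg X K (M : set (Prob R X)) : compact [set: K] -> tau_smooth M ->
  tau_smooth [set k : Prob R (X * K)%type | exists2 m, M m & has_marg1 k m].
Proof.
move=> /compact_near_coveringP cK tM U oU US UT e e0.
have UM n k : (n <= k)%N -> U n `<=` U k.
  by move=> /subnK <-; elim: (k - n)%N => // j IH; rewrite addSn; exact: subset_trans IH (US _).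
pose V n := [set x | forall y, U n (x, y)].
have oV n : open (V n).
  rewrite openE => x Vx.
  have /(_ _ _) h := cK X (nbhs x) (fun x' y => U n (x', y)) _.
  have : \forall x' \near x, [set: K] `<=` (fun y => U n (x', y)).
    apply: h => y _.
    have [[A B] /= [Ax By] AB] : nbhs (x, y) (U n).
      by apply: open_nbhs_nbhs; split => //; exact: Vx.
    by exists (B, A) => // -[y' x'] /= [By' Ax']; apply: AB.
  by apply: filterS => x' h' y; exact: h'.
have VS n : V n `<=` V n.+1 by move=> x Vx y; exact/US/Vx.
have VT x : exists n, V n x.
  have : \forall n \near \oo, [set: K] `<=` (fun y => U n (x, y)).
    apply: (cK nat \oo (fun n y => U n (x, y))) => y _.
    have [n Un] := UT (x, y).
    have [[A B] /= [Ax By] AB] : nbhs (x, y) (U n) by exact: open_nbhs_nbhs.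
    exists (B, [set k | (n <= k)%N]) => /=; first by split => //; exists n.
    move=> [y' k] /= [By' nk]; apply: (UM _ _ nk); apply: AB; split => //=.
    exact: nbhs_singleton.
  by move=> [n _ /(_ n (leqnn _)) /= h]; exists n => y; exact: h.
have [n nM] := tM V oV VS VT e e0.
exists n => k [m Mm km]; apply: (le_trans (nM _ Mm)).
have mV : measurable (V n : set (borel X)) by exact: open_borel.
have mfV : measurable (fst @^-1` (V n) : set (borel (X * K)%type)).
  apply: open_borel; apply: open_comp => // -[x y] _; exact: cvg_fst.
rewrite /pr -km// -/(pr k (fst @^-1` V n)); apply: le_pr => //; first exact: open_borel.
by move=> [x y] /=; exact.
Qed.

(** The open sets increase, so a single one of them contains [E]. *)
Lemma tau_smooth_compact X (E : set X) : compact E -> measurable (E : set (borel X)) ->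
  tau_smooth [set mu : Prob R X | pm mu (E : set (borel X)) = 1%E].
Proof.
move=> /compact_near_coveringP cE mE U oU US UT e e0.
have UM n k : (n <= k)%N -> U n `<=` U k.
  by move=> /subnK <-; elim: (k - n)%N => // j IH; rewrite addSn; exact: subset_trans IH (US _).
have : \forall n \near \oo, E `<=` U n.
  apply: (cE nat \oo (fun n => U n)) => x _.
  have [n Un] := UT x.
  exists (U n, [set k | (n <= k)%N]) => /=.
    by split; [exact: open_nbhs_nbhs|exists n].
  by move=> [y k] /= [Uy nk]; exact: (UM _ _ nk).
move=> [n _ /(_ n (leqnn _)) /= EU]; exists n => mu muE.
apply: (@le_trans _ _ (pr mu E)); first by rewrite /pr muE/= gerBl ltW.
by apply: le_pr => //; exact: open_borel.
Qed.

(** This form of the marginal condition is preserved under weak limits. *)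
Lemma has_marg1P X Y (k : Prob R (X * Y)%type) (m : Prob R X) : cbase R X ->
  has_marg1 k m <-> (forall f, bcont f -> Ex k (fun p => f p.1) = Ex m f).
Proof.
move=> cX; have mfst : @measurable_fun _ _ (borel (X * Y)%type) (borel X) setT fst.
  by apply: continuous_borel => -[x y]; exact: cvg_fst.
split => [km f bf|km B mB].
  rewrite -(Ex_pf mfst); last exact: bcontb.
  by apply: eq_pr_Ex => A mA; rewrite (pfE mfst); exact: km.
rewrite -(pfE mfst); apply: (bcont_prob_ext cX) => // f bf.
by rewrite (Ex_pf mfst) ?km//; exact: bcontb.
Qed.

Lemma cvg_has_marg1 I (F : set_system I) X Y (k : I -> Prob R (X * Y)%type)
    (m : I -> Prob R X) k0 m0 : ProperFilter F -> cbase R X ->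
  k @ F --> k0 -> m @ F --> m0 -> (\forall i \near F, has_marg1 (k i) (m i)) ->
  has_marg1 k0 m0.
Proof.
move=> PF cX kk mm km; apply/has_marg1P => // f bf.
have bf' : bcont (fun p : X * Y => f p.1).
  by apply: bcont_comp => // -[x y]; exact: cvg_fst.
have FF : Filter F by exact: _.
have h1 := (cvg_ProbP _ _ FF).1 kk _ bf'.
have h2 := (cvg_ProbP _ _ FF).1 mm _ bf.
have h3 : Ex (k i) (fun p => f p.1) @[i --> F] --> Ex m0 f.
  apply: cvg_trans h2; apply: near_eq_cvg.
  by apply: filterS km => i /has_marg1P ->.
exact: (cvg_unique (@Rhausdorff R) h1 h3).
Qed.

Lemma cvg_full I (F : set_system I) X (m : I -> Prob R X) m0 (E : set X) :
  ProperFilter F -> cbase R X -> closed E -> m @ F --> m0 ->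
  (\forall i \near F, pm (m i) (E : set (borel X)) = 1%E) ->
  pm m0 (E : set (borel X)) = 1%E.
Proof.
move=> PF cX cE mm mE; have mE' := closed_borel cE.
rewrite prE//; congr EFin; apply/eqP; rewrite eq_le pr_le1//=.
apply: (@closed_cvg I (Prob R X) F PF m [set k : Prob R X | 1 <= pr k E]
  (@closed_pr_ge R X E 1 cX cE) _ m0 mm).
by apply: filterS mE => i iE /=; rewrite /pr iE.
Qed.

Lemma compact_Prob X : cbase R X -> compact [set: X] -> compact [set: Prob R X].
Proof.
move=> cX kX; rewrite compact_ultra => F UF _.
have tT : tau_smooth [set: Prob R X].
  have := tau_smooth_compact kX measurableT; apply: tau_smoothS => mu _ /=.
  by rewrite probability_setT.
have [mu Fmu] := @tau_smooth_ultra_cvg X setT (Prob R X) F id cX tT UF filterT.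
by exists mu.
Qed.

Lemma compact_marg X K (nu : Prob R X) : cbase R X -> cbase R K -> compact [set: K] ->
  compact [set k : Prob R (X * K)%type | has_marg1 k nu].
Proof.
move=> cX cK kK; rewrite compact_ultra => F UF Fnu.
have [|mu Fmu] := @tau_smooth_ultra_cvg _ _ (Prob R (X * K)%type) F id (cbase_prod cX cK)
    (tau_smooth_marg kK (@tau_smooth1 X nu)) UF.
  by apply: filterS Fnu => k kn /=; exists nu.
exists mu; split => //.
by apply: (@cvg_has_marg1 _ F _ _ id (fun=> nu) mu nu) => //; exact: cvg_cst.
Qed.

Lemma compact_full X (E : set X) : cbase R X -> compact E -> closed E ->
  compact [set mu : Prob R X | pm mu (E : set (borel X)) = 1%E].
Proof.
move=> cX kE cE; rewrite compact_ultra => F UF FE.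
have [|mu Fmu] := @tau_smooth_ultra_cvg _ _ (Prob R X) F id cX
    (tau_smooth_compact kE (closed_borel cE)) UF.
  exact: FE.
by exists mu; split => //; exact: (@cvg_full _ F _ id mu).
Qed.

End Compact.

(** * Borel maps into products and spaces of measures *)

Section BorelMaps.
Variable R : realType.
Implicit Types X Y Z : ptopologicalType.

Lemma open_countable_union (I : countType) X (f : I -> X -> R) (U : set X) :
  cbase_on f -> open U ->
  U = \bigcup_(i in [set i | [set x | 0 < f i x] `<=` U]) [set x | 0 < f i x].
Proof.
move=> [_ _ fU] oU; apply/seteqP; split => [x Ux|x [i /= iU] /iU//].
by have [i [fi fiU]] := fU U x oU Ux; exists i.
Qed.

Lemma bigcup_count_measurable d (T : measurableType d) (I : countType) (D : set I)
    (F : I -> set T) : (forall i, D i -> measurable (F i)) ->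
  measurable (\bigcup_(i in D) F i).
Proof.
move=> mF; rewrite bigcup_mkcond; apply: countable_bigcupT_measurable => // i.
by case: ifPn => // /set_mem; exact: mF.
Qed.

(** An open [W] is the countable union of rectangles [V i] times [H i], with [H i] basic and [V i]
    the largest open set for which the rectangle fits into [W]. *)
Lemma measurable_pair_borel d (T : measurableType d) Y Z (f : T -> Y) (g : T -> Z) :
  cbase R Z -> @measurable_fun _ _ T (borel Y) setT f ->
  @measurable_fun _ _ T (borel Z) setT g ->
  @measurable_fun _ _ T (borel (Y * Z)%type) setT (fun t => (f t, g t)).
Proof.
move=> [h hb] mf mg; apply: measurable_to_borel => W oW.
pose H i := [set z | 0 < h i z].
have oH i : open (H i).
  case: hb => ch _ _; rewrite -[H i]/(h i @^-1` [set r | 0 < r]).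
  by apply: open_comp; [move=> x _; exact: ch|exact: open_gt].
pose V i := interior [set y | forall z, H i z -> W (y, z)].
rewrite (_ : _ @^-1` W = \bigcup_i ((f @^-1` V i) `&` (g @^-1` H i))).
  apply: bigcup_measurable => i _; apply: measurableI; rewrite -[_ @^-1` _]setTI.
    by apply: mf => //; apply: open_borel; exact: open_interior.
  by apply: mg => //; exact: open_borel.
apply/seteqP; split => [t /= Wt|t [i _ [/interior_subset /= Vt Ht]]]; last exact: Vt.
have [[A B] /= [Af Bg] AB] : nbhs (f t, g t) W by exact: open_nbhs_nbhs.
move: Bg; rewrite nbhsE => -[B' [oB' B't] B'B].
case: hb => _ _ hU; have [i [hi hiU]] := hU _ _ oB' B't.
exists i => //; split => //=.
by apply: filterS Af => y Ay z Hz; apply: AB; split => //=; exact/B'B/hiU.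
Qed.

(** The cozero sets of [prob_bumps] form a countable base, and each such function depends on
    finitely many expectations only. *)
Lemma measurable_to_Prob d (T : measurableType d) X (h : T -> Prob R X) : cbase R X ->
  (forall f, bcont f -> measurable_fun setT (fun t => Ex (h t) f)) ->
  @measurable_fun _ _ T (borel (Prob R X)) setT h.
Proof.
move=> [f fb] mh; apply: measurable_to_borel => W oW.
rewrite (open_countable_union (prob_bumps_base fb) oW) preimage_bigcup.
apply: bigcup_count_measurable => l _.
have mp p : measurable_fun setT (fun t => prob_bump f p (h t)).
  rewrite /prob_bump; apply: measurable_minr; first exact: measurable_cst.
  apply: measurable_maxr; first exact: measurable_cst.
  by apply: measurable_funB; [apply: mh; exact: bump_bcont|exact: measurable_cst].
have ml : measurable_fun setT (fun t => prob_bumps f l (h t)).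
  elim: l => [|p l IH].
    by rewrite /prob_bumps; under eq_fun do rewrite big_nil; exact: measurable_cst.
  rewrite (_ : (fun t => _) = fun t => prob_bump f p (h t) * prob_bumps f l (h t)).
    exact: measurable_funM.
  by apply/funext => t; rewrite /prob_bumps big_cons.
rewrite (_ : _ @^-1` _ = setT `&` (fun t => prob_bumps f l (h t)) @^-1` `]0, +oo[%classic).
  by apply: ml => //; exact: measurable_itv.
by rewrite setTI; apply/seteqP; split => t /=; rewrite in_itv/= andbT.
Qed.

Lemma measurable_pm X (B : set X) : cbase R X -> measurable (B : set (borel X)) ->
  @measurable_fun _ _ (borel (Prob R X)) _ setT (fun k => pm k (B : set (borel X))).
Proof.
move=> cX mB.
pose P (B : set (borel X)) := @measurable_fun _ _ (borel (Prob R X)) _ setT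
  (fun k : Prob R X => pm k B).
apply: (@dynkin_induction _ (borel X) (@open X) P) mB => //.
- by move=> U V oU oV; exact: openI.
- rewrite /P (_ : (fun k => _) = cst 1%E); first exact: measurable_cst.
  by apply/funext => k; rewrite probability_setT.
- move=> U oU; rewrite /P (_ : (fun k => _) = EFin \o (fun k : Prob R X => pr k U)); last first.
    by apply/funext => k /=; rewrite prE//; exact: open_borel.
  apply/measurable_EFinP; apply: measurable_gtR => s.
  by apply: open_borel; exact: open_pr_gt.
- move=> A mA PA; rewrite /P (_ : (fun k => _) = (fun k : Prob R X => 1 - pm k A)%E).
    by apply: emeasurable_funB => //; exact: measurable_cst.
  by apply/funext => k; rewrite probability_setC.
- move=> F mF tF PF.
  rewrite /P (_ : (fun k => _) = (fun k : Prob R X => \sum_(0 <= i <oo) pm k (F i))%E).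
    by apply: (@ge0_emeasurable_sum _ (borel (Prob R X)) R setT (fun i k => pm k (F i)) xpredT) => // i _; exact: PF.
  apply/funext => k; rewrite measure_semi_bigcup//; exact: bigcup_measurable.
Qed.

Lemma measurable_Ex X (g : X -> R) : cbase R X -> bmeas g ->
  @measurable_fun _ _ (borel (Prob R X)) _ setT (fun k => Ex k g).
Proof.
move=> cX bg; have [mg [M gM]] := bg.
pose gy (k : borel (Prob R X)) : giry (borel X) R := pm k.
have mgy : measurable_fun setT gy.
  by apply: measurable_giry_codensity => // B mB; exact: measurable_pm.
(* Measurability of integration over the space of measures is available for nonnegative integrands;
   the shift is subtracted at the end. *)
pose g' x := g x + M.
have bg' : bmeas g' by apply: bmeasD => //; exact: bmeas_cst.
have g'0 x : 0 <= g' x by have := gM x; rewrite ler_norml /g' => /andP[]; lra.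
have h : @measurable_fun _ _ (borel (Prob R X)) _ setT (fun k => Ex k g').
  apply/measurable_EFinP.
  rewrite (_ : _ \o _ = (fun k => giry_int (gy k) (EFin \o g'))); last first.
    by apply/funext => k /=; rewrite -ExE.
  have mi : measurable_fun setT (fun mu : giry (borel X) R => giry_int mu (EFin \o g')).
    by apply: measurable_giry_int => //; apply/measurable_EFinP; case: bg'.
  exact: (measurableT_comp mi mgy).
rewrite (_ : (fun k => _) = (fun k => Ex k g' - M)).
  by apply: measurable_funB => //; exact: measurable_cst.
by apply/funext => k; rewrite ExD//; [rewrite Ex_cst addrK|exact: bmeas_cst].
Qed.

Lemma measurable_pf X Y (z : X -> Y) : cbase R X -> cbase R Y ->
  @measurable_fun _ _ (borel X) (borel Y) setT z ->
  @measurable_fun _ _ (borel (Prob R X)) (borel (Prob R Y)) setT (fun k => pf k z).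
Proof.
move=> cX cY mz; apply: measurable_to_Prob => // f bf.
rewrite (_ : (fun k => _) = (fun k : Prob R X => Ex k (fun x => f (z x)))).
  by apply: measurable_Ex => //; apply: bmeas_comp => //; exact: bcontb.
by apply/funext => k; rewrite Ex_pf//; exact: bcontb.
Qed.

End BorelMaps.

(** * Compact ordered lattices and greatest elements *)

Lemma continuous_fst (X Y : topologicalType) : continuous (@fst X Y).
Proof. by move=> [x y]; exact: cvg_fst. Qed.

Lemma continuous_snd (X Y : topologicalType) : continuous (@snd X Y).
Proof. by move=> [x y]; exact: cvg_snd. Qed.

Lemma closed_proj (X Y : topologicalType) (K : set Y) (W : set (X * Y)) :
  compact K -> closed W -> closed [set x | exists2 y, K y & W (x, y)].
Proof.
move=> /compact_near_coveringP cK cW; rewrite -openC openE => x /= nW.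
have : \forall x' \near x, K `<=` (fun y => ~ W (x', y)).
  apply: (cK X (nbhs x) (fun x' y => ~ W (x', y))) => y Ky.
  have oW : open (~` W) by rewrite openC.
  have [[A B] /= [Ax By] AB] : nbhs (x, y) (~` W).
    by apply: open_nbhs_nbhs; split => // Wxy; apply: nW; exists y.
  by exists (B, A) => // -[y' x'] /= [By' Ax']; exact: (AB (x', y')).
by apply: filterS => x' h [y Ky Wy]; exact: (h y Ky).
Qed.

Section Lattice.
Variables (R : realType) (A : ptopologicalType).
Variables (le : A -> A -> Prop) (jn : A -> A -> A).
Hypothesis le_refl : forall a, le a a.
Hypothesis le_anti : forall a b, le a b -> le b a -> a = b.
Hypothesis le_trans : forall a b c, le a b -> le b c -> le a c.
Hypothesis hjn : forall a b, is_lub le [set x | x = a \/ x = b] (jn a b).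
Hypothesis hjn_cont : continuous (fun p : A * A => jn p.1 p.2).
Hypothesis hA : compact_metrizable R A.

Let cbA : cbase R A := compact_metrizable_cbase hA.
Let kA : compact [set: A] := hA.1.

Lemma jn_l a b : le a (jn a b).
Proof. by have [+ _] := hjn a b; apply; left. Qed.

Lemma jn_r a b : le b (jn a b).
Proof. by have [+ _] := hjn a b; apply; right. Qed.

Lemma jn_lub a b c : le a c -> le b c -> le (jn a b) c.
Proof. by move=> ac bc; have [_ +] := hjn a b; apply => x [->|->]. Qed.

Lemma metrizable_hausdorff : hausdorff_space A.
Proof.
have [_ [d dA]] := hA; rewrite open_hausdorff => x y /eqP xy.
have dxy : 0 < d x y.
  rewrite lt_neqAle (metric_ge0 dA) andbT eq_sym; apply/eqP => h; apply: xy.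
  by case: dA => d0 _; apply/d0.
exists ([set z | d x z < d x y / 2], [set z | d y z < d x y / 2]) => /=.
  by split; apply/mem_set; rewrite /= (metric_refl dA) divr_gt0.
split; [exact: (open_metric_ball dA)|exact: (open_metric_ball dA)|].
apply/eqP/seteqP; split => // z /= [h1 h2].
have := metric_triangle dA x z y; rewrite (metric_sym dA z y).
by move: h1 h2; lra.
Qed.

(** The order is the set where two continuous maps into a Hausdorff space coincide, the join and the
    second projection. *)
Lemma closed_le_graph : closed [set p : A * A | le p.1 p.2].
Proof.
have -> : [set p : A * A | le p.1 p.2] = [set p : A * A | jn p.1 p.2 = p.2].
  apply/seteqP; split => -[a b] /=.
    by move=> ab; apply: le_anti; [exact: jn_lub|exact: jn_r].
  by move=> <-; exact: jn_l.
move=> p cp; apply: metrizable_hausdorff => U V Up Vp.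
have U' : nbhs p ((fun p => jn p.1 p.2) @^-1` U) by exact: hjn_cont.
have V' : nbhs p (snd @^-1` V) by exact: continuous_snd.
have [q [/= qe [Uq Vq]]] := cp _ (filterI U' V').
by exists q.2; split => //; rewrite -qe.
Qed.

Lemma closed_fibre_r (X Y : topologicalType) (W : set (X * Y)) x : closed W ->
  closed [set y | W (x, y)].
Proof.
move=> cW; have : closed ((fun y => (x, y)) @^-1` W); last by [].
by apply: preimage_closed => // y _; apply: cvg_pair; [exact: cvg_cst|exact: cvg_id].
Qed.

(** Joins make the sets of elements of [B] above a given one into a filter base; a cluster point in
    the compact [B] is above every element because the order is closed. *)
Lemma exists_greatest (B : set A) : closed B -> B !=set0 ->
  (forall a b, B a -> B b -> B (jn a b)) -> exists2 g, B g & forall b, B b -> le b g.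
Proof.
move=> cB [b0 Bb0] Bjn.
have cBk : compact B by apply: (subclosed_compact cB kA).
pose F := filter_from B (fun b => B `&` [set x | le b x]).
have FF : ProperFilter F.
  apply: filter_from_proper; last by move=> b Bb; exists b; split => //=.
  apply: filter_from_filter; first by exists b0.
  move=> a b Ba Bb; exists (jn a b); first exact: Bjn.
  move=> x /= [Bx abx]; split; split => //=.
    exact: le_trans (jn_l a b) abx.
  exact: le_trans (jn_r a b) abx.
have [g [Bg gF]] := cBk F FF (ex_intro2 _ _ b0 Bb0 (@subIsetl _ _ _)).
exists g => // b Bb.
have cb : closed [set x | le b x] by have := @closed_fibre_r A A [set p | le p.1 p.2] b closed_le_graph.
apply: cb => V Vg.
have FB : F (B `&` [set x | le b x]) by exists b.
by have [x [[_ bx] Vx]] := gF _ _ FB Vg; exists x.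
Qed.

Definition up_closed (G : set A) := forall a b, G a -> le a b -> G b.

Definition up (G : set A) : set A := [set b | exists2 a, G a & le a b].
Definition down (G : set A) : set A := [set b | exists2 a, G a & le b a].

Lemma closed_up G : closed G -> closed (up G).
Proof.
move=> cG; have := closed_proj (subclosed_compact cG kA (@subsetT _ _))
  (W := [set p : A * A | le p.2 p.1]).
apply; have : closed ((fun p : A * A => (p.2, p.1)) @^-1` [set p : A * A | le p.1 p.2]); last by [].
apply: preimage_closed; last exact: closed_le_graph.
by move=> p _; apply: cvg_pair; [exact: cvg_snd|exact: cvg_fst].
Qed.

Lemma closed_down G : closed G -> closed (down G).
Proof.
move=> cG; exact: (closed_proj (subclosed_compact cG kA (@subsetT _ _)) closed_le_graph).
Qed.

Lemma up_up_closed G : up_closed (up G).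
Proof. by move=> a b [c Gc ca] ab; exists c => //; exact: le_trans ca ab. Qed.

Section Base.
Variable f : nat -> A -> R.
Hypothesis fb : cbase_on f.

(** Countably many closed sets; by [base_closed] every open set is a union of some of them. *)
Let B (ij : nat * nat) := [set a | ij.2.+1%:R^-1 <= f ij.1 a].

Let closed_B ij : closed (B ij).
Proof.
rewrite -[B ij]/(f ij.1 @^-1` [set r | ij.2.+1%:R^-1 <= r]).
by apply: preimage_closed; [case: fb => + _ _ x _; exact|exact: closed_ge].
Qed.

Lemma base_closed (U : set A) a : open U -> U a -> exists2 ij, B ij a & B ij `<=` U.
Proof.
case: fb => _ _ fU oU Ua; have [i [fi fiU]] := fU U a oU Ua.
have [j _ /(_ j (leqnn _)) /= ji] := near_infty_natSinv_lt (PosNum fi).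
exists (i, j); first exact: ltW.
by move=> x; rewrite /B /= => h; apply: fiU => /=; rewrite (lt_le_trans _ h)// invr_gt0.
Qed.

(* Compact ordered spaces are locally convex (Nachbin). *)
Lemma convex_nbhs (U : set A) a : open U -> U a ->
  exists2 ij, B ij a & up (B ij) `&` down (B ij) `<=` U.
Proof.
move=> oU Ua.
(* Pairs enclosing a point outside [U]. Their set [V] is a projection along a compact space, hence
   closed, and antisymmetry excludes (a, a); so a whole square around (a, a) avoids it. *)
pose W := [set p : (A * A) * A | [/\ le p.1.1 p.2, le p.2 p.1.2 & ~ U p.2]].
have cle (g h : (A * A) * A -> A) : continuous g -> continuous h ->
    closed [set p | le (g p) (h p)].
  move=> cg ch; have : closed ((fun p => (g p, h p)) @^-1` [set p : A * A | le p.1 p.2]); last by [].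
  apply: preimage_closed; last exact: closed_le_graph.
  by move=> p _; apply: cvg_pair; [exact: cg|exact: ch].
have c2 : continuous (fun p : (A * A) * A => p.2) by move=> -[p q]; exact: cvg_snd.
have c1 : continuous (fun p : (A * A) * A => p.1) by move=> -[p q]; exact: cvg_fst.
have c11 : continuous (fun p : (A * A) * A => p.1.1).
  by move=> p; apply: continuous_comp; [exact: c1|exact: cvg_fst].
have c12 : continuous (fun p : (A * A) * A => p.1.2).
  by move=> p; apply: continuous_comp; [exact: c1|exact: cvg_snd].
have cW : closed W.
  rewrite (_ : W = [set p | le p.1.1 p.2] `&` [set p | le p.2 p.1.2] `&` (snd @^-1` (~` U))).
    apply: closedI; first by apply: closedI; exact: cle.
    by apply: preimage_closed; [move=> p _; exact: c2|exact: open_closedC].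
  by apply/seteqP; split => p /= => [[]|[[]]].
have := closed_proj kA cW; set V := (X in closed X) => cV.
have nVa : nbhs (a, a) (~` V).
  apply: open_nbhs_nbhs; split; first by rewrite openC.
  by move=> [y _ [/= ay ya]]; apply; rewrite (le_anti ya ay).
have [[N1 N2] /= [N1a N2a] NV] := nVa.
have [N' [oN' N'a] N'N] : exists2 N', open N' /\ N' a & N' `<=` N1 `&` N2.
  by have : nbhs a (N1 `&` N2) by [apply: filterI]; rewrite nbhsE => -[N' h ?]; exists N'.
have [ij Ba BN] := base_closed oN' N'a.
exists ij => // y [[b1 Bb1 b1y] [b2 Bb2 yb2]]; apply: contrapT => nUy.
have := NV (b1, b2); apply => /=.
  by split; [have [] := N'N _ (BN _ Bb1)|have [] := N'N _ (BN _ Bb2)].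
by exists y.
Qed.

(** By [convex_nbhs] an open set is a countable union of sets up(B) meet down(B). The first kind is
    covered by the hypothesis; the complement of down(B) is open and up-closed, hence a countable
    union of sets up(B'). *)
Lemma measurable_up_closed d (T : measurableType d) (z : T -> A) :
  (forall G, closed G -> up_closed G -> measurable (z @^-1` G)) ->
  @measurable_fun _ _ T (borel A) setT z.
Proof.
move=> mz; apply: measurable_to_borel => U oU.
have mup ij : measurable (z @^-1` (up (B ij))).
  by apply: mz; [exact/closed_up/closed_B|exact: up_up_closed].
have mdown ij : measurable (z @^-1` (down (B ij))).
  have oD : open (~` (down (B ij))) by rewrite openC; exact/closed_down/closed_B.
  have DE : ~` down (B ij) = \bigcup_(ij' in [set ij' | B ij' `<=` ~` down (B ij)]) up (B ij').
    apply/seteqP; split => [a Da|a [ij' h [b Bb ba]]].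
      by have [ij' Ba h] := base_closed oD Da; exists ij' => //; exists a.
    move=> [c Bc ac]; apply: (h b Bb); exists c => //; exact: le_trans ba ac.
  have mC : measurable (z @^-1` (~` down (B ij))).
    by rewrite DE preimage_bigcup; exact: bigcup_count_measurable.
  by rewrite -[_ @^-1` _]setCK; apply: measurableC.
rewrite (_ : U = \bigcup_(ij in [set ij | up (B ij) `&` down (B ij) `<=` U])
    (up (B ij) `&` down (B ij))).
  rewrite preimage_bigcup; apply: bigcup_count_measurable => ij _.
  by rewrite preimage_setI; apply: measurableI.
apply/seteqP; split => [a Ua|a [ij /= h] /h//].
by have [ij Ba h] := convex_nbhs oU Ua; exists ij => //; split; exists a.
Qed.

End Base.

End Lattice.

(** * Integration of functions continuous on a closed set *)

Lemma closed_filter (X : topologicalType) (W : set X) :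
  (forall (F : set_system X) p, ProperFilter F -> F W -> F --> p -> W p) -> closed W.
Proof.
move=> h p clp; apply: (h (within W (nbhs p)) p).
- exact: withinT.
- by apply: cvg_within_filter; exact: cvg_id.
Qed.

Lemma nested_compact (X : topologicalType) (K : set X) (B : nat -> set X) :
  compact K -> (forall n, closed (B n)) -> (forall n, B n `<=` K) ->
  (forall n, B n.+1 `<=` B n) -> (forall n, B n !=set0) -> exists x, forall n, B n x.
Proof.
move=> cK cB BK BS B0.
have Ble n k : (n <= k)%N -> B k `<=` B n.
  by move=> /subnK <-; elim: (k - n)%N => // j IH; rewrite addSn; exact: subset_trans (BS _) IH.
have PF : ProperFilter (filter_from setT B).
  apply: filter_from_proper; last by move=> n _; exact: B0.
  apply: filter_from_filter; first by exists 0%N.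
  move=> i j _ _; exists (maxn i j) => // x Bx.
  by split; [exact: (Ble _ _ (leq_maxl i j))|exact: (Ble _ _ (leq_maxr i j))].
have [x [_ clx]] := cK _ PF (ex_intro2 _ _ 0%N I (BK 0%N)).
exists x => n; apply: cB => V Vx.
by apply: clx => //; exists n.
Qed.

Lemma cvg_cont (X Z : topologicalType) (h : X -> Z) (F : set_system X) p :
  Filter F -> continuous h -> F --> p -> h @ F --> h p.
Proof. by move=> FF ch Fp W Wp; exact: (Fp _ (ch p W Wp)). Qed.

Lemma cvg_closed (X Z : topologicalType) (h : X -> Z) (F : set_system X) p (D : set Z) :
  ProperFilter F -> continuous h -> closed D -> F --> p -> (\forall x \near F, D (h x)) ->
  D (h p).
Proof.
move=> PF ch cD Fp FD; exact: (@closed_cvg X Z F PF h D cD FD (h p) (cvg_cont PF ch Fp)).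
Qed.

Section ContOn.
Variable R : realType.
Implicit Types X Y Z : ptopologicalType.

Definition cont_on X (E : set X) (f : X -> R) := forall x, E x -> forall e : R, 0 < e ->
  \forall y \near x, E y -> `|f x - f y| < e.

Lemma cont_onN X (E : set X) f : cont_on E f -> cont_on E (fun x => - f x).
Proof.
move=> cf x Ex e e0; have := cf x Ex e e0; apply: filterS => y h /h.
by rewrite -opprD normrN.
Qed.

Section OnClosed.
Variables (X : ptopologicalType) (E : set X) (f : X -> R) (M : R).
Hypotheses (cE : closed E) (cf : cont_on E f).
Hypothesis fM : forall x, E x -> `|f x| <= M.

(** Off the closed set [E] the value is a lower bound for [f] on [E], which makes the extension
    upper semicontinuous on all of X. Extension by 0 would not be. *)
Let fE x := if x \in E then f x else - `|M|.

Let fE_usc s : open [set x | fE x < s].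
Proof.
rewrite openE => x /=; rewrite /fE; case: ifPn => [/set_mem Ex fs|].
  have := cf Ex; rewrite -subr_gt0 in fs => /(_ _ fs).
  apply: filterS => y h; rewrite /=; case: ifPn => [/set_mem/h|_].
    by rewrite ltr_norml => /andP[]; lra.
  have := fM Ex; rewrite ler_norml => /andP[h1 h2].
  by move: (ler_norm M) fs h1; lra.
rewrite notin_setE => nEx ms; have : nbhs x (~` E).
  by apply: open_nbhs_nbhs; split => //; rewrite openC.
by apply: filterS => y nEy; rewrite /= memNset.
Qed.

Let fE_bounded : exists N, forall x, `|fE x| <= N.
Proof.
exists `|M| => x; rewrite /fE; case: ifPn => [/set_mem/fM h|_].
  by rewrite (le_trans h)// ler_norm.
by rewrite normrN normr_id.
Qed.

Let bfE : bmeas fE.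
Proof.
rewrite (_ : fE = fun x => - - fE x); last by apply/funext => x; rewrite opprK.
apply: bmeasN; apply: lsc_bmeas.
  move=> s; rewrite (_ : [set x | _] = [set x | fE x < - s]); first exact: fE_usc.
  by apply/seteqP; split => x /=; rewrite ltrNr.
by case: fE_bounded => N hN; exists N => x; rewrite normrN.
Qed.

Lemma bmeas_patch : bmeas (f \_ E).
Proof.
rewrite (_ : f \_ E = fun x => fE x + `|M| * \1_(~` E) x).
  apply: bmeasD => //; apply: bmeasZ; apply: bmeas_indic.
  by apply: measurableC; exact: closed_borel.
apply/funext => x; rewrite /patch /fE indicE in_setC.
by case: (x \in E) => /=; rewrite ?mulr0 ?addr0// mulr1 addNr.
Qed.

Lemma Ex_patch_usc I (F : set_system I) (m : I -> Prob R X) mu (e : R) : Filter F ->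
  cbase R X -> m @ F --> mu -> (\forall i \near F, pm (m i) (E : set (borel X)) = 1%E) ->
  pm mu (E : set (borel X)) = 1%E -> 0 < e ->
  \forall i \near F, Ex (m i) (f \_ E) < Ex mu (f \_ E) + e.
Proof.
move=> FF cX mmu mE muE e0.
have eqE (k : Prob R X) : pm k (E : set (borel X)) = 1%E -> Ex k (f \_ E) = Ex k fE.
  move=> kE; congr fine; apply: (eq_integral_full (closed_borel cE)).
    exact: (pr_full (closed_borel cE) kE).
  by move=> x Ex; rewrite /patch /fE mem_set.
have := Ex_usc FF (cvg_pr_open FF cX mmu) fE_usc fE_bounded e0.
by apply: filterS2 mE => i iE; rewrite !eqE.
Qed.

End OnClosed.

(** Measures carried by [E] do not distinguish [f \_ E] from the semicontinuous extension; apply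
    [Ex_patch_usc] to f and to -f. *)
Lemma cvg_Ex_patch X (E : set X) f M I (F : set_system I) (m : I -> Prob R X) mu :
  Filter F -> cbase R X -> closed E -> cont_on E f -> (forall x, E x -> `|f x| <= M) ->
  m @ F --> mu -> (\forall i \near F, pm (m i) (E : set (borel X)) = 1%E) ->
  pm mu (E : set (borel X)) = 1%E ->
  Ex (m i) (f \_ E) @[i --> F] --> Ex mu (f \_ E).
Proof.
move=> FF cX cE cf fM mmu mE muE; apply/cvgrPdist_lt => e e0.
have h1 := Ex_patch_usc cE cf fM FF cX mmu mE muE e0.
have fM' x : E x -> `|- f x| <= M by rewrite normrN; exact: fM.
have h2 := Ex_patch_usc cE (cont_onN cf) fM' FF cX mmu mE muE e0.
have bf := bmeas_patch cE cf fM.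
have eN : (fun x => - f x) \_ E = fun x => - (f \_ E) x.
  by apply/funext => x; rewrite /patch; case: ifP; rewrite ?oppr0.
apply: filterS2 h1 h2 => i h1 h2; move: h2; rewrite eN !ExN// => h2.
by rewrite ltr_distl; apply/andP; split; move: h1 h2; lra.
Qed.

Lemma closed_Ex_eq X Y Z (f : Y -> R) (g : Z -> R) (h : X -> Prob R Y) (k : X -> Prob R Z) :
  bcont f -> bcont g -> continuous h -> continuous k ->
  closed [set x | Ex (h x) f = Ex (k x) g].
Proof.
move=> bf bg ch ck.
rewrite (_ : [set x | _] = (fun x => Ex (h x) f - Ex (k x) g) @^-1` [set r | r = 0]).
  apply: preimage_closed; last exact: closed_eq.
  move=> x _; apply: (@continuousB R R X (fun x => Ex (h x) f) (fun x => Ex (k x) g)).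
    by apply: (@continuous_comp X (Prob R Y) R h (fun m => Ex m f)); [exact: ch|exact: Ex_continuous].
  by apply: (@continuous_comp X (Prob R Z) R k (fun m => Ex m g)); [exact: ck|exact: Ex_continuous].
by apply/seteqP; split => x /= => [->|/eqP]; rewrite ?subrr// subr_eq0 => /eqP.
Qed.

Lemma closed_has_marg1 X Y Z (h : Z -> Prob R (X * Y)%type) (k : Z -> Prob R X) :
  cbase R X -> continuous h -> continuous k -> closed [set z | has_marg1 (h z) (k z)].
Proof.
move=> cX ch ck.
rewrite (_ : [set z | _] = \bigcap_(f in [set f | bcont f])
    [set z | Ex (h z) (fun p => f p.1) = Ex (k z) f]).
  apply: closed_bigI => f bf; apply: closed_Ex_eq => //.
  by apply: bcont_comp => //; exact: continuous_fst.
apply/seteqP; split => z /=.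
  by move=> /has_marg1P h1 f bf; exact: h1.
by move=> h1; apply/has_marg1P.
Qed.

Lemma full_bigcap d (T : measurableType d) (mu : probability T R) (B : nat -> set T) :
  (forall n, measurable (B n)) -> (forall n, mu (B n) = 1%E) -> mu (\bigcap_n B n) = 1%E.
Proof.
move=> mB B1; have mI : measurable (\bigcap_n B n) by exact: bigcap_measurable.
have : mu (~` \bigcap_n B n) = 0%E.
  apply/eqP; rewrite setC_bigcap eq_le measure_ge0 andbT.
  have mC n : measurable (~` B n) by exact: measurableC.
  have mU : measurable (\bigcup_n ~` B n) by exact: bigcup_measurable.
  apply: (le_trans (measure_sigma_subadditive mu mC mU (@subset_refl _ _))).
  have mu0 n : mu (~` B n) = 0%E by rewrite probability_setC// B1 subee.
  by rewrite eseries0// => n _ _; exact: mu0.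
rewrite probability_setC// => /eqP; rewrite sube_eq ?fin_num_measure//.
  by rewrite add0e => /eqP.
Qed.

Lemma pr_setD X (mu : Prob R X) (U M : set X) : measurable (U : set (borel X)) ->
  measurable (M : set (borel X)) -> M `<=` U -> pr mu (U `\` M) = pr mu U - pr mu M.
Proof.
move=> mU mM MU; apply: EFin_inj; rewrite EFinB -!prE//; last exact: measurableD.
rewrite measureD//; first by rewrite (setIidr MU).
by rewrite (le_lt_trans (probability_le1 _ _))// ltry.
Qed.

(** Take a bump below the indicator of [U] with expectation above the mass of [U] minus e/2, and let
    [M] be the set where it is at least e/2. Its expectation is at most e/2 plus the mass of [M]. *)
Lemma closed_inner_approx X (mu : Prob R X) (U : set X) (e : R) : cbase R X ->
  open U -> 0 < e -> exists M, [/\ closed M, M `<=` U & pr mu (U `\` M) <= e].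
Proof.
move=> [f fb] oU e0; have e20 : 0 < e / 2 by rewrite divr_gt0.
have [|s [k [sk hU]]] := inner_bump (mu := mu) (q := pr mu U - e / 2) fb oU.
  by rewrite ltrBlDr ltrDl.
have bb := bump_bcont fb s k.
pose M := [set x | e / 2 <= bump f s k x].
have cM : closed M.
  rewrite -[M]/(bump f s k @^-1` [set r | e / 2 <= r]).
  by apply: preimage_closed; [case: bb => + _ x _; exact|exact: closed_ge].
have MU : M `<=` U.
  move=> x; rewrite /M /= => h; apply: contrapT => nU.
  by have := le_trans h (hU x); rewrite indicE memNset//= leNgt e20.
have mM : measurable (M : set (borel X)) by exact: closed_borel.
exists M; split => //; rewrite pr_setD//; last exact: open_borel.
have bI := bmeas_indic R mM; have bc := @bmeas_cst R X (e / 2).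
have : Ex mu (bump f s k) <= e / 2 + pr mu M.
  rewrite -(Ex_indic mu mM) -[X in X + _](Ex_cst mu) -ExD//.
  apply: le_Ex; [exact: bcontb|exact: bmeasD|].
  move=> x; rewrite indicE; have [xM|] := boolP (x \in M).
    by rewrite (le_trans (bump_le1 _ _ _ _))// lerDr ltW.
  by rewrite notin_setE addr0 /M /= => /negP; rewrite -ltNge => /ltW.
by move: sk; lra.
Qed.

Lemma Ex_marg1 (X Z : ptopologicalType) (mu : Prob R (X * Z)%type) (b : Prob R X) (h : X -> R) :
  has_marg1 mu b -> bmeas h -> Ex mu (fun p => h p.1) = Ex b h.
Proof.
move=> mb bh; have mf : @measurable_fun _ _ (borel (X * Z)%type) (borel X) setT fst.
  by apply: continuous_borel; exact: continuous_fst.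
rewrite -(Ex_pf mf mu bh); apply: eq_pr_Ex => B mB.
by rewrite (pfE mf); exact: mb.
Qed.

End ContOn.

(** * Payoffs *)

Lemma cvg_pairI I (F : set_system I) (X Z : topologicalType) (f : I -> X) (g : I -> Z) (x : X) (z : Z) :
  Filter F -> f @ F --> x -> g @ F --> z -> (fun i => (f i, g i)) @ F --> (x, z).
Proof.
move=> FF fx gz W [[P Q] /= [Px Qz] PQ].
have Fx : F (f @^-1` P) by exact: fx.
have Fz : F (g @^-1` Q) by exact: gz.
suff : F [set i | W (f i, g i)] by [].
by apply: filterS (filterI Fx Fz) => i [Pi Qi]; exact: (PQ (f i, g i) (conj Pi Qi)).
Qed.

Lemma continuous_pair (W X Z : topologicalType) (f : W -> X) (g : W -> Z) :
  continuous f -> continuous g -> continuous (fun w => (f w, g w)).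
Proof. by move=> cf cg w; apply: cvg_pairI; [exact: cf|exact: cg]. Qed.

Lemma continuous_compT (W X Z : topologicalType) (f : W -> X) (g : X -> Z) :
  continuous f -> continuous g -> continuous (fun w => g (f w)).
Proof. by move=> cf cg w; apply: continuous_comp; [exact: cf|exact: cg]. Qed.

Lemma continuous_idT (W : topologicalType) : continuous (fun w : W => w).
Proof. by move=> w; exact: cvg_id. Qed.

Lemma dist_lt_quarters (R : realFieldType) (x y z e : R) :
  `|x - y| < e / 4 -> `|x - z| < e / 4 -> `|y - z| < e / 2.
Proof. by rewrite !ltr_norml => /andP[? ?] /andP[? ?]; apply/andP; split; lra. Qed.

Lemma dist_lt_halves (R : realFieldType) (x y z e : R) :
  `|x - y| < e / 2 -> `|y - z| <= e / 2 -> `|x - z| < e.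
Proof.
by rewrite !ltr_norml ler_norml => /andP[? ?] /andP[? ?]; apply/andP; split; lra.
Qed.

Section Payoff.
Variables (R : realType) (C A S T : ptopologicalType) (nu : Prob R C).
Variable v : C -> A -> S -> Prob R (C * A)%type -> R.
Variables (sigma : T -> S) (tau : T -> Prob R (C * Prob R T)%type).
Hypotheses (hC : polish R C) (hA : compact_metrizable R A).
Hypotheses (hS : compact_metrizable R S) (hT : compact_metrizable R T).
Hypothesis hv : {within [set x : C * A * S * Prob R (C * A)%type | has_marg1 x.2 nu],
  continuous (fun x : C * A * S * Prob R (C * A)%type => v x.1.1.1 x.1.1.2 x.1.2 x.2)}.
Hypothesis hsigma : continuous sigma.
Hypothesis htau : continuous tau.
Hypothesis htaum : forall t, has_marg1 (tau t) nu.

Local Notation PT := (Prob R T).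
Local Notation CB := (C * PT)%type.
Local Notation Y := (CB * A)%type.
Local Notation PY := (Prob R Y).
Local Notation P2 := (T * PY)%type.
Local Notation CA := (C * A)%type.
Local Notation PCA := (Prob R CA).
Local Notation L := (S * PCA)%type.

(** The pairs (s, mu) at which [v] is assumed continuous. *)
Definition consistent_outcomes : set L := [set x | has_marg1 x.2 nu].
Definition consistent_conjectures : set P2 := [set x | has_marg1 x.2 (tau x.1)].
Local Notation EL := consistent_outcomes.
Local Notation E2 := consistent_conjectures.

Lemma cbC : cbase R C. Proof. exact: polish_cbase. Qed.
Lemma cbA : cbase R A. Proof. exact: compact_metrizable_cbase. Qed.
Lemma cbS : cbase R S. Proof. exact: compact_metrizable_cbase. Qed.
Lemma cbT : cbase R T. Proof. exact: compact_metrizable_cbase. Qed.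
Lemma cbPT : cbase R PT. Proof. by apply: cbase_Prob; exact: cbT. Qed.
Lemma cbCB : cbase R CB. Proof. by apply: cbase_prod; [exact: cbC|exact: cbPT]. Qed.
Lemma cbY : cbase R Y. Proof. by apply: cbase_prod; [exact: cbCB|exact: cbA]. Qed.
Lemma cbPY : cbase R PY. Proof. by apply: cbase_Prob; exact: cbY. Qed.
Lemma cbP2 : cbase R P2. Proof. by apply: cbase_prod; [exact: cbT|exact: cbPY]. Qed.
Lemma cbCA : cbase R CA. Proof. by apply: cbase_prod; [exact: cbC|exact: cbA]. Qed.
Lemma cbPCA : cbase R PCA. Proof. by apply: cbase_Prob; exact: cbCA. Qed.
Lemma cbL : cbase R L. Proof. by apply: cbase_prod; [exact: cbS|exact: cbPCA]. Qed.

Lemma kPT : compact [set: PT].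
Proof. by apply: compact_Prob; [exact: cbT|exact: hT.1]. Qed.

Lemma closed_EL : closed EL.
Proof.
apply: closed_has_marg1; [exact: cbC|exact: continuous_snd|].
exact: (@cst_continuous L (Prob R C)).
Qed.

Lemma compact_EL : compact EL.
Proof.
rewrite (_ : EL = [set: S] `*` [set k : PCA | has_marg1 k nu]).
  apply: compact_setX; first exact: hS.1.
  by apply: compact_marg; [exact: cbC|exact: cbA|exact: hA.1].
by apply/seteqP; split => [[s m] /=|[s m] [_ /=]].
Qed.

Lemma closed_E2 : closed E2.
Proof.
apply: closed_has_marg1; [exact: cbCB|exact: continuous_snd|].
move=> x; apply: (@continuous_comp P2 T (Prob R CB) fst tau); last exact: htau.
exact: continuous_fst.
Qed.

(** The second components have C-marginal [nu], and the factors added to C, the beliefs and the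
    actions, are compact; [tau_smooth_marg] is used once for each. *)
Lemma compact_E2 : compact E2.
Proof.
rewrite compact_ultra => F UF FE.
have [t _ Ft] := @ultra_cvg P2 T setT F fst UF hT.1 filterT.
have tsM := tau_smooth_marg hA.1 (tau_smooth_marg kPT (@tau_smooth1 R C nu)).
have [|k Fk] := @tau_smooth_ultra_cvg R Y _ P2 F snd cbY tsM UF.
  apply: filterS FE => -[t' k'] /= tk; exists (tau t') => //.
  by exists nu => //; exact: htaum.
exists (t, k); have Fp : F --> (t, k).
  have : (fun p : P2 => (p.1, p.2)) @ F --> (t, k) by exact: cvg_pairI.
  by rewrite (_ : (fun p : P2 => (p.1, p.2)) = id)//; apply/funext => -[].
split => //=.
exact: (@closed_cvg P2 P2 F _ id E2 closed_E2 FE (t, k) Fp).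
Qed.

Lemma mEL : measurable (EL : set (borel L)). Proof. by apply: closed_borel; exact: closed_EL. Qed.
Lemma mE2 : measurable (E2 : set (borel P2)). Proof. by apply: closed_borel; exact: closed_E2. Qed.

Lemma phi_fun_continuous : continuous (fun x : Y => (x.1.1, x.2)).
Proof.
apply: continuous_pair; last exact: continuous_snd.
by apply: (@continuous_compT Y CB C fst fst); exact: continuous_fst.
Qed.

Lemma phi_continuous : continuous (@phi R C A T).
Proof. by apply: pf_continuous; exact: phi_fun_continuous. Qed.

Definition outcome (x : P2) : L := (sigma x.1, phi x.2).

Lemma outcome_continuous : continuous outcome.
Proof.
apply: continuous_pair.
  by apply: (@continuous_compT P2 T S fst sigma); [exact: continuous_fst|exact: hsigma].
by apply: (@continuous_compT P2 PY PCA snd (@phi R C A T)); [exact: continuous_snd|exact: phi_continuous].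
Qed.

Lemma measurable_phi_fun :
  @measurable_fun _ _ (borel Y) (borel CA) setT (fun x : Y => (x.1.1, x.2)).
Proof.
by apply: continuous_borel; exact: phi_fun_continuous.
Qed.

Lemma phi_marg (k : PY) (m : Prob R CB) : has_marg1 k m -> has_marg1 m nu ->
  has_marg1 (phi k) nu.
Proof.
move=> km mn B mB; rewrite /phi (pfE measurable_phi_fun) -mn//.
rewrite -km//; have : @measurable_fun _ _ (borel CB) (borel C) setT fst.
  by apply: continuous_borel; exact: continuous_fst.
by move=> /(_ measurableT _ mB); rewrite setTI.
Qed.

Lemma outcome_E2 x : E2 x -> EL (outcome x).
Proof. by move=> /phi_marg; apply; exact: htaum. Qed.

Lemma measurable_outcome : @measurable_fun _ _ (borel P2) (borel L) setT outcome.
Proof. by apply: continuous_borel; exact: outcome_continuous. Qed.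

Lemma v_joint c a (x : L) (e : R) : EL x -> 0 < e ->
  \forall q \near ((c, a), x), EL q.2 ->
    `|v c a x.1 x.2 - v q.1.1 q.1.2 q.2.1 q.2.2| < e.
Proof.
case: x => s m Ex e0.
have := (subspace_continuousP _ _).1 hv (((c, a), s), m) Ex.
move=> /cvgrPdist_lt/(_ e e0) /= h.
pose r (q : (C * A) * L) : C * A * S * PCA := ((q.1, q.2.1), q.2.2).
have cr : continuous r.
  apply: continuous_pair.
    apply: continuous_pair; first exact: continuous_fst.
    by apply: (@continuous_compT _ L S snd fst); [exact: continuous_snd|exact: continuous_fst].
  by apply: (@continuous_compT _ L PCA snd snd); exact: continuous_snd.
exact: (cr ((c, a), (s, m)) _ h).
Qed.

(* [v] is only assumed continuous on [EL], so it may fail to be measurable. *)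
Definition payoff c a : L -> R := (fun x => v c a x.1 x.2) \_ EL.

Lemma v_cont_on c a : cont_on EL (fun x => v c a x.1 x.2).
Proof.
move=> x Ex e e0; have := v_joint c a Ex e0.
have ci : continuous (fun y : L => ((c, a), y)).
  by apply: continuous_pair; [move=> y; exact: cvg_cst|exact: continuous_idT].
by move=> h; exact: (ci x _ h).
Qed.

Lemma v_bounded c a : exists M, forall x, EL x -> `|v c a x.1 x.2| <= M.
Proof.
have /compact_near_coveringP kE := compact_EL.
have : \forall n \near \oo, EL `<=` (fun x => EL x -> `|v c a x.1 x.2| <= n%:R).
  apply: (kE nat \oo (fun n x => EL x -> `|v c a x.1 x.2| <= n%:R)) => x Ex.
  have [N _ Nx] := nbhs_infty_ger (`|v c a x.1 x.2| + 1).
  exists ([set y | EL y -> `|v c a x.1 x.2 - v c a y.1 y.2| < 1], [set n | (N <= n)%N]).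
    by split; [exact: (@v_cont_on c a x Ex 1 ltr01)|exists N].
  move=> [y n] /= [h Nn] Ey.
  have h1 := h Ey; have h2 := Nx n Nn; rewrite /= in h2.
  have := ler_normB (v c a x.1 x.2) (v c a x.1 x.2 - v c a y.1 y.2).
  by rewrite opprB addrC subrK; lra.
by move=> [n _ /(_ n (leqnn _)) /= h]; exists n%:R => x Ex; exact: h.
Qed.

Lemma bmeas_payoff c a : bmeas (payoff c a).
Proof.
have [M vM] := v_bounded c a.
exact: (bmeas_patch closed_EL (@v_cont_on c a) vM).
Qed.

Lemma payoffE c a x : EL x -> payoff c a x = v c a x.1 x.2.
Proof. by move=> Ex; rewrite /payoff /patch mem_set. Qed.

(** For fixed (c, a) only the measure moves, and [cvg_Ex_patch] applies. Replacing (c, a) by (ci,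
    ai) costs little uniformly over the compact set of consistent outcomes. *)
Lemma cvg_payoff I (F : set_system I) (ci : I -> C) (ai : I -> A) (thi : I -> Prob R L)
    c a th : Filter F -> ci @ F --> c -> ai @ F --> a -> thi @ F --> th ->
  (\forall i \near F, pm (thi i) (EL : set (borel L)) = 1%E) ->
  pm th (EL : set (borel L)) = 1%E ->
  Ex (thi i) (payoff (ci i) (ai i)) @[i --> F] --> Ex th (payoff c a).
Proof.
move=> FF cc aa tt thE EE; apply/cvgrPdist_lt => e e0.
have e20 : 0 < e / 2 by rewrite divr_gt0.
have [M vM] := v_bounded c a.
have h1 := cvg_Ex_patch FF cbL closed_EL (@v_cont_on c a) vM tt thE EE.
have /cvgrPdist_lt/(_ _ e20) {}h1 := h1.
have /compact_near_coveringP kE := compact_EL.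
have h2 : \forall i \near F, EL `<=` (fun x => EL x ->
    `|v c a x.1 x.2 - v (ci i) (ai i) x.1 x.2| < e / 2).
  apply: (kE I F (fun i x => EL x -> `|v c a x.1 x.2 - v (ci i) (ai i) x.1 x.2| < e / 2)) => x Ex.
  have e40 : 0 < e / 4 by rewrite divr_gt0.
  have := v_joint c a Ex e40.
  move=> [[P Q] /= [Pca Qx] PQ].
  have hca : \forall i \near F, P (ci i, ai i).
    have : (fun i => (ci i, ai i)) @ F --> (c, a) by exact: cvg_pairI.
    exact.
  have h := @v_cont_on c a x Ex _ e40.
  exists (Q `&` [set y | EL y -> `|v c a x.1 x.2 - v c a y.1 y.2| < e / 4],
    [set i | P (ci i, ai i)]); first by split => //=; exact: filterI.
  move=> [y i] /= [[Qy hy] Pi] Ey.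
  have := PQ ((ci i, ai i), y) (conj Pi Qy) Ey; have := hy Ey.
  exact: dist_lt_quarters.
apply: filterS2 h1 h2 => i h1 h2.
have b1 := bmeas_payoff c a; have b2 := bmeas_payoff (ci i) (ai i).
have h3 : `|Ex (thi i) (payoff c a) - Ex (thi i) (payoff (ci i) (ai i))| <= e / 2.
  have d x : `|payoff c a x - payoff (ci i) (ai i) x| <= e / 2.
    rewrite /payoff /patch; case: ifPn => [/set_mem Ex|_]; last by rewrite subrr normr0 ltW.
    by apply: ltW; exact: h2.
  have bd := bmeasB b1 b2.
  rewrite -ExB// ler_norml; apply/andP; split.
    rewrite -(Ex_cst (thi i) (- (e / 2))); apply: le_Ex => //; first exact: bmeas_cst.
    by move=> x; have := d x; rewrite ler_norml => /andP[].
  rewrite -(Ex_cst (thi i) (e / 2)); apply: le_Ex => //; first exact: bmeas_cst.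
  by move=> x; have := d x; rewrite ler_norml => /andP[].
exact: dist_lt_halves h1 h3.
Qed.

(** The expected payoff, computed from the law of outcomes so that the integrand [payoff] is
    measurable. For conjectures carried by [consistent_conjectures] it is the integral in [Sof], by
    [value_integral]. *)
Definition value c a (mu : Prob R P2) : R := Ex (pf mu outcome) (payoff c a).

Lemma pf_outcome_full (mu : Prob R P2) : pm mu (E2 : set (borel P2)) = 1%E ->
  pm (pf mu outcome) (EL : set (borel L)) = 1%E.
Proof.
move=> muE; rewrite (pfE measurable_outcome).
have mg : measurable (outcome @^-1` EL : set (borel P2)).
  by have := measurable_outcome measurableT mEL; rewrite setTI.
apply/eqP; rewrite eq_le probability_le1//= -muE le_measure// ?inE//; first exact: mE2.
by move=> x /outcome_E2.
Qed.

Lemma value_integral c a (mu : Prob R P2) : pm mu (E2 : set (borel P2)) = 1%E ->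
  (\int[pm mu]_x (v c a (sigma x.1) (phi x.2))%:E)%E = (value c a mu)%:E.
Proof.
move=> muE; have EE := pf_outcome_full muE.
rewrite /value -ExE; last exact: bmeas_payoff.
have := integral_pf_full measurable_outcome mEL EE (bmeas_payoff c a)
  (g := fun x => v c a x.1 x.2) (fun x Ex => esym (payoffE c a Ex)).
move=> <-; apply: (eq_integral_full mEL (pr_full mEL EE)) => x Ex.
by rewrite payoffE.
Qed.

Lemma cvg_value I (F : set_system I) (ci : I -> C) (ai : I -> A) (mui : I -> Prob R P2)
    c a mu : Filter F -> ci @ F --> c -> ai @ F --> a -> mui @ F --> mu ->
  (\forall i \near F, pm (mui i) (E2 : set (borel P2)) = 1%E) ->
  pm mu (E2 : set (borel P2)) = 1%E ->
  value (ci i) (ai i) (mui i) @[i --> F] --> value c a mu.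
Proof.
move=> FF cc aa mm mE EE; apply: cvg_payoff => //; last exact: pf_outcome_full.
  exact: (cvg_comp _ _ mm (@pf_continuous R P2 L outcome outcome_continuous mu)).
by apply: filterS mE => i; exact: pf_outcome_full.
Qed.

Lemma compact_conjectures : compact [set mu : Prob R P2 | pm mu (E2 : set (borel P2)) = 1%E].
Proof. exact: (compact_full cbP2 compact_E2 closed_E2). Qed.

(** * Selecting closed sets on which the constraint is continuous *)

Variable Acorr : C -> set A.
Hypothesis hAuhc : uhc Acorr.
Hypothesis hAne : forall c, Acorr c !=set0.
Hypothesis hAcpt : forall c, compact (Acorr c).

Definition hit (G : set A) : set C := [set c | Acorr c `&` G !=set0].

(** Upper hemicontinuity, read on complements. *)
Lemma closed_hit G : closed G -> closed (hit G).
Proof.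
move=> cG; rewrite -openC openE => c /= nc.
have [||W [oW [Wc h]]] := hAuhc (x := c) (U := ~` G); first by rewrite openC.
  by move=> a Aa Ga; apply: nc; exists a.
rewrite /interior nbhsE; exists W => // c' Wc' [a [Aa Ga]]; exact: (h c' Wc' a Aa Ga).
Qed.

Lemma closed_Acorr c : closed (Acorr c).
Proof. by apply: compact_closed; [exact: (metrizable_hausdorff hA)|exact: hAcpt]. Qed.

Lemma closed_Acorr_graph : closed [set p : C * A | Acorr p.1 p.2].
Proof.
rewrite -openC openE => -[c a] /= nca.
have [f fb] := cbA; have [cf f01 fU] := fb.
have oN : open (~` Acorr c) by rewrite openC; exact: closed_Acorr.
have [i [fi fiU]] := fU _ _ oN nca.
(* [f i] vanishes on [Acorr c] and is positive at [a]; half its value at [a] separates the two. *)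
pose U := [set x | f i x < f i a / 2].
have oU : open U.
  rewrite -[U]/(f i @^-1` [set r | r < f i a / 2]); apply: open_comp; last exact: open_lt.
  by move=> x _; exact: cf.
have [|W [oW [Wc h]]] := hAuhc (x := c) oU.
  move=> x Ax; rewrite /U /=; apply: contrapT => /negP; rewrite -leNgt => hx.
  by apply: (fiU x _ Ax) => /=; rewrite (lt_le_trans _ hx)// divr_gt0.
have oV : open [set x | f i a / 2 < f i x].
  rewrite -[[set x | _]]/(f i @^-1` [set r | f i a / 2 < r]); apply: open_comp; last exact: open_gt.
  by move=> x _; exact: cf.
exists (W, [set x | f i a / 2 < f i x]) => /=.
  split; apply: open_nbhs_nbhs; split => //=.
  by rewrite ltr_pdivrMr// ltr_pMr// ltr1n.
move=> [c' a'] /= [Wc' fa'] Aa'; have := h c' Wc' a' Aa'.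
by rewrite /U /= => /(lt_trans fa'); rewrite ltxx.
Qed.

(* On [Z] the upper hemicontinuous [Acorr] is also lower hemicontinuous, so that
   Berge's theorem applies there. *)
Definition lhc_on (Z : set C) := closed Z /\ forall (G : set A) c, open G -> Z c ->
  hit G c -> \forall c' \near c, Z c' -> hit G c'.

Lemma closed_set1C (c : C) : closed [set c].
Proof.
have [_ [d [dC _]]] := hC.
rewrite (_ : [set c] = (fun x => d x c) @^-1` [set r | r = 0]).
  by apply: preimage_closed; [move=> x _; exact: (metric_continuous dC)|exact: closed_eq].
apply/seteqP; split => x /=; first by move=> ->; exact: (metric_refl dC).
by case: dC => d0 _ /d0.
Qed.

(** Makes the results over sets of [lhc_on] available at any single c, even one outside the large
    sets of [lusin_lhc]. *)
Lemma lhc_on1 (c : C) : lhc_on [set c].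
Proof.
split; first exact: closed_set1C.
by move=> G _ oG -> h; apply: nearW => _ ->.
Qed.

(* Lower hemicontinuity only fails on the boundary of the closed sets [hit B],
   [B] in a countable family, and each open complement is nearly closed. *)
Lemma lusin_lhc (e : R) : 0 < e -> exists Z, lhc_on Z /\ 1 - e <= pr nu Z.
Proof.
move=> e0; have [f fb] := cbA.
pose B (ij : nat * nat) := [set a | ij.2.+1%:R^-1 <= f ij.1 a].
have cB ij : closed (B ij).
  rewrite -[B ij]/(f ij.1 @^-1` [set r | ij.2.+1%:R^-1 <= r]).
  by apply: preimage_closed; [case: fb => + _ _ x _; exact|exact: closed_ge].
pose H n := if unpickle n is Some ij then hit (B ij) else set0.
have cH n : closed (H n).
  by rewrite /H; case: unpickle => [ij|]; [exact: closed_hit|exact: closed0].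
have en n : 0 < e / (2 ^ n.+1)%:R by rewrite divr_gt0// ltr0n expn_gt0.
have /choice[M MP] : forall n, exists M, [/\ closed M, M `<=` ~` H n &
    pr nu (~` H n `\` M) <= e / (2 ^ n.+1)%:R].
  by move=> n; apply: closed_inner_approx; [exact: cbC|rewrite openC; exact: cH|exact: en].
(* Within [Z] the disjoint closed sets [H n] and [M n] are complementary, so [H n] is relatively
   open there. The complement of [Z] is covered by sets of mass at most e / 2^(n+1), which sum to
   e. *)
pose Z := \bigcap_n (H n `|` M n).
have cZ : closed Z.
  by apply: closed_bigI => n _; apply: closedU; [exact: cH|case: (MP n)].
exists Z; split.
  split => // G c oG Zc [a [Aa Ga]].
  have [ij Ba BG] := base_closed fb oG Ga.
  have Hc : H (pickle ij) c by rewrite /H pickleK; exists a.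
  have [cM MH _] := MP (pickle ij).
  have nM : nbhs c (~` M (pickle ij)).
    by apply: open_nbhs_nbhs; split; [rewrite openC|move=> /MH; exact].
  apply: filterS nM => c' nMc' Zc'; have [|//] := Zc' (pickle ij) I.
  by rewrite /H pickleK => -[a' [Aa' Ba']]; exists a'; split => //; exact: BG.
have mZ : measurable (Z : set (borel C)) by exact: closed_borel.
have : pr nu (~` Z) <= e; last by rewrite pr_setC//; lra.
rewrite -lee_fin -prE; last exact: measurableC.
pose D n : set (borel C) := ~` H n `\` M n.
have mD n : measurable (D n).
  apply: measurableD; last by apply: closed_borel; case: (MP n).
  by apply: measurableC; exact: closed_borel.
have mU : measurable (\bigcup_n D n) by exact: bigcup_measurable.
have -> : (~` Z : set (borel C)) = \bigcup_n D n.
  by rewrite setC_bigcap; apply: eq_bigcupr => n _; rewrite setCU -setDE.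
apply: (le_trans (measure_sigma_subadditive (pm nu) mD mU (@subset_refl _ _))).
apply: (le_trans _ (epsilon_trick0 xpredT (ltW e0))).
have h n : (pm nu (D n) <= (e / (2 ^ n.+1)%:R)%:E)%E.
  by have [_ _] := MP n; rewrite -lee_fin -prE; last exact: mD.
by apply: lee_nneseries => // n _; exact: h.
Qed.
(** * Regular correspondences *)

(* The graph need not be closed, as [Acorr] is only upper hemicontinuous: it is
   closed over the sets of [lhc_on], and weakly Borel measurable everywhere. *)
Definition regular (F : C -> PT -> set A) :=
  [/\ forall Z, lhc_on Z -> closed [set y : Y | Z y.1.1 /\ F y.1.1 y.1.2 y.2],
      forall G, closed G ->
        measurable ([set p : CB | exists2 a, G a & F p.1 p.2 a] : set (borel CB)) &
      forall c b a, F c b a -> Acorr c a].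

Lemma regular_closed F c : regular F -> closed [set q : PT * A | F c q.1 q.2].
Proof.
move=> [Fc _ _]; have := Fc _ (lhc_on1 c) => h.
have : closed ((fun q : PT * A => ((c, q.1), q.2)) @^-1`
  [set y : Y | [set c] y.1.1 /\ F y.1.1 y.1.2 y.2]).
  apply: preimage_closed => // q _; apply: continuous_pair; last exact: continuous_snd.
  by apply: continuous_pair; [move=> z; exact: cvg_cst|exact: continuous_fst].
by congr closed; apply/seteqP; split => q /= => [[]|].
Qed.

Lemma regular_closed_value F c b : regular F -> closed (F c b).
Proof. by move=> rF; exact: (@closed_fibre_r PT A [set q | F c q.1 q.2] b (@regular_closed F c rF)). Qed.

(** The values of F are closed, so a point is off the graph iff some basic open set contains the
    action and misses the value. Basic open sets are countable unions of closed sets, to which the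
    clause of [regular] applies. *)
Lemma measurable_graphS F : regular F -> measurable (graphS F : set (borel Y)).
Proof.
move=> rF; have [_ mF _] := rF; have [f fb] := cbA; have [cf f01 fU] := fb.
pose Up i := [set a | 0 < f i a].
have oO i : open (Up i).
  rewrite -[Up i]/(f i @^-1` [set r | 0 < r]); apply: open_comp; last exact: open_gt.
  by move=> x _; exact: cf.
pose P i : set (borel CB) := [set p | exists2 a, Up i a & F p.1 p.2 a].
have mP i : measurable (P i).
  pose B k := [set a | k.+1%:R^-1 <= f i a].
  have cB k : closed (B k).
    rewrite -[B k]/(f i @^-1` [set r | k.+1%:R^-1 <= r]).
    by apply: preimage_closed; [move=> x _; exact: cf|exact: closed_ge].
  rewrite (_ : P i = \bigcup_k [set p | exists2 a, B k a & F p.1 p.2 a]).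
    by apply: bigcup_measurable => k _; exact: mF.
  apply/seteqP; split => p /=.
    move=> [a fa Fa]; have [k _ /(_ k (leqnn _)) /= ka] := near_infty_natSinv_lt (PosNum fa).
    by exists k => //; exists a => //; exact: ltW.
  move=> [k _ [a Ba Fa]]; exists a => //.
  by rewrite /Up /=; apply: lt_le_trans Ba; rewrite invr_gt0.
have mfst : @measurable_fun _ _ (borel Y) (borel CB) setT fst.
  by apply: continuous_borel; exact: continuous_fst.
have msnd : @measurable_fun _ _ (borel Y) (borel A) setT snd.
  by apply: continuous_borel; exact: continuous_snd.
rewrite -[graphS F]setCK; apply: measurableC.
rewrite (_ : ~` _ = \bigcup_i ((fst @^-1` (~` P i)) `&` (snd @^-1` Up i))).
  apply: bigcup_measurable => i _; apply: measurableI; rewrite -[_ @^-1` _]setTI.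
    by apply: mfst => //; exact: measurableC.
  by apply: msnd => //; exact: open_borel.
apply/seteqP; split => [[p a] /= nF|[p a] [i _ /= [nP Oa] Fa]]; last first.
  by apply: nP; exists a.
have oF : open (~` F p.1 p.2) by rewrite openC; exact: regular_closed_value.
have [i [fa fi]] := fU _ _ oF nF.
by exists i => //; split => //= -[a' fa' Fa']; exact: (fi a' fa').
Qed.

Lemma regular_Acorr : regular (fun c _ => Acorr c).
Proof.
split => // [Z [cZ _]|G cG].
  rewrite (_ : [set y : Y | _] = ((fun y : Y => y.1.1) @^-1` Z) `&`
      ((fun y : Y => (y.1.1, y.2)) @^-1` [set p : C * A | Acorr p.1 p.2])) //.
  apply: closedI; apply: preimage_closed => //.
  - move=> y _; apply: (@continuous_compT Y CB C fst fst); exact: continuous_fst.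
  - by move=> y _; exact: phi_fun_continuous.
  - exact: closed_Acorr_graph.
rewrite (_ : [set p : CB | _] = fst @^-1` (hit G)).
  apply: closed_borel; apply: preimage_closed; last exact: closed_hit.
  by move=> y _; exact: continuous_fst.
by apply/seteqP; split => p /= => [[a Ga Aa]|[a [Aa Ga]]]; exists a.
Qed.

Lemma tau_nu t (Z : set C) : measurable (Z : set (borel C)) ->
  pr (tau t) (fst @^-1` Z) = pr nu Z.
Proof. by move=> mZ; rewrite /pr htaum. Qed.

(** With [Z n] closed of [nu]-mass at least 1 - 1/(n+1), let [D n] be the part of the graph of F
    over [Z n]. Given that k has C-marginal [nu], it has full mass on the graph iff it gives each
    [D n] mass at least 1 - 1/(n+1), and these are closed conditions since [D n] is closed. *)
Lemma closed_graphD F : regular F -> closed (graphD (Dof tau F)).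
Proof.
move=> rF; have [Fc _ _] := rF; have mG := measurable_graphS rF.
have /choice[Z ZP] : forall n : nat, exists Z, lhc_on Z /\ 1 - n.+1%:R^-1 <= pr nu Z.
  by move=> n; apply: lusin_lhc; rewrite invr_gt0.
pose D n := [set y : Y | Z n y.1.1 /\ F y.1.1 y.1.2 y.2].
have cD n : closed (D n) by apply: Fc; case: (ZP n).
rewrite (_ : graphD _ = E2 `&` \bigcap_n (snd @^-1` [set k : PY | 1 - n.+1%:R^-1 <= pr k (D n)])).
  apply: closedI; first exact: closed_E2.
  apply: closed_bigI => n _; apply: preimage_closed; last exact: (closed_pr_ge cbY).
  by move=> x _; exact: continuous_snd.
apply/seteqP; split => -[t k].
  move=> [/= kF kt]; split => // n _ /=.
  have [[cZ _] Zn] := ZP n; apply: (le_trans Zn).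
  have mZ : measurable (Z n : set (borel C)) by exact: closed_borel.
  have mZ' : measurable (fst @^-1` Z n : set (borel CB)).
    by apply: closed_borel; apply: preimage_closed => // x _; exact: continuous_fst.
  have mZ2 : measurable (fst @^-1` (fst @^-1` Z n) : set (borel Y)).
    apply: closed_borel; apply: (@preimage_closed Y CB fst (fst @^-1` Z n)).
      by move=> x _; exact: continuous_fst.
    by apply: preimage_closed => // x _; exact: continuous_fst.
  rewrite -(tau_nu t mZ) /pr -kt//.
  have := measure_setI_full mG (pr_full mG kF) mZ2.
  by move=> <-.
move=> [/= kt kD]; split => //.
rewrite prE//; congr EFin; apply/eqP; rewrite eq_le pr_le1//=.
rewrite leNgt; apply/negP => lt; rewrite -subr_gt0 in lt.
have [n _ /(_ n (leqnn _)) /= nlt] := near_infty_natSinv_lt (PosNum lt).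
have := kD n I => /= h.
have h2 : pr k (D n) <= pr k (graphS F).
  by apply: le_pr => //; [exact: closed_borel|move=> y []].
by move: h h2 nlt; move: (_^-1) => q; lra.
Qed.

Lemma graphD_sub_E2 F : graphD (Dof tau F) `<=` E2.
Proof. by move=> x [_ +]. Qed.

Lemma measurable_graphD F : regular F -> measurable (graphD (Dof tau F) : set (borel P2)).
Proof. by move=> rF; apply: closed_borel; exact: closed_graphD. Qed.

Lemma full_graphD_E2 F (mu : Prob R P2) : regular F ->
  pm mu (graphD (Dof tau F) : set (borel P2)) = 1%E -> pm mu (E2 : set (borel P2)) = 1%E.
Proof.
move=> rF mu1; apply/eqP; rewrite eq_le probability_le1//=; last exact: mE2.
rewrite -mu1 le_measure ?inE//; [exact: measurable_graphD|exact: mE2|exact: graphD_sub_E2].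
Qed.

Definition conjecture F (b : PT) (mu : Prob R P2) :=
  has_marg1 mu b /\ pm mu (graphD (Dof tau F) : set (borel P2)) = 1%E.

Definition optimal c mu a :=
  Acorr c a /\ forall a', Acorr c a' -> value c a' mu <= value c a mu.

Lemma SofP F c b a : regular F ->
  Sof Acorr v sigma (Dof tau F) c b a <-> exists2 mu, conjecture F b mu & optimal c mu a.
Proof.
move=> rF; split.
  move=> [mu [mb [mF [Aa h]]]]; exists mu; [exact: conj|split; [exact: Aa|move=> a' Aa']].
  have mE := full_graphD_E2 rF mF.
  by have := h a' Aa'; rewrite !value_integral// lee_fin.
move=> [mu [mb mF] [Aa h]]; exists mu.
split; [exact: mb|split; [exact: mF|split; [exact: Aa|move=> a' Aa']]].
have mE := full_graphD_E2 rF mF.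
by rewrite !value_integral// lee_fin; exact: h.
Qed.

Lemma cvg_conjecture F I (FI : set_system I) (bi : I -> PT) (mui : I -> Prob R P2) b mu :
  regular F -> ProperFilter FI -> bi @ FI --> b -> mui @ FI --> mu ->
  (\forall i \near FI, conjecture F (bi i) (mui i)) -> conjecture F b mu.
Proof.
move=> rF PF bb mm h; split.
  apply: (cvg_has_marg1 PF cbT mm bb); by apply: filterS h => i [].
apply: (cvg_full PF cbP2 (closed_graphD rF) mm); by apply: filterS h => i [].
Qed.

Lemma conjecture_E2 F b mu : regular F -> conjecture F b mu ->
  pm mu (E2 : set (borel P2)) = 1%E.
Proof. by move=> rF [_ /(full_graphD_E2 rF)]. Qed.

(** * Regularity is preserved by best replies *)

(** The closed-graph half of Berge's theorem. Convergence is tested along filters and not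
    sequences. *)
Lemma closed_optimal_over F Z : regular F -> lhc_on Z ->
  closed [set q : Y * Prob R P2 | [/\ Z q.1.1.1, conjecture F q.1.1.2 q.2 &
                                      optimal q.1.1.1 q.2 q.1.2]].
Proof.
move=> rF [cZ lZ]; set W := [set q | _].
apply: closed_filter => FI p PF FW Fp; have FF : Filter FI by exact: _.
have c1 : continuous (fun q : Y * Prob R P2 => q.1) by exact: continuous_fst.
have cm : continuous (fun q : Y * Prob R P2 => q.2) by exact: continuous_snd.
have c11 : continuous (fun q : Y * Prob R P2 => q.1.1).
  by apply: (continuous_compT c1); exact: continuous_fst.
have ca : continuous (fun q : Y * Prob R P2 => q.1.2).
  by apply: (continuous_compT c1); exact: continuous_snd.
have cc : continuous (fun q : Y * Prob R P2 => q.1.1.1).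
  by apply: (continuous_compT c11); exact: continuous_fst.
have cb : continuous (fun q : Y * Prob R P2 => q.1.1.2).
  by apply: (continuous_compT c11); exact: continuous_snd.
have Fc := cvg_cont FF cc Fp; have Fa := cvg_cont FF ca Fp.
have Fm := cvg_cont FF cm Fp; have Fb := cvg_cont FF cb Fp.
have Zp : Z p.1.1.1 by apply: (cvg_closed PF cc cZ Fp); apply: filterS FW => q [].
have conjp : conjecture F p.1.1.2 p.2.
  by apply: (cvg_conjecture rF PF Fb Fm); apply: filterS FW => q [].
have FE : \forall q \near FI, pm q.2 (E2 : set (borel P2)) = 1%E.
  by apply: filterS FW => q [_ /(conjecture_E2 rF)].
have pE := conjecture_E2 rF conjp.
split => //; split.
  have cca : continuous (fun q : Y * Prob R P2 => (q.1.1.1, q.1.2)) by exact: continuous_pair.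
  by apply: (cvg_closed PF cca closed_Acorr_graph Fp); apply: filterS FW => q [_ _ []].
move=> a' Aa'; rewrite leNgt; apply/negP => lt.
(* [r] lies strictly between the limit payoff and that of the better action a'. *)
have [lr rl] := midf_lt lt; move: ((_ + _) / 2) lr rl => r lr rl.
have h1 : \forall q \near FI, value q.1.1.1 q.1.2 q.2 < r.
  by have /cvgr_lt/(_ _ lr) := cvg_value FF Fc Fa Fm FE pE.
(* The better action need not be feasible at nearby c. Joint continuity keeps the payoff above [r]
   for all actions in a neighbourhood of a', and lower hemicontinuity over [Z] supplies a feasible
   one among them. *)
pose FI2 := filter_prod FI (nbhs a').
have F1 : fst @ FI2 --> FI by exact: cvg_fst.
have F2c : (fun q : (Y * Prob R P2) * A => q.1.1.1.1) @ FI2 --> p.1.1.1.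
  exact: (cvg_comp _ _ F1 Fc).
have F2m : (fun q : (Y * Prob R P2) * A => q.1.2) @ FI2 --> p.2 by exact: (cvg_comp _ _ F1 Fm).
have F2a : snd @ FI2 --> a' by exact: cvg_snd.
have F2E : \forall q \near FI2, pm q.1.2 (E2 : set (borel P2)) = 1%E by exact: (F1 _ FE).
have FF2 : Filter FI2 by exact: _.
have /cvgr_gt/(_ _ rl) := cvg_value FF2 F2c F2a F2m F2E pE.
move=> [[P Q] /= [FP nQ] PQ].
move: nQ; rewrite nbhsE => -[G [oG Ga'] GQ].
have hG : \forall q \near FI, Z q.1.1.1 -> hit G q.1.1.1.
  have hG : hit G p.1.1.1 by exists a'.
  exact: (Fc _ (lZ G _ oG Zp hG)).
have [q [[[[h1q FPq] hGq] [Zq conjq [Aq optq]]]]] :=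
  filter_ex (filterI (filterI (filterI h1 FP) hG) FW).
have [a'' [Aa'' Ga'']] := hGq Zq.
have r_lt := PQ (q, a'') (conj FPq (GQ _ Ga'')).
by have := lt_le_trans r_lt (optq _ Aa'') => /lt_trans/(_ h1q); rewrite ltxx.
Qed.

(** The competitors [H] do not vary with c, so the inequalities pass to the limit by continuity of
    [value] alone, over the whole of C. *)
Lemma closed_near_optimal F (G H : set A) (e : R) : regular F -> closed G ->
  closed [set q : CB * (A * Prob R P2) | [/\ G q.2.1, Acorr q.1.1 q.2.1,
    conjecture F q.1.2 q.2.2 &
    forall a', H a' -> value q.1.1 a' q.2.2 <= value q.1.1 q.2.1 q.2.2 + e]].
Proof.
move=> rF cG; set W := [set q | _].
apply: closed_filter => FI p PF FW Fp; have FF : Filter FI by exact: _.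
have c1 : continuous (fun q : CB * (A * Prob R P2) => q.1) by exact: continuous_fst.
have c2 : continuous (fun q : CB * (A * Prob R P2) => q.2) by exact: continuous_snd.
have cc : continuous (fun q : CB * (A * Prob R P2) => q.1.1).
  by apply: (continuous_compT c1); exact: continuous_fst.
have cb : continuous (fun q : CB * (A * Prob R P2) => q.1.2).
  by apply: (continuous_compT c1); exact: continuous_snd.
have ca : continuous (fun q : CB * (A * Prob R P2) => q.2.1).
  by apply: (continuous_compT c2); exact: continuous_fst.
have cm : continuous (fun q : CB * (A * Prob R P2) => q.2.2).
  by apply: (continuous_compT c2); exact: continuous_snd.
have Fc := cvg_cont FF cc Fp; have Fa := cvg_cont FF ca Fp.
have Fm := cvg_cont FF cm Fp; have Fb := cvg_cont FF cb Fp.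
have conjp : conjecture F p.1.2 p.2.2.
  by apply: (cvg_conjecture rF PF Fb Fm); apply: filterS FW => q [].
have FE : \forall q \near FI, pm q.2.2 (E2 : set (borel P2)) = 1%E.
  by apply: filterS FW => q [_ _ /(conjecture_E2 rF)].
have pE := conjecture_E2 rF conjp.
split => //.
- by apply: (cvg_closed PF ca cG Fp); apply: filterS FW => q [].
- have cca : continuous (fun q : CB * (A * Prob R P2) => (q.1.1, q.2.1)) by exact: continuous_pair.
  by apply: (cvg_closed PF cca closed_Acorr_graph Fp); apply: filterS FW => q [].
- move=> a' Ha'; rewrite -lerBlDl.
  have Fa' : (fun _ : CB * (A * Prob R P2) => a') @ FI --> a' by exact: cvg_cst.
  have h1 := cvg_value FF Fc Fa Fm FE pE; have h2 := cvg_value FF Fc Fa' Fm FE pE.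
  apply: (cvg_upper PF (cvgB h2 h1)); apply: filterS FW => q [_ _ _ h].
  by rewrite lerBlDl; exact: h.
Qed.

Lemma finite_base_cover (f : nat -> A -> R) c (U : set A) : cbase_on f -> open U ->
  Acorr c `<=` U -> exists s : seq nat,
    Acorr c `<=` [set a | exists2 i, i \in s & 0 < f i a] /\
    [set a | exists2 i, i \in s & 0 < f i a] `<=` U.
Proof.
move=> fb oU AU; have [cf f01 fU] := fb.
have := @hAcpt c; rewrite compact_cover => cc.
have [|a Aa|D DU DX] := cc nat [set i | [set a | 0 < f i a] `<=` U] (fun i => [set a | 0 < f i a]).
- move=> i _; rewrite -[[set x | _]]/(f i @^-1` [set r | 0 < r]).
  by apply: open_comp; [move=> x _; exact: cf|exact: open_gt].
- by have [i [fi fiU]] := fU U a oU (AU _ Aa); exists i.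
- exists (finmap.enum_fset D); split.
    by move=> a /DX [i iD fi]; exists i.
  by move=> a [i iD fi]; have /set_mem := DU i iD; apply.
Qed.

Lemma value_open c mu a0 (e : R) : pm mu (E2 : set (borel P2)) = 1%E ->
  open [set a | value c a mu < value c a0 mu + e].
Proof.
move=> muE; rewrite openE => a /= lt.
have Fc : (fun=> c) @ nbhs a --> c by exact: cvg_cst.
have Fm : (fun=> mu) @ nbhs a --> mu by exact: cvg_cst.
have FE : \forall a' \near a, pm mu (E2 : set (borel P2)) = 1%E by exact: nearW.
by have /cvgr_lt/(_ _ lt) := cvg_value (nbhs_filter a) Fc cvg_id Fm FE muE.
Qed.

Lemma regular_Sof F : regular F -> regular (Sof Acorr v sigma (Dof tau F)).
Proof.
move=> rF; split; last by move=> c b a [mu [_ [_ []]]].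
- move=> Z lZ; have := closed_proj compact_conjectures (closed_optimal_over rF lZ).
  congr closed; apply/seteqP; split => y /=.
    by move=> [mu muE [Zy cy oy]]; split => //; apply/SofP => //; exists mu.
  move=> [Zy /(SofP _ _ _ rF) [mu cmu omu]]; exists mu => //.
  exact: (conjecture_E2 rF cmu).
- (* [Sof F (c, b)] meets [G] iff for all [n] some finite union [O'] of basic open
     sets containing [Acorr c], and some conjecture, make an action of [G]
     [1/n]-optimal among [O']; the sets [O'] are countably many. *)
  move=> G cG; have [f fb] := cbA.
  pose O' (s : seq nat) := [set a | exists2 i, i \in s & 0 < f i a].
  have oO' s : open (O' s).
    rewrite (_ : O' s = \bigcup_(i in [set` s]) [set a | 0 < f i a]); last first.
      by apply/seteqP; split => a [i ? ?]; exists i.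
    apply: bigcup_open => i _; rewrite -[[set x | _]]/(f i @^-1` [set r | 0 < r]).
    by apply: open_comp; [case: fb => + _ _ x _; exact|exact: open_gt].
  pose K := [set: A] `*` [set mu : Prob R P2 | pm mu (E2 : set (borel P2)) = 1%E].
  have kK : compact K by apply: compact_setX; [exact: hA.1|exact: compact_conjectures].
  pose W s n := [set q : CB * (A * Prob R P2) | [/\ G q.2.1, Acorr q.1.1 q.2.1,
    conjecture F q.1.2 q.2.2 &
    forall a', O' s a' -> value q.1.1 a' q.2.2 <= value q.1.1 q.2.1 q.2.2 + n.+1%:R^-1]].
  pose P s n := [set p : CB | exists2 am, K am & W s n (p, am)].
  have cP s n : closed (P s n).
    by apply: closed_proj => //; exact: closed_near_optimal.
  pose V s := [set p : CB | Acorr p.1 `<=` O' s].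
  have oV s : open (V s).
    have oc : open [set c | Acorr c `<=` O' s].
      rewrite openE => c /= cO; have [W' [oW' [W'c h]]] := hAuhc (oO' s) cO.
      by rewrite /interior nbhsE; exists W'.
    by apply: (@open_comp CB C fst [set c | Acorr c `<=` O' s]) => // p _; exact: continuous_fst.
  rewrite (_ : [set p : CB | _] = \bigcap_n \bigcup_s (V s `&` P s n)).
    apply: bigcap_measurable => // n _; apply: bigcup_count_measurable => s _.
    by apply: measurableI; [exact: open_borel|exact: closed_borel].
  apply/seteqP; split => -[c b] /=.
    move=> [a Ga /(SofP _ _ _ rF) [mu cmu [Aa omu]]] n _.
    have muE := conjecture_E2 rF cmu.
    have n0 : 0 < n.+1%:R^-1 :> R by rewrite invr_gt0.
    have [|s [AO OU]] := finite_base_cover fb (value_open c a n.+1%:R^-1 muE) (c := c).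
      by move=> a' /omu /= h; rewrite (le_lt_trans h)// ltrDl.
    exists s => //; split => //; exists (a, mu) => //; split => //= a' /OU /= h.
    exact: ltW.
  move=> h.
  (* The finite unions found for different n are unrelated, but each contains [Acorr c]. Comparison
     with [Acorr c] alone gives nested sets, whose common point is exactly optimal. *)
  pose W' n := [set q : CB * (A * Prob R P2) | [/\ G q.2.1, Acorr q.1.1 q.2.1,
    conjecture F q.1.2 q.2.2 &
    forall a', Acorr c a' -> value q.1.1 a' q.2.2 <= value q.1.1 q.2.1 q.2.2 + n.+1%:R^-1]].
  pose B n := [set am | W' n ((c, b), am)].
  have cB n : closed (B n).
    have cW : closed (W' n) by exact: closed_near_optimal.
    have := @closed_fibre_r CB (A * Prob R P2)%type (W' n) (c, b) cW.
    by [].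
  have BK n : B n `<=` K by move=> [a mu] [_ _ /(conjecture_E2 rF)].
  have BS n : B n.+1 `<=` B n.
    move=> [a mu] [Ga Aa cmu h']; split => // a' Aa'; apply: (le_trans (h' a' Aa')).
    by rewrite lerD2l lef_pV2 ?posrE// ler_nat.
  have B0 n : B n !=set0.
    have [s _ [AO [[a mu] _ [Ga Aa cmu h']]]] := h n I.
    by exists (a, mu); split => // a' Aa'; apply: h'; exact: AO.
  have [[a mu] Ba] := nested_compact kK cB BK BS B0.
  have [Ga Aa cmu _] := Ba 0%N; exists a => //; apply/SofP => //; exists mu => //.
  split => // a' Aa'; rewrite leNgt; apply/negP => lt; rewrite -subr_gt0 in lt.
  have [n _ /(_ n (leqnn _)) /= nlt] := near_infty_natSinv_lt (PosNum lt).
  have [_ _ _ /(_ a' Aa') /=] := Ba n.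
  by rewrite -lerBlDl => /le_lt_trans/(_ nlt); rewrite ltxx.
Qed.

Lemma Sof_sub F F' : regular F -> regular F' -> (forall c b, F c b `<=` F' c b) ->
  forall c b, Sof Acorr v sigma (Dof tau F) c b `<=` Sof Acorr v sigma (Dof tau F') c b.
Proof.
move=> rF rF' FF' c b a /(SofP _ _ _ rF) [mu [mb m1] omu]; apply/SofP => //.
exists mu => //; split => //.
apply/eqP; rewrite eq_le probability_le1//=; last exact: measurable_graphD.
rewrite -m1 le_measure ?inE//; [exact: measurable_graphD|exact: measurable_graphD|].
move=> [t k] [/= kF kt]; split => //=.
apply/eqP; rewrite eq_le probability_le1//=; last exact: measurable_graphS.
rewrite -kF le_measure ?inE//; [exact: measurable_graphS|exact: measurable_graphS|].
by move=> [[c' b'] a']; exact: FF'.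
Qed.

Local Notation S_ := (Sm Acorr v sigma tau).

Lemma regular_Sm n : regular (S_ n).
Proof. by elim: n => [|n IH]; [exact: regular_Acorr|exact: regular_Sof]. Qed.

Lemma Sm_decr n c b : S_ n.+1 c b `<=` S_ n c b.
Proof.
elim: n c b => [|n IH] c b; first by move=> a [mu [_ [_ []]]].
exact: (Sof_sub (regular_Sm n.+1) (regular_Sm n) IH).
Qed.

(** By compactness of A, the decreasing intersection of the rounds meets a closed G iff every round
    does. *)
Lemma regular_ICR : regular (ICR Acorr v sigma tau).
Proof.
split; last by move=> c b a /(_ 0%N).
- move=> Z lZ; rewrite (_ : [set y : Y | _] =
      \bigcap_n [set y : Y | Z y.1.1 /\ S_ n y.1.1 y.1.2 y.2]).
    by apply: closed_bigI => n _; have [+ _ _] := regular_Sm n; apply.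
  apply/seteqP; split => y /=; first by move=> [Zy h] n _; split.
  by move=> h; split => [|n]; [have [] := h 0%N I|have [] := h n I].
- move=> G cG; rewrite (_ : [set p : CB | _] =
      \bigcap_n [set p : CB | exists2 a, G a & S_ n p.1 p.2 a]).
    by apply: bigcap_measurable => // n _; have [_ + _] := regular_Sm n; apply.
  apply/seteqP; split => p /=; first by move=> [a Ga h] n _; exists a.
  move=> h; have [|||n|a ha] := @nested_compact A setT (fun n => G `&` S_ n p.1 p.2) hA.1.
  - by move=> n; apply: closedI => //; exact: (@regular_closed_value (S_ n) p.1 p.2 (regular_Sm n)).
  - by [].
  - by move=> n a [Ga Sa]; split => //; exact: Sm_decr.
  - by have [a Ga Sa] := h n I; exists a.
  - by exists a => [|n]; [have [] := ha 0%N|have [] := ha n].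
Qed.

(** The conjectures that justify [a] against round n form decreasing nonempty closed sets in a
    compact space. A common element is carried by the graphs of all rounds, hence by that of their
    intersection. *)
Lemma ICR_sub_Sof c b :
  ICR Acorr v sigma tau c b `<=` Sof Acorr v sigma (Dof tau (ICR Acorr v sigma tau)) c b.
Proof.
move=> a Sa.
pose B n := [set mu | conjecture (S_ n) b mu /\ optimal c mu a].
have gS n : graphD (Dof tau (S_ n.+1)) `<=` graphD (Dof tau (S_ n)).
  move=> [t k] [/= kF kt]; split => //=.
  have mS := measurable_graphS (regular_Sm n); have mS' := measurable_graphS (regular_Sm n.+1).
  apply/eqP; rewrite eq_le probability_le1//= -kF le_measure ?inE//.
  by move=> [[c' b'] a']; exact: Sm_decr.
have [||||mu hmu] := @nested_compact _ _ B compact_conjectures.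
- move=> n; have h := closed_optimal_over (regular_Sm n) (lhc_on1 c).
  have := @closed_fibre_r Y (Prob R P2) _ ((c, b), a) h.
  by congr closed; apply/seteqP; split => mu /= => [[]|[]].
- by move=> n mu [/(conjecture_E2 (regular_Sm n))].
- move=> n mu [[mb m1] omu]; split => //; split => //.
  have mD := measurable_graphD (regular_Sm n).
  have mD' := measurable_graphD (regular_Sm n.+1).
  apply/eqP; rewrite eq_le probability_le1//= -m1 le_measure ?inE//; exact: gS.
- move=> n; have := Sa n.+1 => /(SofP _ _ _ (regular_Sm n)) [mu cmu omu].
  by exists mu.
apply/SofP; first exact: regular_ICR.
exists mu; last by have [] := hmu 0%N.
split; first by have [[]] := hmu 0%N.
rewrite (_ : graphD _ = \bigcap_n graphD (Dof tau (S_ n))).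
  apply: full_bigcap => n; first exact: measurable_graphD (regular_Sm n).
  by have [[]] := hmu n.
apply/seteqP; split => [[t k] [/= kF kt] n _|[t k] h].
  split => //=; have mS := measurable_graphS (regular_Sm n).
  have mI := measurable_graphS regular_ICR.
  apply/eqP; rewrite eq_le probability_le1//= -kF le_measure ?inE//.
  by move=> [[c' b'] a'] /(_ n).
split; last by have [] := h 0%N I.
rewrite /= (_ : graphS _ = \bigcap_n graphS (S_ n)).
  apply: full_bigcap => n; first exact: measurable_graphS (regular_Sm n).
  by have [] := h n I.
by apply/seteqP; split => [[[c' b'] a'] /= h' n _|[[c' b'] a'] h' n]; [exact: h'|exact: (h' n I)].
Qed.

(** * Best replies to pure strategies *)

Section Strategy.
Variable z : C -> PT -> A.
Hypothesis mz : @measurable_fun _ _ (borel CB) (borel A) setT (fun p : CB => z p.1 p.2).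

Definition played (t : T) : PY := zstar z (tau t).

(** The conjecture of a player with belief [b] who expects everyone to follow [z]. *)
Definition pure (b : PT) : Prob R P2 := pf b (fun t => (t, played t)).

Lemma measurable_graph_fun :
  @measurable_fun _ _ (borel CB) (borel Y) setT (fun p : CB => (p, z p.1 p.2)).
Proof. by apply: (measurable_pair_borel cbA); [exact: measurable_id|exact: mz]. Qed.

Lemma played_marg t : has_marg1 (played t) (tau t).
Proof. by move=> B mB; rewrite /played /zstar (pfE measurable_graph_fun). Qed.

Lemma measurable_played : @measurable_fun _ _ (borel T) (borel P2) setT (fun t => (t, played t)).
Proof.
apply: (measurable_pair_borel cbPY); first exact: measurable_id.
have h := measurable_pf cbCB cbY measurable_graph_fun.
exact: (measurableT_comp h (continuous_borel htau)).
Qed.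

Lemma pure_conjecture F b : (forall c b, F c b (z c b)) -> conjecture F b (pure b).
Proof.
move=> Fz; split.
  by move=> B mB; rewrite /pure (pfE measurable_played).
rewrite /pure (pfE measurable_played) (_ : _ @^-1` _ = setT) ?probability_setT//.
apply/seteqP; split => // t _ /=; split; last exact: played_marg.
rewrite /= /played /zstar (pfE measurable_graph_fun) (_ : _ @^-1` _ = setT) ?probability_setT//.
by apply/seteqP; split => // p _ /=; exact: Fz.
Qed.

(** The law in the definition of equilibrium is the law of outcomes under [pure b]. *)
Lemma BNE_optimal : (forall c b, optimal c (pure b) (z c b)) -> BNE Acorr v sigma tau z.
Proof.
move=> zo; split; first exact: mz.
split; first by move=> c b; case: (zo c b).
move=> c b a Aa.
have mo : @measurable_fun _ _ (borel T) (borel L) setT (fun t => (sigma t, phi (zstar z (tau t)))).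
  exact: (measurableT_comp measurable_outcome measurable_played).
have thE : pm (pf b (fun t => (sigma t, phi (zstar z (tau t))))) (EL : set (borel L)) = 1%E.
  rewrite (pfE mo) (_ : _ @^-1` _ = setT) ?probability_setT//.
  apply/seteqP; split => // t _ /=; apply: (outcome_E2 (x := (t, played t))).
  exact: played_marg.
have ev a' : (\int[pm (pf b (fun t => (sigma t, phi (zstar z (tau t)))))]_x
        (v c a' x.1 x.2)%:E)%E = (value c a' (pure b))%:E.
  rewrite (_ : value _ _ _ = Ex (pf b (fun t => (sigma t, phi (zstar z (tau t))))) (payoff c a')).
    rewrite -ExE; last exact: bmeas_payoff.
    by apply: (eq_integral_full mEL (pr_full mEL thE)) => x Ex; rewrite payoffE.
  apply: eq_pr_Ex => B mB; rewrite (pfE mo) (pfE measurable_outcome) /pure.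
  by rewrite (pfE measurable_played).
by rewrite !ev lee_fin; have [_] := zo c b; apply.
Qed.

End Strategy.

(** * Monotone best replies *)

Section Order.
Variables (le : A -> A -> Prop) (jn mt : A -> A -> A).
Hypothesis le_refl : forall a, le a a.
Hypothesis le_anti : forall a b, le a b -> le b a -> a = b.
Hypothesis le_trans : forall a b c, le a b -> le b c -> le a c.
Hypothesis hjn : forall a b, is_lub le [set x | x = a \/ x = b] (jn a b).
Hypothesis hmt : forall a b, is_glb le [set x | x = a \/ x = b] (mt a b).
Hypothesis hjn_cont : continuous (fun p : A * A => jn p.1 p.2).
Hypothesis hsub : forall c a b, Acorr c a -> Acorr c b ->
  Acorr c (jn a b) /\ Acorr c (mt a b).
Hypothesis hsupermod : forall c a b s (mu : Prob R (C * A)%type), has_marg1 mu nu ->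
  v c a s mu + v c b s mu <= v c (jn a b) s mu + v c (mt a b) s mu.
Hypothesis hincdiff : forall c a b s (mu mu' : Prob R (C * A)%type),
  le b a -> has_marg1 mu nu -> has_marg1 mu' nu -> stoch_ge le mu mu' ->
  v c a s mu' - v c b s mu' <= v c a s mu - v c b s mu.

Definition greatest (B : set A) g := B g /\ forall a, B a -> le a g.

Lemma value_supermod c a b mu : pm mu (E2 : set (borel P2)) = 1%E ->
  value c a mu + value c b mu <= value c (jn a b) mu + value c (mt a b) mu.
Proof.
move=> /pf_outcome_full muE; have bp a' := bmeas_payoff c a'.
rewrite /value -!ExD//; apply: (le_Ex_full mEL muE); [exact: bmeasD|exact: bmeasD|].
by move=> x Ex; rewrite !payoffE//; exact: hsupermod.
Qed.

(** Topkis's argument: under [mu] the meet of a and g is no better than a, so by supermodularity the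
    join is no worse than g. Passing to [mu'] only raises the gain of the join over g, which is
    already optimal there. *)
Lemma jn_optimal c mu mu' a g : pm mu (E2 : set (borel P2)) = 1%E ->
  (forall x y, le y x -> value c x mu - value c y mu <= value c x mu' - value c y mu') ->
  optimal c mu a -> optimal c mu' g -> optimal c mu' (jn a g).
Proof.
move=> muE inc [Aa oa] [Ag og]; have [Aj Am] := hsub Aa Ag.
split => // a' Aa'; apply: (Order.POrderTheory.le_trans (og _ Aa')).
have h1 := value_supermod c a g muE; have h2 := oa _ Am; have h3 := inc _ _ (jn_r hjn a g).
rewrite -subr_ge0; apply: Order.POrderTheory.le_trans h3.
move: h1 h2; move: (value c a mu) (value c (mt a g) mu) (value c g mu) (value c (jn a g) mu).
by move=> x y w q; lra.
Qed.

(** The maximizers form a nonempty closed set, stable under joins by [jn_optimal] with both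
    conjectures equal. *)
Lemma exists_greatest_optimal F c b mu : regular F -> conjecture F b mu ->
  exists2 g, optimal c mu g & forall a, optimal c mu a -> le a g.
Proof.
move=> rF cmu; have muE := conjecture_E2 rF cmu.
apply: (exists_greatest le_refl le_anti le_trans hjn hjn_cont hA (B := [set a | optimal c mu a])).
- have h := closed_optimal_over rF (lhc_on1 c).
  have : closed ((fun a : A => (((c, b), a), mu)) @^-1` [set q : Y * Prob R P2 |
      [/\ [set c] q.1.1.1, conjecture F q.1.1.2 q.2 & optimal q.1.1.1 q.2 q.1.2]]).
    apply: preimage_closed h => a _; apply: continuous_pair; last by move=> y; exact: cvg_cst.
    by apply: continuous_pair; [move=> y; exact: cvg_cst|exact: continuous_idT].
  by congr closed; apply/seteqP; split => a /= => [[]|].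
- have [||a /set_mem Aa ha] := @compact_EVT_max A R (fun a => value c a mu) (Acorr c) (hAne c).
  + exact: hAcpt.
  + apply: continuous_subspaceT => a.
    have Fc : (fun=> c) @ nbhs a --> c by exact: cvg_cst.
    have Fm : (fun=> mu) @ nbhs a --> mu by exact: cvg_cst.
    have FE : \forall a' \near a, pm mu (E2 : set (borel P2)) = 1%E by exact: nearW.
    exact: (cvg_value (nbhs_filter a) Fc cvg_id Fm FE muE).
  + by exists a; split => // a' Aa'; apply: ha; exact: mem_set.
- by move=> a a' oa oa'; apply: (jn_optimal muE).
Qed.

(* By increasing differences, replacing the opponents' play by the dominating
   strategy [z] raises the returns to higher actions. *)
Section Dominated.
Variables (z : C -> PT -> A) (F : C -> PT -> set A).
Hypothesis mz : @measurable_fun _ _ (borel CB) (borel A) setT (fun p : CB => z p.1 p.2).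
Hypothesis rF : regular F.
Hypothesis Fz : forall c b, greatest (F c b) (z c b).

(** Both measures have marginal [tau t], and on the graph of F moving the action up to z(c, beta)
    raises a monotone test function while leaving c unchanged. *)
Lemma played_stoch_ge t k : Dof tau F t k -> stoch_ge le (phi (played z t)) (phi k).
Proof.
move=> [kF kt] g mg bg gle; have {}bg : bmeas g by [].
rewrite !ExE// lee_fin /phi !(Ex_pf measurable_phi_fun)//.
have bgz : bmeas (fun p : CB => g (p.1, z p.1 p.2)).
  by have := bmeas_comp measurable_phi_fun bg => /(bmeas_comp (measurable_graph_fun mz)).
rewrite /played /zstar (Ex_pf (measurable_graph_fun mz)); last first.
  exact: (bmeas_comp measurable_phi_fun).
rewrite -(Ex_marg1 kt bgz); apply: (le_Ex_full (measurable_graphS rF) kF).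
- exact: (bmeas_comp measurable_phi_fun).
- apply: (@bmeas_comp R Y CB (fun p => g (p.1, z p.1 p.2)) fst _ bgz).
  by apply: continuous_borel; exact: continuous_fst.
- by move=> y Fy; apply: gle; split => //=; exact: (Fz _ _).2.
Qed.

(** Increasing differences are applied at each (t, k), comparing k with [played z t]; the state t,
    and so its law [b], is the same on both sides. *)
Lemma value_incdiff c b mu a a' : conjecture F b mu -> le a' a ->
  value c a mu - value c a' mu <= value c a (pure z b) - value c a' (pure z b).
Proof.
move=> [mb mF] aa'.
pose d x := payoff c a x - payoff c a' x.
have bd : bmeas d by apply: bmeasB; exact: bmeas_payoff.
have bdo := bmeas_comp measurable_outcome bd.
rewrite /value -!ExB; try exact: bmeas_payoff.
rewrite -/d !(Ex_pf measurable_outcome)// /pure (Ex_pf (measurable_played mz))//.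
rewrite -(Ex_marg1 mb); last exact: (bmeas_comp (measurable_played mz) bdo).
apply: (le_Ex_full (measurable_graphD rF) mF) => //.
  apply: (@bmeas_comp R P2 T (fun t => d (outcome (t, played z t))) fst).
    by apply: continuous_borel; exact: continuous_fst.
  exact: (bmeas_comp (measurable_played mz) bdo).
move=> [t k] /= Dk; have E1 := outcome_E2 (graphD_sub_E2 Dk).
have E2' : EL (outcome (t, played z t)) by apply: outcome_E2; exact: (played_marg mz).
rewrite /d !payoffE//; apply: hincdiff => //; exact: played_stoch_ge.
Qed.

(** Let g be the greatest best reply to [pure z b]. If a is a best reply to some conjecture,
    [jn_optimal] makes the join of a and g a best reply to [pure z b], so it is at most g. *)
Lemma Sof_greatest c b :
  exists2 g, optimal c (pure z b) g & greatest (Sof Acorr v sigma (Dof tau F) c b) g.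
Proof.
have cz : conjecture F b (pure z b) by apply: (pure_conjecture mz) => c' b'; exact: (Fz _ _).1.
have [g og gg] := exists_greatest_optimal c rF cz; exists g => //; split.
  by apply/(SofP _ _ _ rF); exists (pure z b).
move=> a /(SofP _ _ _ rF) [mu cmu oa].
have muE := conjecture_E2 rF cmu.
apply: (le_trans (jn_l hjn a g)); apply: gg.
by apply: (jn_optimal muE _ oa og) => x y; exact: value_incdiff.
Qed.

End Dominated.

(** For up-closed G, the greatest element belongs to G iff some element does. *)
Lemma measurable_greatest F z : regular F -> (forall c b, greatest (F c b) (z c b)) ->
  @measurable_fun _ _ (borel CB) (borel A) setT (fun p : CB => z p.1 p.2).
Proof.
move=> [_ mF _] Fz; have [f fb] := cbA.
apply: (measurable_up_closed le_refl le_anti le_trans hjn hjn_cont hA fb) => G cG uG.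
rewrite (_ : _ @^-1` _ = [set p : CB | exists2 a, G a & F p.1 p.2 a]); first exact: mF.
apply/seteqP; split => p /=; first by move=> Gz; exists (z p.1 p.2) => //; exact: (Fz _ _).1.
by move=> [a Ga Fa]; apply: (uG _ _ Ga); exact: (Fz _ _).2.
Qed.

Lemma Sm_greatest n c b : exists g, greatest (S_ n c b) g.
Proof.
elim: n c b => [|n IH] c b.
  have hj a a' : Acorr c a -> Acorr c a' -> Acorr c (jn a a').
    by move=> Aa Aa'; have [] := hsub Aa Aa'.
  have cAc : closed (Acorr c) by exact: closed_Acorr.
  have [g Ag gg] := exists_greatest le_refl le_anti le_trans hjn hjn_cont hA cAc (hAne c) hj.
  by exists g.
have /choice[z zP] : forall p : CB, exists g, greatest (S_ n p.1 p.2) g by move=> p; exact: IH.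
pose z' c b := z (c, b).
have Fz c' b' : greatest (S_ n c' b') (z' c' b') by exact: (zP (c', b')).
have mz := measurable_greatest (regular_Sm n) Fz.
by have [g _ gg] := Sof_greatest mz (regular_Sm n) Fz c b; exists g.
Qed.

Local Notation I_ := (ICR Acorr v sigma tau).

(** The greatest element of each round is an upper bound of [ICR], so the upper bounds inside round
    n form nested nonempty closed sets; a common point is an upper bound lying in [ICR]. *)
Lemma ICR_greatest c b : exists g, greatest (I_ c b) g.
Proof.
have cle := closed_le_graph le_refl le_anti hjn hjn_cont hA.
pose U := \bigcap_(x in I_ c b) [set a | le x a].
have cU : closed U.
  apply: closed_bigI => x _; have := @closed_fibre_r A A [set p | le p.1 p.2] x cle.
  by [].
have [||||g hg] := @nested_compact A setT (fun n => S_ n c b `&` U) hA.1.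
- by move=> n; apply: closedI => //; exact: (@regular_closed_value (S_ n) c b (regular_Sm n)).
- by [].
- by move=> n a [Sa Ua]; split => //; exact: Sm_decr.
- by move=> n; have [g [Sg gg]] := Sm_greatest n c b; exists g; split => // x /(_ n); exact: gg.
- by exists g; split => [n|x Ix]; [have [] := hg n|have [_ +] := hg 0%N; apply].
Qed.

Lemma Sof_ICR_sub c b : Sof Acorr v sigma (Dof tau I_) c b `<=` I_ c b.
Proof.
move=> a Sa [|n]; first by case: Sa => mu [_ [_ []]].
by apply: (Sof_sub regular_ICR (regular_Sm n)) Sa => c' b' x; exact.
Qed.

(** The supremum is attained. [ICR] and its image under [Sof] have the same greatest element, as
    they include each other, and [Sof_greatest] identifies that of the image as a best reply to the
    supremum strategy. *)
Lemma ICR_sup_BNE : (forall c b, exists a, is_lub le (I_ c b) a) /\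
  forall zh, (forall c b, is_lub le (I_ c b) (zh c b)) -> BNE Acorr v sigma tau zh.
Proof.
split=> [c b|zh zhP].
  by have [g [Ig gg]] := ICR_greatest c b; exists g; split => // x; exact.
have Fz c b : greatest (I_ c b) (zh c b).
  have [g [Ig gg]] := ICR_greatest c b; have [ub lub] := zhP c b.
  have -> : zh c b = g by apply: le_anti; [exact: lub|exact: ub].
  by [].
have mz := measurable_greatest regular_ICR Fz.
apply: (BNE_optimal mz) => c b.
have [g og [Sg gg]] := Sof_greatest mz regular_ICR Fz c b.
have -> : zh c b = g.
  apply: le_anti; first by apply: gg; apply: ICR_sub_Sof; exact: (Fz _ _).1.
  by apply: (Fz _ _).2; exact: Sof_ICR_sub.
exact: og.
Qed.

End Order.

End Payoff.

Theorem theorem2 (R : realType) (C A S T : ptopologicalType)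
  (nu : Prob R C)
  (le : A -> A -> Prop) (jn mt : A -> A -> A)
  (Acorr : C -> set A)
  (v : C -> A -> S -> Prob R (C * A)%type -> R)
  (sigma : T -> S) (tau : T -> Prob R (C * Prob R T)%type)
  (* standing assumptions *)
  (hC : polish R C)
  (hA : compact_metrizable R A)
  (hS : compact_metrizable R S)
  (hT : compact_metrizable R T)
  (hAuhc : uhc Acorr)
  (hAne : forall c, Acorr c !=set0)
  (hAcpt : forall c, compact (Acorr c))
  (hv : {within [set x : C * A * S * Prob R (C * A)%type | has_marg1 x.2 nu],
          continuous (fun x : C * A * S * Prob R (C * A)%type =>
                        v x.1.1.1 x.1.1.2 x.1.2 x.2)})
  (hsigma : continuous sigma)
  (htau : continuous tau)
  (htaum : forall t, has_marg1 (tau t) nu)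
  (* le x y means x \preceq y (y \succeq x); le is a lattice order with continuous join jn and meet mt *)
  (le_refl : forall a, le a a)
  (le_anti : forall a b, le a b -> le b a -> a = b)
  (le_trans : forall a b c, le a b -> le b c -> le a c)
  (hjn : forall a b, is_lub le [set x | x = a \/ x = b] (jn a b))
  (hmt : forall a b, is_glb le [set x | x = a \/ x = b] (mt a b))
  (hjn_cont : continuous (fun p : A * A => jn p.1 p.2))
  (hmt_cont : continuous (fun p : A * A => mt p.1 p.2))
  (* (i) sublattice values *)
  (hsub : forall c a b, Acorr c a -> Acorr c b ->
            Acorr c (jn a b) /\ Acorr c (mt a b))
  (* (ii) supermodularity in a *)
  (hsupermod : forall c a b s (mu : Prob R (C * A)%type), has_marg1 mu nu ->
      v c a s mu + v c b s mu <= v c (jn a b) s mu + v c (mt a b) s mu)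
  (* (iii) increasing differences in (a, mu): for a \succeq b and mu \succeq mu' *)
  (hincdiff : forall c a b s (mu mu' : Prob R (C * A)%type),
      le b a -> has_marg1 mu nu -> has_marg1 mu' nu ->
      stoch_ge le mu mu' ->
      v c a s mu' - v c b s mu' <= v c a s mu - v c b s mu) :
  (forall c b, exists a, is_lub le (ICR Acorr v sigma tau c b) a) /\
  (forall c b, exists a, is_glb le (ICR Acorr v sigma tau c b) a) /\
  (forall zh : C -> Prob R T -> A,
     (forall c b, is_lub le (ICR Acorr v sigma tau c b) (zh c b)) ->
     BNE Acorr v sigma tau zh) /\
  (forall zl : C -> Prob R T -> A,
     (forall c b, is_glb le (ICR Acorr v sigma tau c b) (zl c b)) ->
     BNE Acorr v sigma tau zl).
Proof.
have [lub lubB] := ICR_sup_BNE hC hA hS hT hv hsigma htau htaum hAuhc hAne hAcpt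
  le_refl le_anti le_trans hjn hjn_cont hsub hsupermod hincdiff.
(* The infimum is the supremum for the reversed order, with joins and meets exchanged. *)
pose ge a b := le b a.
have ge_refl a : ge a a by exact: le_refl.
have ge_anti a b : ge a b -> ge b a -> a = b by move=> ab ba; exact: le_anti.
have ge_trans a b c : ge a b -> ge b c -> ge a c by move=> ab bc; exact: le_trans ab.
have hsub' c a b : Acorr c a -> Acorr c b -> Acorr c (mt a b) /\ Acorr c (jn a b).
  by move=> Aa Ab; have [] := hsub c a b Aa Ab.
have hsupermod' c a b s (mu : Prob R (C * A)%type) : has_marg1 mu nu ->
    v c a s mu + v c b s mu <= v c (mt a b) s mu + v c (jn a b) s mu.
  by move=> mm; rewrite [leRHS]addrC; exact: hsupermod.
(* Test functions monotone for the reversed order are the negatives of monotone ones. Increasing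
   differences therefore survive, as the orders on actions and on measures are reversed together. *)
have stoch_ge_flip (mu mu' : Prob R (C * A)%type) : stoch_ge ge mu mu' -> stoch_ge le mu' mu.
  move=> h g mg [M gM] gle; have bg : bmeas g by split => //; exists M.
  have bNg := bmeasN bg; have := h (fun x => - g x) bNg.1 bNg.2.
  rewrite !ExE// !ExN// !lee_fin lerN2; apply => x y [xy yx].
  by rewrite lerN2; apply: gle; split.
have hincdiff' c a b s (mu mu' : Prob R (C * A)%type) : ge b a ->
    has_marg1 mu nu -> has_marg1 mu' nu -> stoch_ge ge mu mu' ->
    v c a s mu' - v c b s mu' <= v c a s mu - v c b s mu.
  move=> ba m m' /stoch_ge_flip h; rewrite -lerN2 !opprB; exact: hincdiff.
have [glb glbB] := ICR_sup_BNE hC hA hS hT hv hsigma htau htaum hAuhc hAne hAcpt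
  ge_refl ge_anti ge_trans hmt hmt_cont hsub' hsupermod' hincdiff'.
by split; [exact: lub|split; [exact: glb|split]].
Qed.
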